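(* For every $\alpha>0$, let $\mathcal{C}_\alpha=X_\alpha(\mathbb{R}^2)\subset \mathrm{Nil}_3$ be the surface defined in the context. Then $\mathcal{C}_\alpha$ is a minimal annulus in $\mathrm{Nil}_3$ with the following properties. 1. For every $c\in\mathbb{R}$, the intersection of $\mathcal{C}_\alpha$ with the vertical plane $\{x_2=c\}$ is a non-empty, closed, embedded, convex curve. Here convexity is meant in the flat plane $\{x_2=c\}$, whose induced metric in the coordinates $(x_1,\,x_3+\tfrac{c}{2}x_1)$ is Euclidean. 2. $\mathcal{C}_\alpha$ is properly embedded. 3. $\mathcal{C}_\alpha$ is invariant under each of the three isometries $(x_1,x_2,x_3)\mapsto(x_1,-x_2,-x_3)$, $(x_1,x_2,x_3)\mapsto(-x_1,x_2,-x_3)$ and $(x_1,x_2,x_3)\mapsto(-x_1,-x_2,x_3)$. These are the rotations of angle $\pi$ around the $x_1$-, $x_2$- and $x_3$-axes. Moreover, the $x_2$-axis is contained in the ''interior'' of $\mathcal{C}_\alpha$: for each $c$, the point $(0,c,0)$ lies in the bounded region of the plane $\{x_2=c\}$ enclosed by the curve $\mathcal{C}_\alpha\cap\{x_2=c\}$. 4. $\mathcal{C}_\alpha$ is conformally equivalent to $\mathbb{C}\setminus\{0\}$.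
   Context: $\mathrm{Nil}_3$ is $\mathbb{R}^3$ with coordinates $(x_1,x_2,x_3)$ and the Riemannian metric $dx_1^2+dx_2^2+\big(dx_3+\tfrac12(x_2\,dx_1-x_1\,dx_2)\big)^2$. A vertical plane is a surface $\{a_1x_1+a_2x_2=b\}$ with $(a_1,a_2)\neq(0,0)$. For $\alpha>0$ and $\theta\in\mathbb{R}$ set $C_{\alpha,\theta}=\frac{\sin(2\theta)}{2\alpha}$ and $P_{\alpha,\theta}(x)=\alpha^2+\cos(2\theta)x^2-C_{\alpha,\theta}^2x^4$. Let $\theta^+_\alpha=\pi/2$ if $\alpha>1$, and $\theta^+_\alpha=\frac12\arccos(1-2\alpha^2)$ if $\alpha\le1$. Set $$L(\alpha,\theta)=\int_{-1}^1\frac{2\alpha C_{\alpha,\theta}^2x^2-\alpha\cos(2\theta)+C_{\alpha,\theta}^2x^2\sqrt{P_{\alpha,\theta}(x)}}{\sqrt{(1-x^2)P_{\alpha,\theta}(x)}\,\big(\alpha+\sqrt{P_{\alpha,\theta}(x)}\big)}\,dx .$$ Let $\theta=\tilde\theta_\alpha$ be the unique $\theta\in(0,\theta^+_\alpha)\cap(0,\pi/4)$ with $L(\alpha,\theta)=0$, and write $C=C_{\alpha,\tilde\theta_\alpha}$. Let $\varphi:\mathbb{R}\to\mathbb{R}$ be the solution of $\varphi'^2=P_{\alpha,\theta}(\cos\varphi)$ with $\varphi(0)=0$ and $\varphi'(0)\le0$. Define functions by $\beta'=C\cos^2\varphi$ with $\beta(0)=0$, and $G'=\frac{C^2\cos^2\varphi-\cos(2\theta)}{\alpha-\varphi'}$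 with $G(0)=0$. For $(u,v)\in\mathbb{R}^2$ put $A=\alpha v+\beta(u)$, and define $X_\alpha(u,v)=(x_1,x_2,x_3)$ by $x_1=\frac{G'(u)}{\alpha}\cos\varphi(u)\sinh A-\frac{C}{\alpha}\sin\varphi(u)\cosh A$, $x_2=Cv-G(u)$, $x_3=-\frac{x_1x_2}{2}+\frac{C}{\alpha}\Big(\frac{G'(u)}{\alpha}-1\Big)\cos\varphi(u)\cosh A-\frac1\alpha\Big(\frac{C^2}{\alpha}+G'(u)\Big)\sin\varphi(u)\sinh A$. The surface $\mathcal{C}_\alpha$ (called the horizontal catenoid of parameter $\alpha$) is the image of $X_\alpha$. *)

(* Defs.v *)
From Stdlib Require Import Reals.
From Coquelicot Require Import Coquelicot.
Open Scope R_scope.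

Definition C_at (alpha theta : R) : R := sin (2 * theta) / (2 * alpha).

Definition P_at (alpha theta x : R) : R :=
  alpha ^ 2 + cos (2 * theta) * x ^ 2 - (C_at alpha theta) ^ 2 * x ^ 4.

Definition theta_plus (alpha : R) : R :=
  if Rlt_dec 1 alpha then PI / 2 else acos (1 - 2 * alpha ^ 2) / 2.

Definition L_integrand (alpha theta x : R) : R :=
  let C := C_at alpha theta in
  let Px := P_at alpha theta x in
  (2 * alpha * C ^ 2 * x ^ 2 - alpha * cos (2 * theta) + C ^ 2 * x ^ 2 * sqrt Px)
  / (sqrt ((1 - x ^ 2) * Px) * (alpha + sqrt Px)).

Definition L_vanishes (alpha theta : R) : Prop :=
  is_RInt_gen (V := R_NormedModule) (L_integrand alpha theta)
    (at_right (-1)) (at_left 1) 0.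

Definition is_theta_tilde (alpha theta : R) : Prop :=
  0 < theta /\ theta < theta_plus alpha /\ theta < PI / 4 /\ L_vanishes alpha theta.

Definition pt := (R * R * R)%type.

Definition X_map (alpha theta : R) (phi beta G : R -> R) (u v : R) : pt :=
  let C := C_at alpha theta in
  let A := alpha * v + beta u in
  let Gp := Derive G u in
  let x1 := Gp / alpha * cos (phi u) * sinh A - C / alpha * sin (phi u) * cosh A in
  let x2 := C * v - G u in
  let x3 := - (x1 * x2) / 2
            + C / alpha * (Gp / alpha - 1) * cos (phi u) * cosh A
            - / alpha * (C ^ 2 / alpha + Gp) * sin (phi u) * sinh A in
  (x1, x2, x3).

Definition co (p : pt) (i : nat) : R :=
  let '(a, b, c) := p in match i with 0%nat => a | 1%nat => b | _ => c end.

Definition upd (p : pt) (i : nat) (t : R) : pt :=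
  let '(a, b, c) := p in
  match i with 0%nat => (t, b, c) | 1%nat => (a, t, c) | _ => (a, b, t) end.

Definition sum3 (f : nat -> R) : R := f 0%nat + f 1%nat + f 2%nat.

(* orthonormal coframe: dx1, dx2, dx3 + (x2 dx1 - x1 dx2)/2 ;
   cof a p i = i-th coefficient of the a-th coframe 1-form at p *)
Definition cof (a : nat) (p : pt) (i : nat) : R :=
  match a with
  | 0%nat => match i with 0%nat => 1 | _ => 0 end
  | 1%nat => match i with 1%nat => 1 | _ => 0 end
  | _ => match i with 0%nat => co p 1 / 2 | 1%nat => - co p 0 / 2 | _ => 1 end
  end.

(* dual orthonormal frame: d1 - (x2/2) d3, d2 + (x1/2) d3, d3 *)
Definition fr (a : nat) (p : pt) (i : nat) : R :=
  match a with
  | 0%nat => match i with 0%nat => 1 | 1%nat => 0 | _ => - co p 1 / 2 end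
  | 1%nat => match i with 0%nat => 0 | 1%nat => 1 | _ => co p 0 / 2 end
  | _ => match i with 2%nat => 1 | _ => 0 end
  end.

Definition gmet (i j : nat) (p : pt) : R := sum3 (fun a => cof a p i * cof a p j).

Definition ginv (i j : nat) (p : pt) : R := sum3 (fun a => fr a p i * fr a p j).

Definition dgm (i j l : nat) (p : pt) : R :=
  Derive (fun t => gmet i j (upd p l t)) (co p l).

Definition Gam (k i j : nat) (p : pt) : R :=
  / 2 * sum3 (fun l => ginv k l p * (dgm j l i p + dgm i l j p - dgm i j l p)).

Definition gdot (p : pt) (a b : nat -> R) : R :=
  sum3 (fun i => sum3 (fun j => gmet i j p * a i * b j)).

Definition comp (Y : R -> R -> pt) (k : nat) (u v : R) : R := co (Y u v) k.
Definition du (f : R -> R -> R) (u v : R) : R := Derive (fun s => f s v) u.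
Definition dv (f : R -> R -> R) (u v : R) : R := Derive (fun t => f u t) v.

Definition Yu Y u v (k : nat) := du (comp Y k) u v.
Definition Yv Y u v (k : nat) := dv (comp Y k) u v.
Definition Yuu Y u v (k : nat) := du (du (comp Y k)) u v.
Definition Yuv Y u v (k : nat) := dv (du (comp Y k)) u v.
Definition Yvv Y u v (k : nat) := dv (dv (comp Y k)) u v.

Definition cross (a b : nat -> R) (k : nat) : R :=
  match k with
  | 0%nat => a 1%nat * b 2%nat - a 2%nat * b 1%nat
  | 1%nat => a 2%nat * b 0%nat - a 0%nat * b 2%nat
  | _ => a 0%nat * b 1%nat - a 1%nat * b 0%nat
  end.

Definition det3 (a b c : nat -> R) : R := sum3 (fun k => cross a b k * c k).

Definition immersion_at (Y : R -> R -> pt) (u v : R) : Prop :=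
  ~ (forall k, cross (Yu Y u v) (Yv Y u v) k = 0).

(* C^1 on a set D (meant to be open) *)
Definition C1_on (D : R -> R -> Prop) (Y : R -> R -> pt) : Prop :=
  forall u v, D u v -> forall k,
    ex_derive (fun s => comp Y k s v) u /\ ex_derive (fun t => comp Y k u t) v /\
    continuity_2d_pt (du (comp Y k)) u v /\ continuity_2d_pt (dv (comp Y k)) u v.

Definition C2_plane (Y : R -> R -> pt) : Prop :=
  forall u v k,
    ex_derive (fun s => comp Y k s v) u /\ ex_derive (fun t => comp Y k u t) v /\
    ex_derive (fun s => du (comp Y k) s v) u /\ ex_derive (fun t => du (comp Y k) u t) v /\
    ex_derive (fun s => dv (comp Y k) s v) u /\ ex_derive (fun t => dv (comp Y k) u t) v /\
    continuity_2d_pt (du (du (comp Y k))) u v /\ continuity_2d_pt (dv (du (comp Y k))) u v /\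
    continuity_2d_pt (du (dv (comp Y k))) u v /\ continuity_2d_pt (dv (dv (comp Y k))) u v.

Definition covd (p : pt) (second a b : nat -> R) (k : nat) : R :=
  second k + sum3 (fun i => sum3 (fun j => Gam k i j p * a i * b j)).

(* mean curvature vanishes at (u,v): the vector
   G D_u Y_u - 2F D_u Y_v + E D_v Y_v (= 2(EG-F^2) H N + tangential part)
   lies in span(Y_u, Y_v) *)
Definition mean_curv_zero_at (Y : R -> R -> pt) (u v : R) : Prop :=
  let p := Y u v in
  let a := Yu Y u v in let b := Yv Y u v in
  let E := gdot p a a in let F := gdot p a b in let Gg := gdot p b b in
  let W := fun k => Gg * covd p (Yuu Y u v) a a k
                    - 2 * F * covd p (Yuv Y u v) a b k
                    + E * covd p (Yvv Y u v) b b k in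
  det3 a b W = 0.

Definition minimal_immersion (Y : R -> R -> pt) : Prop :=
  C2_plane Y /\ forall u v, immersion_at Y u v /\ mean_curv_zero_at Y u v.

Definition image (Y : R -> R -> pt) : pt -> Prop := fun p => exists u v, Y u v = p.

Definition dist3 (p q : pt) : R :=
  sqrt ((co p 0 - co q 0) ^ 2 + (co p 1 - co q 1) ^ 2 + (co p 2 - co q 2) ^ 2).
Definition dist2 (p q : R * R) : R :=
  sqrt ((fst p - fst q) ^ 2 + (snd p - snd q) ^ 2).

Definition closed3 (S : pt -> Prop) : Prop :=
  forall p, (forall eps, 0 < eps -> exists q, S q /\ dist3 p q < eps) -> S p.

Definition homeo_onto (D : R -> R -> Prop) (Y : R -> R -> pt) (S : pt -> Prop) : Prop :=
  (forall u v, D u v -> S (Y u v)) /\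
  (forall q, S q -> exists u v, D u v /\ Y u v = q) /\
  (forall u v u' v', D u v -> D u' v' -> Y u v = Y u' v' -> u = u' /\ v = v') /\
  (forall u v, D u v -> forall eps, 0 < eps -> exists eta, 0 < eta /\
     forall u' v', D u' v' -> dist2 (u', v') (u, v) < eta ->
       dist3 (Y u' v') (Y u v) < eps) /\
  (forall u v, D u v -> forall eps, 0 < eps -> exists eta, 0 < eta /\
     forall u' v', D u' v' -> dist3 (Y u' v') (Y u v) < eta ->
       dist2 (u', v') (u, v) < eps).

Definition embedded_surface (S : pt -> Prop) : Prop :=
  forall p, S p -> exists eps, 0 < eps /\ exists Y : R -> R -> pt,
    let D := fun u v => u ^ 2 + v ^ 2 < 1 in
    C1_on D Y /\ (forall u v, D u v -> immersion_at Y u v) /\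
    homeo_onto D Y (fun q => S q /\ dist3 q p < eps).

Definition properly_embedded (S : pt -> Prop) : Prop :=
  embedded_surface S /\ closed3 S.

Definition conformal_to_punctured_plane (S : pt -> Prop) : Prop :=
  exists Psi : R -> R -> pt,
    let D := fun s t => (s, t) <> (0, 0) in
    C1_on D Psi /\ (forall s t, D s t -> immersion_at Psi s t) /\
    homeo_onto D Psi S /\
    (forall s t, D s t ->
       gdot (Psi s t) (Yu Psi s t) (Yu Psi s t) = gdot (Psi s t) (Yv Psi s t) (Yv Psi s t) /\
       gdot (Psi s t) (Yu Psi s t) (Yv Psi s t) = 0).

Definition convex2 (K : R * R -> Prop) : Prop :=
  forall x y l, K x -> K y -> 0 <= l <= 1 ->
    K (l * fst x + (1 - l) * fst y, l * snd x + (1 - l) * snd y).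

Definition bounded2 (K : R * R -> Prop) : Prop :=
  exists M, forall x, K x -> dist2 x (0, 0) <= M.

Definition interior2 (K : R * R -> Prop) (x : R * R) : Prop :=
  exists r, 0 < r /\ forall y, dist2 y x < r -> K y.

Definition boundary2 (K : R * R -> Prop) (x : R * R) : Prop :=
  forall r, 0 < r ->
    (exists y, dist2 y x < r /\ K y) /\ (exists y, dist2 y x < r /\ ~ K y).

Definition closed_embedded_curve (Gamma : R * R -> Prop) : Prop :=
  exists (T : R) (g1 g2 : R -> R), 0 < T /\
    (forall s, g1 (s + T) = g1 s /\ g2 (s + T) = g2 s) /\
    (forall s, ex_derive g1 s /\ ex_derive g2 s /\
               continuity_pt (Derive g1) s /\ continuity_pt (Derive g2) s /\
               (Derive g1 s, Derive g2 s) <> (0, 0)) /\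
    (forall s s', 0 <= s < T -> 0 <= s' < T -> g1 s = g1 s' -> g2 s = g2 s' -> s = s') /\
    (forall y, Gamma y <-> exists s, y = (g1 s, g2 s)).

Definition convex_curve (Gamma : R * R -> Prop) : Prop :=
  exists K, convex2 K /\ bounded2 K /\ (exists x, interior2 K x) /\
    forall y, boundary2 K y <-> Gamma y.

Definition enclosed_by_convex_curve (Gamma : R * R -> Prop) (q : R * R) : Prop :=
  exists K, convex2 K /\ bounded2 K /\ (forall y, boundary2 K y <-> Gamma y) /\
    interior2 K q.

(* the section S ∩ {x2 = c}, written in the Euclidean coordinates
   (x1, x3 + c x1 / 2) of the flat plane {x2 = c} *)
Definition section (S : pt -> Prop) (c : R) : R * R -> Prop :=
  fun y => exists x1 x3, S (x1, c, x3) /\ y = (x1, x3 + c * x1 / 2).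

Definition rot1 (p : pt) : pt := let '(a, b, c) := p in (a, - b, - c).
Definition rot2 (p : pt) : pt := let '(a, b, c) := p in (- a, b, - c).
Definition rot3 (p : pt) : pt := let '(a, b, c) := p in (- a, - b, c).

(* Main.v *)
(* Write x = cos phi, g = G', A = alpha v + beta. The definitions give g x^2 = alpha + phi' and
   g' = sin phi cos phi (C^2 + g^2); with these, (u, v) are conformal coordinates, the map X is
   harmonic, and the section by {x_2 = c} has velocity ((g^2 + C^2) / C) cosh A (cos phi, - sin phi).
   So its tangent turns monotonically, by 2 pi over a period 2 H of the curve: the curve is closed,
   embedded and convex, and it bounds the intersection of the half-planes cut out by its tangents.
   The substitution x = cos phi turns L = 0 into alpha G(H) + C beta(H) = 0, where phi(H) = - pi,
   which is what makes the sections close up and X invariant under (u, v) |-> (u + 2 H, v - b),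
   b = 2 beta(H) / alpha. The quotient of the complex plane by this translation is conformally C \ {0}.
   Injectivity modulo the period and compactness give continuity of the inverse and closedness. *)

Require Import Defs.
From Stdlib Require Import Reals Lra Lia Psatz ZArith Classical IndefiniteDescription FunctionalExtensionality.
From Coquelicot Require Import Coquelicot.
Open Scope R_scope.

(* Stdlib's [comp] (composition of real functions) would hide the coordinate map of Defs. *)
Local Notation comp := Defs.comp.

(** * Maps of class C^1 on the plane *)

(** The definition of [embedded_surface] asks for a disk chart onto the whole intersection of the
    surface with a Euclidean ball, so restricting [X] to a small parameter disk is not enough. The
    chart is built from a sublevel set of the squared distance in the parameter plane: for an
    immersion this function increases along rays, hence the set is star-shaped, and a radial map
    carries the unit disk onto it. This requires a C^1 calculus in two variables, an implicit
    function and compactness on rectangles. For the surface itself the obstacle is algebraic: the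
    square root of [P] would enter every derivative. It disappears once phi' and G'' are written as
    polynomials in g, cos phi and sin phi, so the geometric section takes these two equations, with
    parity and shift rules, as hypotheses, and they are derived from the differential equation at
    the end. Positivity of [P] on [-1, 1], which comes from theta < theta^+, gives phi' a constant
    sign and makes phi reach - PI in finite time. *)

Lemma is_derive_continuity_pt (f : R -> R) x l : is_derive f x l -> continuity_pt f x.
Proof. intros H. apply derivable_continuous_pt. exists l. now apply is_derive_Reals. Qed.

(** The candidates for the partial derivatives are explicit functions, and total differentiability
    is part of the notion, so that the chain rule holds pointwise and derivatives are compared
    without passing through [Derive]. *)
Definition C1pt (f fu fv : R -> R -> R) (u v : R) : Prop :=
  differentiable_pt_lim f u v (fu u v) (fv u v) /\
  continuity_2d_pt fu u v /\ continuity_2d_pt fv u v.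

Lemma C1pt_cont f fu fv u v : C1pt f fu fv u v -> continuity_2d_pt f u v.
Proof.
  intros [H _]. apply differentiable_continuity_pt.
  exists (fu u v), (fv u v). exact H.
Qed.

Lemma differentiable_is_derive f u v a b : differentiable_pt_lim f u v a b ->
  is_derive (fun s => f s v) u a /\ is_derive (fun t => f u t) v b.
Proof.
  intros H; split.
  - apply is_derive_Reals.
    replace a with (a * 1 + b * 0) by ring.
    apply (derivable_pt_lim_comp_2d f (fun s => s) (fun _ => v)); auto.
    + apply derivable_pt_lim_id.
    + apply derivable_pt_lim_const.
  - apply is_derive_Reals.
    replace b with (a * 0 + b * 1) by ring.
    apply (derivable_pt_lim_comp_2d f (fun _ => u) (fun t => t)); auto.
    + apply derivable_pt_lim_const.
    + apply derivable_pt_lim_id.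
Qed.

Lemma C1pt_derive f fu fv u v : C1pt f fu fv u v ->
  is_derive (fun s => f s v) u (fu u v) /\ is_derive (fun t => f u t) v (fv u v).
Proof. intros [H _]. now apply differentiable_is_derive. Qed.

Lemma continuity_2d_pt_comp f a b u v :
  continuity_2d_pt f (a u v) (b u v) ->
  continuity_2d_pt a u v -> continuity_2d_pt b u v ->
  continuity_2d_pt (fun s t => f (a s t) (b s t)) u v.
Proof.
  intros Hf Ha Hb eps.
  destruct (Hf eps) as [d Hd].
  destruct (Ha d) as [d1 H1]. destruct (Hb d) as [d2 H2].
  exists (mkposreal (Rmin d1 d2) (Rmin_pos _ _ (cond_pos d1) (cond_pos d2))); simpl.
  intros s t Hs Ht. apply Hd.
  - apply H1; eapply Rlt_le_trans; eauto using Rmin_l.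
  - apply H2; eapply Rlt_le_trans; eauto using Rmin_r.
Qed.

Lemma C1pt_comp f fu fv a au av b bu bv u v :
  C1pt f fu fv (a u v) (b u v) -> C1pt a au av u v -> C1pt b bu bv u v ->
  C1pt (fun s t => f (a s t) (b s t))
       (fun s t => fu (a s t) (b s t) * au s t + fv (a s t) (b s t) * bu s t)
       (fun s t => fu (a s t) (b s t) * av s t + fv (a s t) (b s t) * bv s t) u v.
Proof.
  intros Hf Ha Hb.
  assert (ca := C1pt_cont _ _ _ _ _ Ha). assert (cb := C1pt_cont _ _ _ _ _ Hb).
  destruct Hf as [Hf [Hf1 Hf2]], Ha as [Ha [Ha1 Ha2]], Hb as [Hb [Hb1 Hb2]].
  split; [now apply differentiable_pt_lim_comp|].
  split; apply continuity_2d_pt_plus; apply continuity_2d_pt_mult; auto;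
    now apply continuity_2d_pt_comp.
Qed.

Lemma C1pt_ext_loc f fu fv g gu gv u v :
  locally_2d (fun s t => f s t = g s t /\ fu s t = gu s t /\ fv s t = gv s t) u v ->
  C1pt f fu fv u v -> C1pt g gu gv u v.
Proof.
  intros H [H1 [H2 H3]].
  destruct (locally_2d_singleton _ _ _ H) as [_ [E1 E2]].
  rewrite E1, E2 in H1.
  split; [|split].
  - revert H1. apply differentiable_pt_lim_ext.
    revert H. apply locally_2d_impl, locally_2d_forall. tauto.
  - revert H2. apply continuity_2d_pt_ext_loc.
    revert H. apply locally_2d_impl, locally_2d_forall. tauto.
  - revert H3. apply continuity_2d_pt_ext_loc.
    revert H. apply locally_2d_impl, locally_2d_forall. tauto.
Qed.

Lemma C1pt_ext f fu fv g gu gv u v :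
  (forall s t, f s t = g s t) -> (forall s t, fu s t = gu s t) ->
  (forall s t, fv s t = gv s t) ->
  C1pt f fu fv u v -> C1pt g gu gv u v.
Proof. intros. eapply C1pt_ext_loc; eauto. apply locally_2d_forall; auto. Qed.

(** The usual sufficient condition for differentiability, in its asymmetric form: only the first
    partial derivative has to exist around the point. *)
Lemma C1pt_intro (f fu fv : R -> R -> R) (u v : R) :
  locally_2d (fun s t => is_derive (fun z => f z t) s (fu s t)) u v ->
  is_derive (fun z => f u z) v (fv u v) ->
  continuity_2d_pt fu u v -> continuity_2d_pt fv u v -> C1pt f fu fv u v.
Proof.
  intros Hu Hv Cu Cv. split; [|split]; auto.
  apply filterdiff_differentiable_pt_lim.
  apply (is_derive_filterdiff f u v fu (fv u v)).
  - exact (proj1 (locally_2d_locally _ u v) Hu).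
  - exact Hv.
  - now apply continuity_2d_pt_filterlim.
Qed.

Lemma C1pt_const c u v : C1pt (fun _ _ => c) (fun _ _ => 0) (fun _ _ => 0) u v.
Proof.
  apply C1pt_intro; try apply continuity_2d_pt_const.
  - apply locally_2d_forall; intros. apply @is_derive_const.
  - apply @is_derive_const.
Qed.

Lemma C1pt_fst u v : C1pt (fun s _ => s) (fun _ _ => 1) (fun _ _ => 0) u v.
Proof.
  apply C1pt_intro; try apply continuity_2d_pt_const.
  - apply locally_2d_forall; intros. apply @is_derive_id.
  - apply @is_derive_const.
Qed.

Lemma C1pt_snd u v : C1pt (fun _ t => t) (fun _ _ => 0) (fun _ _ => 1) u v.
Proof.
  apply C1pt_intro; try apply continuity_2d_pt_const.
  - apply locally_2d_forall; intros. apply @is_derive_const.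
  - apply @is_derive_id.
Qed.

(** Sums, products and compositions with a function of one variable are all obtained from the chain
    rule [C1pt_comp]. *)
Lemma C1pt_plus a au av b bu bv u v :
  C1pt a au av u v -> C1pt b bu bv u v ->
  C1pt (fun s t => a s t + b s t) (fun s t => au s t + bu s t)
       (fun s t => av s t + bv s t) u v.
Proof.
  intros Ha Hb.
  eapply C1pt_ext; [| | | eapply (C1pt_comp (fun x y => x + y) (fun _ _ => 1) (fun _ _ => 1));
    [ | exact Ha | exact Hb]]; intros; simpl; try ring.
  apply C1pt_intro; try apply continuity_2d_pt_const.
  - apply locally_2d_forall; intros. auto_derive; auto; ring.
  - auto_derive; auto; ring.
Qed.

Lemma C1pt_mult a au av b bu bv u v :
  C1pt a au av u v -> C1pt b bu bv u v ->
  C1pt (fun s t => a s t * b s t) (fun s t => au s t * b s t + a s t * bu s t)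
       (fun s t => av s t * b s t + a s t * bv s t) u v.
Proof.
  intros Ha Hb.
  eapply C1pt_ext; [| | | eapply (C1pt_comp (fun x y => x * y) (fun _ y => y) (fun x _ => x));
    [ | exact Ha | exact Hb]]; intros; simpl; try ring.
  apply C1pt_intro; try apply continuity_2d_pt_id1; try apply continuity_2d_pt_id2.
  - apply locally_2d_forall; intros. auto_derive; auto; ring.
  - auto_derive; auto; ring.
Qed.

Lemma C1pt_comp1 (f f' : R -> R) (a au av : R -> R -> R) (u v : R) :
  locally (a u v) (fun x => is_derive f x (f' x)) -> continuity_pt f' (a u v) ->
  C1pt a au av u v ->
  C1pt (fun s t => f (a s t)) (fun s t => f' (a s t) * au s t)
       (fun s t => f' (a s t) * av s t) u v.
Proof.
  intros Hf Cf Ha.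
  eapply C1pt_ext; [| | | eapply (C1pt_comp (fun x _ => f x) (fun x _ => f' x) (fun _ _ => 0));
    [ | exact Ha | exact Ha]]; intros; simpl; try ring.
  apply C1pt_intro; try apply continuity_2d_pt_const.
  - destruct Hf as [d Hd]. exists d. intros. now apply Hd.
  - apply @is_derive_const.
  - apply (continuity_1d_2d_pt_comp f' (fun x _ => x)); auto using continuity_2d_pt_id1.
Qed.

Definition open2 (D : R -> R -> Prop) := forall u v, D u v -> locally_2d D u v.

(** Continuity of [du f] at (u, v) involves its values at neighbouring points; openness of [D] lets
    it be replaced by [fu] there. *)
Lemma C1pt_du_dv (D : R -> R -> Prop) f fu fv : open2 D ->
  (forall u v, D u v -> C1pt f fu fv u v) ->
  forall u v, D u v ->
    ex_derive (fun s => f s v) u /\ ex_derive (fun t => f u t) v /\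
    continuity_2d_pt (du f) u v /\ continuity_2d_pt (dv f) u v /\
    du f u v = fu u v /\ dv f u v = fv u v.
Proof.
  intros HD H u v Duv.
  assert (E : forall u v, D u v -> du f u v = fu u v /\ dv f u v = fv u v).
  { intros s t Dst. destruct (C1pt_derive _ _ _ _ _ (H s t Dst)) as [H1 H2].
    split; [exact (is_derive_unique _ _ _ H1)|exact (is_derive_unique _ _ _ H2)]. }
  destruct (C1pt_derive _ _ _ _ _ (H u v Duv)) as [H1 H2].
  destruct (H u v Duv) as [_ [C1 C2]].
  split; [eexists; exact H1|]. split; [eexists; exact H2|].
  repeat split; try apply E; auto.
  - revert C1. apply continuity_2d_pt_ext_loc.
    generalize (HD u v Duv). apply locally_2d_impl, locally_2d_forall.
    intros s t Dst. symmetry. now apply E.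
  - revert C2. apply continuity_2d_pt_ext_loc.
    generalize (HD u v Duv). apply locally_2d_impl, locally_2d_forall.
    intros s t Dst. symmetry. now apply E.
Qed.

(** * Compactness and distances *)

Lemma rectangle_pos_lower_bound (F : R -> R -> R) a b a' b' :
  (forall x y, a <= x <= b -> a' <= y <= b' -> continuity_2d_pt F x y) ->
  (forall x y, a <= x <= b -> a' <= y <= b' -> 0 < F x y) ->
  exists d, 0 < d /\ forall x y, a <= x <= b -> a' <= y <= b' -> d <= F x y.
Proof.
  intros HC HP.
  (* Around each point of the rectangle one number serves both as radius and as lower bound for [F];
     compactness then bounds these numbers below by a common [d]. Outside the rectangle the value 1
     is a default. *)
  destruct (functional_choice (fun (z : R * R) (d : posreal) =>
    a <= fst z <= b -> a' <= snd z <= b' ->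
    forall x y, Rabs (x - fst z) < d -> Rabs (y - snd z) < d -> d <= F x y))
    as [delta Hd].
  { intros [u v]; simpl.
    destruct (classic (a <= u <= b /\ a' <= v <= b')) as [[Hu Hv]|N].
    2: { exists (mkposreal 1 Rlt_0_1). intros; tauto. }
    assert (P := HP u v Hu Hv).
    assert (P2 : 0 < F u v / 2) by lra.
    destruct (HC u v Hu Hv (mkposreal _ P2)) as [d H]. simpl in H.
    exists (mkposreal (Rmin d (F u v / 2)) (Rmin_pos _ _ (cond_pos d) P2)). simpl.
    intros _ _ x y Hx Hy.
    assert (Rmin d (F u v / 2) <= d) by apply Rmin_l.
    assert (Rmin d (F u v / 2) <= F u v / 2) by apply Rmin_r.
    assert (H3 := H x y ltac:(lra) ltac:(lra)).
    apply Rabs_def2 in H3. lra. }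
  destruct (compactness_value_2d a b a' b' (fun u v => delta (u, v))) as [d H].
  exists d. split; [apply cond_pos|].
  intros x y Hx Hy. apply NNPP. intro N. apply (H x y Hx Hy).
  intros [u [v [Hu [Hv [H1 [H2 H3]]]]]]. apply N.
  eapply Rle_trans; [exact H3|]. exact (Hd (u, v) Hu Hv x y H1 H2).
Qed.

Lemma segment_pos_lower_bound (f : R -> R) a b :
  (forall x, continuity_pt f x) -> (forall x, 0 < f x) ->
  exists d, 0 < d /\ forall x, a <= x <= b -> d <= f x.
Proof.
  intros HC HP.
  destruct (rectangle_pos_lower_bound (fun x _ => f x) a b 0 0) as [d [Hd H]]; auto.
  - intros x y _ _. apply (continuity_1d_2d_pt_comp f (fun x _ => x)); auto using continuity_2d_pt_id1.
  - exists d. split; auto. intros x Hx. apply (H x 0); lra.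
Qed.

Lemma continuity_2d_pt_dist3 (Z : R -> R -> pt) p u v :
  (forall k, continuity_2d_pt (comp Z k) u v) ->
  continuity_2d_pt (fun s t => dist3 (Z s t) p) u v.
Proof.
  intros H. unfold dist3.
  apply (continuity_1d_2d_pt_comp sqrt).
  - apply continuity_pt_filterlim. apply continuous_sqrt.
  - assert (Q : forall k c, continuity_2d_pt (fun s t => (co (Z s t) k - c) ^ 2) u v).
    { intros k c.
      apply (continuity_1d_2d_pt_comp (fun x => (x - c) ^ 2)); [|apply H].
      apply continuity_pt_filterlim. apply (@ex_derive_continuous _ R_NormedModule). auto_derive; auto. }
    repeat apply continuity_2d_pt_plus; apply Q.
Qed.

Lemma continuity_2d_pt_dist2 p u v :
  continuity_2d_pt (fun s t => dist2 (s, t) p) u v.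
Proof.
  unfold dist2; simpl fst; simpl snd.
  apply (continuity_1d_2d_pt_comp sqrt).
  - apply continuity_pt_filterlim. apply continuous_sqrt.
  - apply continuity_2d_pt_plus.
    + apply (continuity_1d_2d_pt_comp (fun x => (x - fst p) ^ 2) (fun s _ => s)); [|apply continuity_2d_pt_id1].
      apply continuity_pt_filterlim. apply (@ex_derive_continuous _ R_NormedModule). auto_derive; auto.
    + apply (continuity_1d_2d_pt_comp (fun x => (x - snd p) ^ 2) (fun _ t => t)); [|apply continuity_2d_pt_id2].
      apply continuity_pt_filterlim. apply (@ex_derive_continuous _ R_NormedModule). auto_derive; auto.
Qed.

Lemma continuity_2d_pt_Rmax f g u v :
  continuity_2d_pt f u v -> continuity_2d_pt g u v ->
  continuity_2d_pt (fun s t => Rmax (f s t) (g s t)) u v.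
Proof.
  intros Hf Hg eps.
  generalize (locally_2d_and _ _ _ _ (Hf eps) (Hg eps)).
  apply locally_2d_impl, locally_2d_forall. intros s t [H1 H2].
  apply Rabs_def2 in H1. apply Rabs_def2 in H2.
  unfold Rmax. do 2 destruct Rle_dec; apply Rabs_def1; lra.
Qed.

Lemma dist3_nonneg p q : 0 <= dist3 p q.
Proof. apply sqrt_pos. Qed.

Lemma dist3_eq0 p q : dist3 p q = 0 -> p = q.
Proof.
  unfold dist3. intros H. apply sqrt_eq_0 in H; [|repeat apply Rplus_le_le_0_compat; apply pow2_ge_0].
  destruct p as [[a b] c], q as [[a' b'] c']. simpl in H.
  assert (Q : forall x, x ^ 2 = 0 -> x = 0) by (intros x Hx; apply Rsqr_0_uniq; unfold Rsqr; lra).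
  assert (Ha := pow2_ge_0 (a - a')). assert (Hb := pow2_ge_0 (b - b')). assert (Hc := pow2_ge_0 (c - c')).
  assert (a - a' = 0) by (apply Q; lra). assert (b - b' = 0) by (apply Q; lra).
  assert (c - c' = 0) by (apply Q; lra).
  replace a' with a by lra. replace b' with b by lra. now replace c' with c by lra.
Qed.

Lemma dist3_refl p : dist3 p p = 0.
Proof. unfold dist3. rewrite <- sqrt_0. f_equal. ring. Qed.

Lemma dist3_sym p q : dist3 p q = dist3 q p.
Proof. unfold dist3. f_equal. ring. Qed.

Lemma dist2_refl p : dist2 p p = 0.
Proof. unfold dist2. rewrite <- sqrt_0. f_equal. ring. Qed.

Lemma dist2_coord p q : Rabs (fst p - fst q) <= dist2 p q /\ Rabs (snd p - snd q) <= dist2 p q.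
Proof.
  unfold dist2. rewrite <- !sqrt_Rsqr_abs. unfold Rsqr.
  assert (Ha := pow2_ge_0 (fst p - fst q)). assert (Hb := pow2_ge_0 (snd p - snd q)).
  split; apply sqrt_le_1_alt; lra.
Qed.

Lemma dist2_le_abs p q : dist2 p q <= Rabs (fst p - fst q) + Rabs (snd p - snd q).
Proof.
  unfold dist2. assert (A := Rabs_pos (fst p - fst q)). assert (B := Rabs_pos (snd p - snd q)).
  rewrite <- (sqrt_pow2 (Rabs (fst p - fst q) + Rabs (snd p - snd q))) by lra. apply sqrt_le_1_alt.
  rewrite <- (pow2_abs (fst p - fst q)), <- (pow2_abs (snd p - snd q)). nra.
Qed.

Lemma dist3_coord p q k : Rabs (co p k - co q k) <= dist3 p q.
Proof.
  unfold dist3. rewrite <- sqrt_Rsqr_abs. unfold Rsqr. apply sqrt_le_1_alt.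
  destruct p as [[a b] c], q as [[a' b'] c'].
  assert (Ha := pow2_ge_0 (a - a')). assert (Hb := pow2_ge_0 (b - b')). assert (Hc := pow2_ge_0 (c - c')).
  destruct k as [|[|k]]; simpl in *; lra.
Qed.

Lemma continuity_2d_pt_dist f u v :
  continuity_2d_pt f u v <->
  forall eps, 0 < eps -> exists eta, 0 < eta /\ forall s t, dist2 (s, t) (u, v) < eta ->
    Rabs (f s t - f u v) < eps.
Proof.
  split.
  - intros H eps He. destruct (H (mkposreal _ He)) as [d Hd].
    exists d. split; [apply cond_pos|]. intros s t Hst.
    destruct (dist2_coord (s, t) (u, v)) as [H1 H2]. simpl in H1, H2.
    apply Hd; lra.
  - intros H eps. destruct (H eps (cond_pos eps)) as [eta [He Hd]].
    assert (He2 : 0 < eta / 2) by lra.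
    exists (mkposreal _ He2). simpl. intros s t Hs Ht. apply Hd.
    eapply Rle_lt_trans; [apply dist2_le_abs|]. simpl. lra.
Qed.

(** Add the distance to [p], the positive part of [eps] minus the distance to (u0, v0), and the
    positive part of [K]. The sum vanishes nowhere on the rectangle, and its lower bound is the
    required [eta]. The condition [K <= 0] cuts out a compact subset, for instance a closed disk. *)
Lemma inverse_continuous_on_compact (Z : R -> R -> pt) (K : R -> R -> R) p a b a' b' u0 v0 :
  (forall x y, a <= x <= b -> a' <= y <= b' ->
     (forall k, continuity_2d_pt (comp Z k) x y) /\ continuity_2d_pt K x y) ->
  (forall x y, a <= x <= b -> a' <= y <= b' -> K x y <= 0 -> Z x y = p -> x = u0 /\ y = v0) ->
  forall eps, 0 < eps -> exists eta, 0 < eta /\ forall x y, a <= x <= b -> a' <= y <= b' ->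
    K x y <= 0 -> dist3 (Z x y) p < eta -> dist2 (x, y) (u0, v0) < eps.
Proof.
  intros HC HI eps He.
  destruct (rectangle_pos_lower_bound (fun x y =>
     (dist3 (Z x y) p + Rmax 0 (eps - dist2 (x, y) (u0, v0))) + Rmax 0 (K x y)) a b a' b') as [d [Hd H]].
  - intros x y Hx Hy. destruct (HC x y Hx Hy) as [HZ HK].
    repeat apply continuity_2d_pt_plus.
    + now apply continuity_2d_pt_dist3.
    + apply continuity_2d_pt_Rmax; [apply continuity_2d_pt_const|].
      apply continuity_2d_pt_minus; [apply continuity_2d_pt_const|apply continuity_2d_pt_dist2].
    + apply continuity_2d_pt_Rmax; [apply continuity_2d_pt_const|auto].
  - intros x y Hx Hy.
    assert (A := dist3_nonneg (Z x y) p).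
    assert (B := Rmax_l 0 (eps - dist2 (x, y) (u0, v0))).
    assert (C := Rmax_l 0 (K x y)).
    destruct (Rle_or_lt (K x y) 0) as [L|L].
    2: { assert (D := Rmax_r 0 (K x y)). lra. }
    destruct (Req_dec (dist3 (Z x y) p) 0) as [E|E]; [|lra].
    destruct (HI x y Hx Hy L (dist3_eq0 _ _ E)) as [-> ->].
    assert (D := Rmax_r 0 (eps - dist2 (u0, v0) (u0, v0))).
    rewrite dist2_refl in *. lra.
  - exists d. split; auto. intros x y Hx Hy HK Hlt.
    assert (L := H x y Hx Hy). simpl in L.
    rewrite (Rmax_left 0 (K x y)) in L by lra.
    unfold Rmax in L. destruct Rle_dec; lra.
Qed.

(** * Embedded surfaces from immersions *)

Lemma incr_MVT (f f' : R -> R) a b : a < b ->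
  (forall x, a <= x <= b -> is_derive f x (f' x)) ->
  (forall x, a < x < b -> 0 < f' x) -> f a < f b.
Proof.
  intros Hab Hd Hp.
  destruct (MVT_cor2 f f' a b Hab) as [c [E Hc]].
  - intros c Hc. apply is_derive_Reals. now apply Hd.
  - assert (0 < f' c * (b - a)) by (apply Rmult_lt_0_compat; [apply Hp|]; lra). lra.
Qed.

(** Implicit differentiation along a level curve known to be continuous: the first order expansion
    of [F] at one point forces the increment of [g] to be [- l2 / l1] times that of x, up to smaller
    terms. *)
Lemma implicit_is_derive (F : R -> R -> R) (g : R -> R) x0 l1 l2 c :
  differentiable_pt_lim F (g x0) x0 l1 l2 -> l1 <> 0 -> continuity_pt g x0 ->
  locally x0 (fun x => F (g x) x = c) -> is_derive g x0 (- l2 / l1).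
Proof.
  intros HF Hl Hg Hc. apply is_derive_Reals. intros eps Heps.
  assert (L1 : 0 < Rabs l1) by now apply Rabs_pos_lt.
  assert (L2 := Rabs_pos l2).
  (* A first estimate, with relative error at most |l1| / 2, bounds the increment of [g] by K |h|;
     the second term of the minimum below then makes the error on the quotient at most eps / 2. *)
  set (K := 2 * (Rabs l2 + Rabs l1) / Rabs l1).
  assert (HK : 0 < K).
  { unfold K. apply Rdiv_lt_0_compat; lra. }
  assert (E1 : 0 < Rmin (Rabs l1 / 2) (eps * Rabs l1 / (2 * (K + 1)))).
  { apply Rmin_pos; [lra|]. apply Rdiv_lt_0_compat; [|lra]. now apply Rmult_lt_0_compat. }
  set (e := mkposreal _ E1).
  destruct (HF e) as [d Hd].
  destruct Hc as [d1 Hd1].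
  apply continuity_pt_filterlim in Hg.
  destruct (proj1 (filterlim_locally g (g x0)) Hg d) as [d2 Hd2].
  assert (Hpos : 0 < Rmin d (Rmin d1 d2)).
  { repeat apply Rmin_pos; apply cond_pos. }
  exists (mkposreal _ Hpos). simpl. intros h Hh0 Hh.
  assert (M1 := Rmin_l d (Rmin d1 d2)). assert (M2 := Rmin_r d (Rmin d1 d2)).
  assert (M3 := Rmin_l d1 d2). assert (M4 := Rmin_r d1 d2).
  assert (Hx : Rabs (x0 + h - x0) = Rabs h) by (f_equal; ring).
  assert (Q : Rabs (F (g (x0 + h)) (x0 + h) - F (g x0) x0 - (l1 * (g (x0 + h) - g x0) + l2 * (x0 + h - x0)))
    <= e * Rmax (Rabs (g (x0 + h) - g x0)) (Rabs (x0 + h - x0))).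
  { apply Hd.
    - assert (B := Hd2 (x0 + h)). apply B. unfold ball; simpl; unfold AbsRing_ball; simpl.
      unfold abs, minus, plus, opp; simpl. replace (x0 + h + - x0) with h by ring. lra.
    - rewrite Hx. lra. }
  rewrite (Hd1 (x0 + h)), (Hd1 x0) in Q.
  2: apply ball_center.
  2: { unfold ball; simpl; unfold AbsRing_ball; simpl.
      unfold abs, minus, plus, opp; simpl. replace (x0 + h + - x0) with h by ring. lra. }
  replace (x0 + h - x0) with h in Q by ring.
  set (k := g (x0 + h) - g x0) in *.
  replace (c - c - (l1 * k + l2 * h)) with (- (l1 * k + l2 * h)) in Q by ring.
  rewrite Rabs_Ropp in Q.
  assert (Pk := Rabs_pos k). assert (Ph : 0 < Rabs h) by now apply Rabs_pos_lt.
  assert (e1 : e <= Rabs l1 / 2) by apply Rmin_l.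
  assert (e2 : e <= eps * Rabs l1 / (2 * (K + 1))) by apply Rmin_r.
  assert (e0 := cond_pos e).
  assert (Mx : Rmax (Rabs k) (Rabs h) <= Rabs k + Rabs h) by (apply Rmax_lub; lra).
  assert (Hk : Rabs k <= K * Rabs h).
  { assert (T : Rabs l1 * Rabs k <= Rabs (l1 * k + l2 * h) + Rabs l2 * Rabs h).
    { rewrite <- !Rabs_mult.
      replace (l1 * k) with ((l1 * k + l2 * h) + - (l2 * h)) at 1 by ring.
      eapply Rle_trans; [apply Rabs_triang|]. rewrite Rabs_Ropp. lra. }
    assert (T2 : Rabs l1 * Rabs k <= 2 * (Rabs l2 + Rabs l1) * Rabs h) by nra.
    unfold K. apply Rmult_le_reg_l with (Rabs l1); auto.
    replace (Rabs l1 * (2 * (Rabs l2 + Rabs l1) / Rabs l1 * Rabs h))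
      with (2 * (Rabs l2 + Rabs l1) * Rabs h) by (field; lra). exact T2. }
  replace (k / h - - l2 / l1) with ((l1 * k + l2 * h) / (l1 * h)) by (field; auto).
  unfold Rdiv. rewrite Rabs_mult, Rabs_inv, Rabs_mult.
  apply Rmult_lt_reg_r with (Rabs l1 * Rabs h); [now apply Rmult_lt_0_compat|].
  rewrite Rmult_assoc, Rinv_l, Rmult_1_r by nra.
  apply Rle_lt_trans with (e * ((K + 1) * Rabs h)).
  { eapply Rle_trans; [exact Q|]. apply Rmult_le_compat_l; lra. }
  apply Rle_lt_trans with (eps * Rabs l1 / (2 * (K + 1)) * ((K + 1) * Rabs h)).
  { apply Rmult_le_compat_r; [|exact e2]. apply Rmult_le_pos; lra. }
  replace (eps * Rabs l1 / (2 * (K + 1)) * ((K + 1) * Rabs h)) with (eps * (Rabs l1 * Rabs h) / 2) by (field; lra).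
  assert (0 < eps * (Rabs l1 * Rabs h)) by (apply Rmult_lt_0_compat; [|apply Rmult_lt_0_compat]; lra). lra.
Qed.

Lemma locally_2d_lt f c u v : continuity_2d_pt f u v -> f u v < c ->
  locally_2d (fun s t => f s t < c) u v.
Proof.
  intros Hf Hlt. assert (P : 0 < c - f u v) by lra.
  generalize (Hf (mkposreal _ P)). apply locally_2d_impl, locally_2d_forall.
  simpl. intros s t H. apply Rabs_def2 in H. lra.
Qed.

Lemma locally_2d_gt f c u v : continuity_2d_pt f u v -> c < f u v ->
  locally_2d (fun s t => c < f s t) u v.
Proof.
  intros Hf Hlt. assert (P : 0 < f u v - c) by lra.
  generalize (Hf (mkposreal _ P)). apply locally_2d_impl, locally_2d_forall.
  simpl. intros s t H. apply Rabs_def2 in H. lra.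
Qed.

(** * Radial parametrization of a star-shaped sublevel set *)

Definition nrm2 (s t : R) := s ^ 2 + t ^ 2.

Lemma C1pt_nrm2 s t : C1pt nrm2 (fun s _ => 2 * s) (fun _ t => 2 * t) s t.
Proof.
  unfold nrm2. apply C1pt_intro.
  - apply locally_2d_forall; intros. auto_derive; auto; ring.
  - auto_derive; auto; ring.
  - apply continuity_2d_pt_mult; auto using continuity_2d_pt_const, continuity_2d_pt_id1.
  - apply continuity_2d_pt_mult; auto using continuity_2d_pt_const, continuity_2d_pt_id2.
Qed.

Lemma nrm2_scal l s t : nrm2 (l * s) (l * t) = l ^ 2 * nrm2 s t.
Proof. unfold nrm2. ring. Qed.

Lemma nrm2_nonneg s t : 0 <= nrm2 s t.
Proof. unfold nrm2. assert (A := pow2_ge_0 s). assert (B := pow2_ge_0 t). lra. Qed.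

Lemma nrm2_eq0 s t : nrm2 s t = 0 -> s = 0 /\ t = 0.
Proof.
  unfold nrm2. intros H. assert (A := pow2_ge_0 s). assert (B := pow2_ge_0 t).
  split; apply Rsqr_0_uniq; unfold Rsqr; lra.
Qed.

(** A C^1 nondecreasing cutoff for the squared norm: zero on the disk of radius 1/2 and, since 16/9
    = 1 / (3/4)^2, equal to 1 on the unit circle. *)
Definition cut (q : R) := 16 / 9 * Rmax 0 (q - 1 / 4) ^ 2.
Definition cut' (q : R) := 32 / 9 * Rmax 0 (q - 1 / 4).

Lemma is_derive_cut q : is_derive cut q (cut' q).
Proof.
  unfold cut, cut'.
  destruct (Rtotal_order q (1 / 4)) as [H|[H|H]].
  - apply is_derive_ext_loc with (fun _ => 0).
    + assert (P : 0 < 1 / 4 - q) by lra. exists (mkposreal _ P). simpl. intros y Hy.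
      apply Rabs_def2 in Hy. unfold minus, plus, opp in Hy; simpl in Hy.
      rewrite Rmax_left by lra. ring.
    + rewrite Rmax_left by lra. rewrite Rmult_0_r. apply @is_derive_const.
  - subst q. rewrite Rmax_left by lra. rewrite Rmult_0_r.
    apply is_derive_Reals. intros eps He.
    assert (P : 0 < 9 / 16 * eps) by lra. exists (mkposreal _ P). simpl. intros h Hh0 Hh.
    rewrite (Rmax_left 0 (1 / 4 - 1 / 4)) by lra.
    replace (1 / 4 + h - 1 / 4) with h by ring.
    replace ((16 / 9 * (Rmax 0 h * (Rmax 0 h * 1)) - 16 / 9 * (0 * (0 * 1))) / h - 0)
      with (16 / 9 * Rmax 0 h * (Rmax 0 h / h)) by (field; auto).
    unfold Rmax. destruct Rle_dec as [L|L].
    + replace (16 / 9 * h * (h / h)) with (16 / 9 * h) by (field; auto).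
      apply Rabs_def2 in Hh. apply Rabs_def1; lra.
    + rewrite Rmult_0_r, Rmult_0_l, Rabs_R0. lra.
  - apply is_derive_ext_loc with (fun q => 16 / 9 * (q - 1 / 4) ^ 2).
    + assert (P : 0 < q - 1 / 4) by lra. exists (mkposreal _ P). simpl. intros y Hy.
      apply Rabs_def2 in Hy. unfold minus, plus, opp in Hy; simpl in Hy.
      rewrite Rmax_right by lra. ring.
    + rewrite Rmax_right by lra. auto_derive; auto. field.
Qed.

Lemma continuity_cut' q : continuity_pt cut' q.
Proof.
  unfold cut'. apply continuity_pt_mult.
  - apply continuity_pt_const. intros x y; reflexivity.
  - intros eps He. exists eps. split; auto. intros x [_ Hx]. unfold dist in *. simpl in *.
    unfold R_dist in *. apply Rabs_def2 in Hx. unfold Rmax.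
    do 2 destruct Rle_dec; apply Rabs_def1; lra.
Qed.

Lemma cut_0 q : q <= 1 / 4 -> cut q = 0 /\ cut' q = 0.
Proof. intros H. unfold cut, cut'. rewrite Rmax_left by lra. split; ring. Qed.

Lemma cut_1 : cut 1 = 1.
Proof. unfold cut. rewrite Rmax_right by lra. field. Qed.

Lemma cut_mono q q' : q <= q' -> cut q <= cut q'.
Proof.
  intros H. unfold cut. assert (A := Rmax_l 0 (q - 1 / 4)).
  assert (B : Rmax 0 (q - 1 / 4) <= Rmax 0 (q' - 1 / 4)).
  { apply Rle_max_compat_l. lra. }
  nra.
Qed.

Lemma cut_ge0 q : 0 <= cut q.
Proof. unfold cut. assert (A := pow2_ge_0 (Rmax 0 (q - 1 / 4))). lra. Qed.

Lemma cut'_ge0 q : 0 <= cut' q.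
Proof. unfold cut'. assert (A := Rmax_l 0 (q - 1 / 4)). lra. Qed.

Section Gauge.
Variables (f fa fb : R -> R -> R) (d0 d1 e : R).
Hypothesis fC1 : forall a b, C1pt f fa fb a b.
Hypothesis f0 : f 0 0 = 0.
Hypothesis Hd1 : 0 < d1.
Hypothesis Hd01 : d1 < d0.
Hypothesis He : 0 < e.
Hypothesis frad : forall a b, 0 < nrm2 a b < d0 ^ 2 -> 0 < a * fa a b + b * fb a b.
Hypothesis fbd : forall a b, nrm2 a b = d1 ^ 2 -> e <= f a b.

Lemma is_derive_ray s t l :
  is_derive (fun l => f (l * s) (l * t)) l (s * fa (l * s) (l * t) + t * fb (l * s) (l * t)).
Proof.
  destruct (fC1 (l * s) (l * t)) as [H _].
  apply is_derive_Reals.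
  replace (s * fa (l * s) (l * t) + t * fb (l * s) (l * t))
    with (fa (l * s) (l * t) * s + fb (l * s) (l * t) * t) by ring.
  apply (derivable_pt_lim_comp_2d f (fun l => l * s) (fun l => l * t)); auto;
    apply is_derive_Reals; auto_derive; auto; ring.
Qed.

Lemma ray_incr s t l1 l2 : 0 < nrm2 s t -> 0 <= l1 -> l1 < l2 ->
  l2 ^ 2 * nrm2 s t < d0 ^ 2 -> f (l1 * s) (l1 * t) < f (l2 * s) (l2 * t).
Proof.
  intros Hz H1 H2 H3.
  apply (incr_MVT (fun l => f (l * s) (l * t)) (fun l => s * fa (l * s) (l * t) + t * fb (l * s) (l * t))); auto.
  - intros; apply is_derive_ray.
  - intros l Hl.
    assert (P : 0 < l * s * fa (l * s) (l * t) + l * t * fb (l * s) (l * t)).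
    { apply frad. rewrite nrm2_scal. split; [apply Rmult_lt_0_compat; nra|].
      eapply Rle_lt_trans; [|exact H3]. apply Rmult_le_compat_r; nra. }
    nra.
Qed.

(** [f] vanishes at the origin and is at least [e] on the circle of radius [d1], so each ray meets
    the level [e]. The scaling factor [mu] is the reciprocal of the Minkowski gauge of the sublevel
    set. *)
Lemma exists_ray_hit : exists mu : R -> R -> R, forall s t, 0 < nrm2 s t ->
  0 < mu s t /\ mu s t ^ 2 * nrm2 s t <= d1 ^ 2 /\ f (mu s t * s) (mu s t * t) = e.
Proof.
  destruct (functional_choice (fun (z : R * R) m => 0 < nrm2 (fst z) (snd z) ->
    0 < m /\ m ^ 2 * nrm2 (fst z) (snd z) <= d1 ^ 2 /\ f (m * fst z) (m * snd z) = e)) as [mu H].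
  - intros [s t]; simpl fst; simpl snd.
    destruct (Rle_or_lt (nrm2 s t) 0) as [N|P]; [exists 0; lra|].
    set (T := d1 / sqrt (nrm2 s t)).
    assert (S := sqrt_lt_R0 _ P).
    assert (HT : 0 < T) by now apply Rdiv_lt_0_compat.
    assert (ET : T ^ 2 * nrm2 s t = d1 ^ 2).
    { unfold T. rewrite <- (sqrt_sqrt (nrm2 s t)) at 2 by lra. field. lra. }
    destruct (IVT_gen (fun l => f (l * s) (l * t)) 0 T e) as [m [Hm Em]].
    + intros l. exact (is_derive_continuity_pt _ _ _ (is_derive_ray s t l)).
    + rewrite !Rmult_0_l, f0.
      assert (e <= f (T * s) (T * t)) by (apply fbd; now rewrite nrm2_scal).
      rewrite Rmin_left, Rmax_right by lra. lra.
    + rewrite Rmin_left, Rmax_right in Hm by lra.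
      exists m. intros _.
      assert (m <> 0). { intros ->. rewrite !Rmult_0_l, f0 in Em. lra. }
      split; [lra|]. split; auto. rewrite <- ET. apply Rmult_le_compat_r; nra.
  - exists (fun s t => mu (s, t)). intros s t Hz. apply (H (s, t)). exact Hz.
Qed.

Variable mu : R -> R -> R.
Hypothesis Hmu : forall s t, 0 < nrm2 s t ->
  0 < mu s t /\ mu s t ^ 2 * nrm2 s t <= d1 ^ 2 /\ f (mu s t * s) (mu s t * t) = e.

Lemma d1d0_sq : d1 ^ 2 < d0 ^ 2.
Proof. nra. Qed.

(** By strict monotonicity on rays, comparing [l] with [mu] amounts to comparing [f] with [e];
    homogeneity and continuity of [mu] are read off from these implications. *)
Lemma ray_lt s t l : 0 < nrm2 s t -> 0 <= l -> l ^ 2 * nrm2 s t < d0 ^ 2 ->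
  (f (l * s) (l * t) < e -> l < mu s t) /\ (l < mu s t -> f (l * s) (l * t) < e) /\
  (e < f (l * s) (l * t) -> mu s t < l) /\ (mu s t < l -> e < f (l * s) (l * t)).
Proof.
  intros Hz Hl Hd. destruct (Hmu s t Hz) as [M1 [M2 M3]].
  assert (D := d1d0_sq).
  destruct (Rtotal_order l (mu s t)) as [H|[H|H]].
  - assert (Q := ray_incr s t l (mu s t) Hz Hl H ltac:(lra)). lra.
  - subst l. lra.
  - assert (Q := ray_incr s t (mu s t) l Hz ltac:(lra) H Hd). lra.
Qed.

Lemma mu_scal l s t : 0 < nrm2 s t -> 0 < l -> mu (l * s) (l * t) = mu s t / l.
Proof.
  intros Hz Hl.
  assert (Hz' : 0 < nrm2 (l * s) (l * t)) by (rewrite nrm2_scal; apply Rmult_lt_0_compat; nra).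
  destruct (Hmu s t Hz) as [M1 [M2 M3]]. destruct (Hmu _ _ Hz') as [N1 [period_sq N3]].
  rewrite nrm2_scal in period_sq.
  assert (D := d1d0_sq).
  set (m := mu (l * s) (l * t)) in *.
  destruct (ray_lt s t (m * l) Hz) as [_ [R2 [_ R4]]].
  - nra.
  - replace ((m * l) ^ 2 * nrm2 s t) with (m ^ 2 * (l ^ 2 * nrm2 s t)) by ring. lra.
  - rewrite !Rmult_assoc in R2, R4.
    assert (E : m * l = mu s t) by (destruct (Rtotal_order (m * l) (mu s t)) as [H|[H|H]]; lra).
    rewrite <- E. field. lra.
Qed.

Lemma continuity_2d_pt_scal l s t : continuity_2d_pt (fun s t => f (l * s) (l * t)) s t.
Proof.
  apply (continuity_2d_pt_comp f (fun s _ => l * s) (fun _ t => l * t)).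
  - exact (C1pt_cont _ _ _ _ _ (fC1 _ _)).
  - apply continuity_2d_pt_mult; auto using continuity_2d_pt_const, continuity_2d_pt_id1.
  - apply continuity_2d_pt_mult; auto using continuity_2d_pt_const, continuity_2d_pt_id2.
Qed.

(** The values of [f] at the points of the ray with factors [mu - h] and [mu + h] lie strictly on
    either side of [e]; this persists for nearby (s, t) and traps their [mu]. *)
Lemma continuity_mu s t : 0 < nrm2 s t -> continuity_2d_pt mu s t.
Proof.
  intros Hz eps. destruct (Hmu s t Hz) as [M1 [M2 M3]].
  assert (S := sqrt_lt_R0 _ Hz).
  assert (SS := sqrt_sqrt (nrm2 s t) ltac:(lra)).
  set (n := sqrt (nrm2 s t)) in *.
  assert (P : 0 < Rmin (eps / 2) (Rmin (mu s t / 2) ((d0 - d1) / (2 * n)))).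
  { destruct eps as [eps Heps]. simpl. repeat apply Rmin_pos; try lra. apply Rdiv_lt_0_compat; lra. }
  (* The bound by (d0 - d1) / (2 n) keeps the farther point inside the radius [d0], where [f] is
     monotone on rays. *)
  set (h := Rmin (eps / 2) (Rmin (mu s t / 2) ((d0 - d1) / (2 * n)))) in *.
  assert (h1 : h <= eps / 2) by apply Rmin_l.
  assert (h2 : h <= mu s t / 2) by (eapply Rle_trans; [apply Rmin_r|apply Rmin_l]).
  assert (h3 : h <= (d0 - d1) / (2 * n)) by (eapply Rle_trans; [apply Rmin_r|apply Rmin_r]).
  assert (h4 : h * n <= (d0 - d1) / 2).
  { apply Rmult_le_compat_r with (r := n) in h3; [|lra].
    replace ((d0 - d1) / (2 * n) * n) with ((d0 - d1) / 2) in h3 by (field; lra). exact h3. }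
  assert (m1 : mu s t * n <= d1).
  { destruct (Rle_or_lt (mu s t * n) d1); auto.
    assert (d1 ^ 2 < (mu s t * n) ^ 2) by nra.
    replace ((mu s t * n) ^ 2) with (mu s t ^ 2 * (n * n)) in H0 by ring. rewrite SS in H0. lra. }
  assert (B : (mu s t + h) ^ 2 * nrm2 s t < d0 ^ 2).
  { rewrite <- SS. replace ((mu s t + h) ^ 2 * (n * n)) with ((mu s t * n + h * n) ^ 2) by ring.
    assert (0 < mu s t * n) by now apply Rmult_lt_0_compat.
    assert (0 < h * n) by now apply Rmult_lt_0_compat. nra. }
  assert (Hlo : f ((mu s t - h) * s) ((mu s t - h) * t) < e).
  { apply (ray_lt s t); try lra. eapply Rle_lt_trans; [|exact B]. apply Rmult_le_compat_r; nra. }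
  assert (Hhi : e < f ((mu s t + h) * s) ((mu s t + h) * t)).
  { apply (ray_lt s t); lra. }
  assert (CN := C1pt_cont _ _ _ _ _ (C1pt_nrm2 s t)).
  assert (L1 := locally_2d_lt _ _ _ _ (continuity_2d_pt_scal (mu s t - h) s t) Hlo).
  assert (L2 := locally_2d_gt _ _ _ _ (continuity_2d_pt_scal (mu s t + h) s t) Hhi).
  assert (L3 := locally_2d_gt _ _ _ _ CN Hz).
  assert (L4 := locally_2d_lt (fun s' t' => (mu s t + h) ^ 2 * nrm2 s' t') _ s t
    (continuity_2d_pt_mult _ _ _ _ (continuity_2d_pt_const _ _ _) CN) B).
  generalize (locally_2d_and _ _ _ _ (locally_2d_and _ _ _ _ L1 L2) (locally_2d_and _ _ _ _ L3 L4)).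
  apply locally_2d_impl, locally_2d_forall. intros s' t' [[K1 K2] [K3 K4]].
  assert (A1 : mu s t - h < mu s' t').
  { apply (ray_lt s' t'); auto; [lra|]. eapply Rle_lt_trans; [|exact K4]. apply Rmult_le_compat_r; nra. }
  assert (A2 : mu s' t' < mu s t + h).
  { apply (ray_lt s' t'); auto; lra. }
  assert (Heps := cond_pos eps). apply Rabs_def1; lra.
Qed.

(** Derivative of [f] in the ray variable at the point that is hit. Its positivity allows implicit
    differentiation of f (mu s) (mu t) = e, of which [mus] and [mut] are the outcome. *)
Definition rad s t := s * fa (mu s t * s) (mu s t * t) + t * fb (mu s t * s) (mu s t * t).
Definition mus s t := - (mu s t * fa (mu s t * s) (mu s t * t)) / rad s t.
Definition mut s t := - (mu s t * fb (mu s t * s) (mu s t * t)) / rad s t.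

Lemma rad_pos s t : 0 < nrm2 s t -> 0 < rad s t.
Proof.
  intros Hz. destruct (Hmu s t Hz) as [M1 [M2 M3]]. unfold rad.
  assert (D := d1d0_sq).
  assert (P : 0 < mu s t * s * fa (mu s t * s) (mu s t * t) + mu s t * t * fb (mu s t * s) (mu s t * t)).
  { apply frad. rewrite nrm2_scal. split; [apply Rmult_lt_0_compat; nra|lra]. }
  nra.
Qed.

Lemma open_nrm2 s t : 0 < nrm2 s t -> locally_2d (fun s t => 0 < nrm2 s t) s t.
Proof. intros H. apply locally_2d_gt; auto. exact (C1pt_cont _ _ _ _ _ (C1pt_nrm2 s t)). Qed.

Lemma is_derive_mu s t : 0 < nrm2 s t ->
  is_derive (fun x => mu x t) s (mus s t) /\ is_derive (fun x => mu s x) t (mut s t).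
Proof.
  intros Hz. assert (Rp := rad_pos s t Hz).
  assert (CM := continuity_mu s t Hz).
  assert (O := open_nrm2 s t Hz).
  destruct (fC1 (mu s t * s) (mu s t * t)) as [HF _].
  split.
  - apply (implicit_is_derive (fun l x => f (l * x) (l * t)) (fun x => mu x t) s (rad s t) _ e).
    + assert (Q := C1pt_comp f fa fb (fun l x => l * x) (fun _ x => x) (fun l _ => l)
        (fun l _ => l * t) (fun _ _ => t) (fun _ _ => 0) (mu s t) s (fC1 _ _)).
      destruct Q as [Q _].
      * apply C1pt_intro; auto using continuity_2d_pt_id1, continuity_2d_pt_id2.
        -- apply locally_2d_forall; intros; auto_derive; auto; ring.
        -- auto_derive; auto; ring.
      * apply C1pt_intro; auto using continuity_2d_pt_const.
        -- apply locally_2d_forall; intros; auto_derive; auto; ring.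
        -- auto_derive; auto; ring.
      * unfold rad. replace (s * _ + t * _) with
          (fa (mu s t * s) (mu s t * t) * s + fb (mu s t * s) (mu s t * t) * t) by ring.
        replace (mu s t * fa _ _) with
          (fa (mu s t * s) (mu s t * t) * mu s t + fb (mu s t * s) (mu s t * t) * 0) by ring.
        exact Q.
    + lra.
    + apply continuity_pt_filterlim. apply filterlim_locally. intros eps.
      destruct (CM eps) as [d Hd]. exists d. intros y Hy. apply Hd; [exact Hy|].
      replace (t - t) with 0 by ring. rewrite Rabs_R0. apply cond_pos.
    + destruct O as [d Hd]. exists d. intros y Hy. apply Hmu. apply Hd; [exact Hy|].
      replace (t - t) with 0 by ring. rewrite Rabs_R0. apply cond_pos.
  - apply (implicit_is_derive (fun l x => f (l * s) (l * x)) (fun x => mu s x) t (rad s t) _ e).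
    + assert (Q := C1pt_comp f fa fb (fun l _ => l * s) (fun _ _ => s) (fun _ _ => 0)
        (fun l x => l * x) (fun _ x => x) (fun l _ => l) (mu s t) t (fC1 _ _)).
      destruct Q as [Q _].
      * apply C1pt_intro; auto using continuity_2d_pt_const.
        -- apply locally_2d_forall; intros; auto_derive; auto; ring.
        -- auto_derive; auto; ring.
      * apply C1pt_intro; auto using continuity_2d_pt_id1, continuity_2d_pt_id2.
        -- apply locally_2d_forall; intros; auto_derive; auto; ring.
        -- auto_derive; auto; ring.
      * unfold rad. replace (s * _ + t * _) with
          (fa (mu s t * s) (mu s t * t) * s + fb (mu s t * s) (mu s t * t) * t) by ring.
        replace (mu s t * fb _ _) with
          (fa (mu s t * s) (mu s t * t) * 0 + fb (mu s t * s) (mu s t * t) * mu s t) by ring.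
        exact Q.
    + lra.
    + apply continuity_pt_filterlim. apply filterlim_locally. intros eps.
      destruct (CM eps) as [d Hd]. exists d. intros y Hy. apply Hd; [|exact Hy].
      replace (s - s) with 0 by ring. rewrite Rabs_R0. apply cond_pos.
    + destruct O as [d Hd]. exists d. intros y Hy. apply Hmu. apply Hd; [|exact Hy].
      replace (s - s) with 0 by ring. rewrite Rabs_R0. apply cond_pos.
Qed.

Lemma C1pt_mu s t : 0 < nrm2 s t -> C1pt mu mus mut s t.
Proof.
  intros Hz. assert (CM := continuity_mu s t Hz).
  assert (Rp := rad_pos s t Hz).
  destruct (fC1 (mu s t * s) (mu s t * t)) as [_ [Ca Cb]].
  assert (Cs : continuity_2d_pt (fun s t => mu s t * s) s t) by (apply continuity_2d_pt_mult; auto using continuity_2d_pt_id1).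
  assert (Ct : continuity_2d_pt (fun s t => mu s t * t) s t) by (apply continuity_2d_pt_mult; auto using continuity_2d_pt_id2).
  assert (Ga := continuity_2d_pt_comp fa _ _ s t Ca Cs Ct).
  assert (Gb := continuity_2d_pt_comp fb _ _ s t Cb Cs Ct).
  assert (Gr : continuity_2d_pt rad s t).
  { apply continuity_2d_pt_plus; apply continuity_2d_pt_mult; auto using continuity_2d_pt_id1, continuity_2d_pt_id2. }
  apply C1pt_intro.
  - generalize (open_nrm2 s t Hz). apply locally_2d_impl, locally_2d_forall. intros; now apply is_derive_mu.
  - now apply is_derive_mu.
  - apply continuity_2d_pt_mult; [apply continuity_2d_pt_opp, continuity_2d_pt_mult; auto|].
    apply continuity_2d_pt_inv; auto; lra.
  - apply continuity_2d_pt_mult; [apply continuity_2d_pt_opp, continuity_2d_pt_mult; auto|].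
    apply continuity_2d_pt_inv; auto; lra.
Qed.

(** Euler's identity for a function homogeneous of degree -1. *)
Lemma mu_euler s t : 0 < nrm2 s t -> s * mus s t + t * mut s t = - mu s t.
Proof.
  intros Hz. assert (Rp := rad_pos s t Hz). unfold mus, mut.
  transitivity (- mu s t * rad s t / rad s t); [unfold rad at 3|]; field; lra.
Qed.

End Gauge.

(* The disk is parametrized by a radial map [z |-> z * kap z], which is linear near 0 (so that no regularity question
   arises there) and sends the unit circle onto the level set [f = e]. *)
Lemma sublevel_set_disk (f fa fb : R -> R -> R) (d0 d1 e : R) :
  (forall a b, C1pt f fa fb a b) -> f 0 0 = 0 -> 0 < d1 < d0 -> 0 < e ->
  (forall a b, 0 < nrm2 a b < d0 ^ 2 -> 0 < a * fa a b + b * fb a b) ->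
  (forall a b, nrm2 a b = d1 ^ 2 -> e <= f a b) ->
  exists P Ps Pt Q Qs Qt : R -> R -> R,
    (forall s t, C1pt P Ps Pt s t) /\ (forall s t, C1pt Q Qs Qt s t) /\
    (forall s t, Ps s t * Qt s t - Pt s t * Qs s t <> 0) /\
    (forall s t, nrm2 s t < 1 -> f (P s t) (Q s t) < e) /\
    (forall s t, nrm2 s t <= 1 -> nrm2 (P s t) (Q s t) <= d1 ^ 2) /\
    (forall a b, nrm2 a b <= d1 ^ 2 -> f a b < e ->
       exists s t, nrm2 s t < 1 /\ P s t = a /\ Q s t = b) /\
    (forall s t s' t', P s t = P s' t' -> Q s t = Q s' t' -> s = s' /\ t = t').
Proof.
  intros fC1 f0 Hd He frad fbd.
  destruct Hd as [Hd1 Hd01].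
  destruct (exists_ray_hit f fa fb d1 e fC1 f0 Hd1 He fbd) as [mu Hmu].
  assert (Dsq : d1 ^ 2 < d0 ^ 2) by nra.
  assert (HC := C1pt_cont _ _ _ _ _ (fC1 0 0)).
  rewrite <- f0 in He.
  destruct (locally_2d_lt f e 0 0 HC He) as [r Hr]. rewrite f0 in He.
  assert (Hr0 := cond_pos r).
  (* The disk of radius [a0] lies in the sublevel set; [a0] is the dilation factor used near the
     origin. *)
  set (a0 := r / 2).
  assert (Ha0 : forall a b, nrm2 a b <= a0 ^ 2 -> f a b < e).
  { intros a b H. unfold nrm2 in H. assert (A1 := pow2_ge_0 a). assert (A2 := pow2_ge_0 b).
    unfold a0 in H. apply Hr; rewrite Rminus_0_r; apply Rabs_def1; nra. }
  assert (Pa0 : 0 < a0) by (unfold a0; lra).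
  set (N := fun s t => sqrt (nrm2 s t)).
  (* Distance from the origin to the level set in the direction of (s, t). It is homogeneous of
     degree 0, so its radial derivative vanishes ([Eul]). *)
  set (R0 := fun s t => mu s t * N s t).
  set (R0s := fun s t => mus fa fb mu s t * N s t + mu s t * (/ (2 * N s t) * (2 * s))).
  set (R0t := fun s t => mut fa fb mu s t * N s t + mu s t * (/ (2 * N s t) * (2 * t))).
  assert (HN : forall s t, 0 < nrm2 s t -> 0 < N s t /\ N s t * N s t = nrm2 s t).
  { intros s t Hz. split; [now apply sqrt_lt_R0|]. apply sqrt_sqrt; lra. }
  assert (HR : forall s t, 0 < nrm2 s t -> a0 <= R0 s t <= d1).
  { intros s t Hz. destruct (HN s t Hz) as [n1 n2]. destruct (Hmu s t Hz) as [m1 [m2 m3]].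
    unfold R0.
    assert (E : mu s t ^ 2 * nrm2 s t = (mu s t * N s t) ^ 2) by (rewrite <- n2; ring).
    assert (0 < mu s t * N s t) by now apply Rmult_lt_0_compat.
    split.
    - destruct (Rle_or_lt a0 (mu s t * N s t)); auto.
      assert (f (mu s t * s) (mu s t * t) < e).
      { apply Ha0. rewrite nrm2_scal, E. nra. } lra.
    - rewrite E in m2. destruct (Rle_or_lt (mu s t * N s t) d1); auto. nra. }
  assert (HRsc : forall l s t, 0 < l -> 0 < nrm2 s t -> R0 (l * s) (l * t) = R0 s t).
  { intros l s t Hl Hz. unfold R0.
    rewrite (mu_scal f fa fb d0 d1 e fC1 Hd1 Hd01 frad mu Hmu) by auto.
    unfold N. rewrite nrm2_scal, sqrt_mult, sqrt_pow2 by (try apply nrm2_nonneg; nra).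
    field. lra. }
  assert (CR : forall s t, 0 < nrm2 s t -> C1pt R0 R0s R0t s t).
  { intros s t Hz. apply C1pt_mult.
    - now apply (C1pt_mu f fa fb d0 d1 e fC1 Hd1 Hd01 frad mu Hmu).
    - apply (C1pt_comp1 sqrt (fun x => / (2 * sqrt x)) nrm2 (fun s _ => 2 * s) (fun _ t => 2 * t)).
      + assert (Hz2 : 0 < nrm2 s t / 2) by lra. exists (mkposreal _ Hz2). simpl. intros y Hy.
        apply Rabs_def2 in Hy. unfold minus, plus, opp in Hy; simpl in Hy.
        auto_derive; [lra|]. rewrite Rmult_1_l. reflexivity.
      + apply continuity_pt_inv.
        * apply continuity_pt_mult; [apply continuity_pt_const; intros ? ?; reflexivity|].
          apply continuity_pt_sqrt; lra.
        * assert (0 < sqrt (nrm2 s t)) by now apply sqrt_lt_R0. lra.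
      + apply C1pt_nrm2. }
  assert (Eul : forall s t, 0 < nrm2 s t -> s * R0s s t + t * R0t s t = 0).
  { intros s t Hz. destruct (HN s t Hz) as [n1 n2].
    assert (E := mu_euler f fa fb d0 d1 e Hd1 Hd01 frad mu Hmu s t Hz).
    unfold R0s, R0t.
    replace (s * (mus fa fb mu s t * N s t + mu s t * (/ (2 * N s t) * (2 * s))) +
      t * (mut fa fb mu s t * N s t + mu s t * (/ (2 * N s t) * (2 * t))))
    with ((s * mus fa fb mu s t + t * mut fa fb mu s t) * N s t + mu s t * (nrm2 s t / N s t))
      by (unfold nrm2; field; lra).
    rewrite E, <- n2. field. lra. }
  (* The dilation factor is [a0] where the cutoff vanishes and [R0] on the unit circle, so the
     singularity of [R0] at the origin is never seen. *)
  set (kap := fun s t => a0 + cut (nrm2 s t) * (R0 s t - a0)).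
  set (kas := fun s t => cut' (nrm2 s t) * (2 * s) * (R0 s t - a0) + cut (nrm2 s t) * R0s s t).
  set (kat := fun s t => cut' (nrm2 s t) * (2 * t) * (R0 s t - a0) + cut (nrm2 s t) * R0t s t).
  assert (Ck : forall s t, C1pt kap kas kat s t).
  { intros s t. destruct (Rle_or_lt (nrm2 s t) 0) as [L|L].
    - apply (C1pt_ext_loc (fun _ _ => a0) (fun _ _ => 0) (fun _ _ => 0)).
      + assert (L4 : nrm2 s t < 1 / 4) by lra.
        generalize (locally_2d_lt _ _ _ _ (C1pt_cont _ _ _ _ _ (C1pt_nrm2 s t)) L4).
        apply locally_2d_impl, locally_2d_forall. intros s' t' H.
        destruct (cut_0 (nrm2 s' t')) as [c1 c2]; [lra|].
        unfold kap, kas, kat. rewrite c1, c2. repeat split; ring.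
      + apply C1pt_const.
    - eapply C1pt_ext; [| | |
        exact (C1pt_plus _ _ _ _ _ _ _ _ (C1pt_const a0 s t)
         (C1pt_mult _ _ _ _ _ _ _ _
           (C1pt_comp1 cut cut' nrm2 (fun s _ => 2 * s) (fun _ t => 2 * t) s t
             (filter_forall _ is_derive_cut) (continuity_cut' _) (C1pt_nrm2 s t))
           (C1pt_plus _ _ _ _ _ _ _ _ (CR s t L) (C1pt_const (- a0) s t))))];
        intros; unfold kap, kas, kat; ring. }
  assert (Hk1 : forall s t, 0 < nrm2 s t -> a0 <= kap s t).
  { intros s t Hz. unfold kap. assert (A := cut_ge0 (nrm2 s t)). assert (B := HR s t Hz). nra. }
  assert (Hk0 : forall s t, nrm2 s t <= 1 / 4 -> kap s t = a0).
  { intros s t Hz. unfold kap. destruct (cut_0 _ Hz) as [c1 c2]. rewrite c1. ring. }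
  assert (Hkp : forall s t, 0 < kap s t).
  { intros s t. destruct (Rle_or_lt (nrm2 s t) 0) as [L|L].
    - rewrite Hk0; lra.
    - assert (A := Hk1 s t L). lra. }
  assert (Hk2 : forall s t, 0 < nrm2 s t <= 1 -> kap s t <= R0 s t).
  { intros s t [Hz H1]. unfold kap. assert (A := cut_ge0 (nrm2 s t)). assert (B := HR s t Hz).
    assert (C := cut_mono _ _ H1). rewrite cut_1 in C. nra. }
  exists (fun s t => s * kap s t), (fun s t => 1 * kap s t + s * kas s t), (fun s t => 0 * kap s t + s * kat s t),
    (fun s t => t * kap s t), (fun s t => 0 * kap s t + t * kas s t), (fun s t => 1 * kap s t + t * kat s t).
  split; [|split; [|split; [|split; [|split; [|split]]]]].
  - intros s t. apply (C1pt_mult (fun s _ => s) (fun _ _ => 1) (fun _ _ => 0)); auto using C1pt_fst.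
  - intros s t. apply (C1pt_mult (fun _ t => t) (fun _ _ => 0) (fun _ _ => 1)); auto using C1pt_snd.
  - intros s t.
    (* The Jacobian determinant is kap (kap + s kas + t kat), so it suffices that [kap] does not
       decrease along rays. *)
    assert (D : 0 <= s * kas s t + t * kat s t).
    { unfold kas, kat.
      replace (s * (cut' (nrm2 s t) * (2 * s) * (R0 s t - a0) + cut (nrm2 s t) * R0s s t) +
        t * (cut' (nrm2 s t) * (2 * t) * (R0 s t - a0) + cut (nrm2 s t) * R0t s t))
      with (2 * cut' (nrm2 s t) * nrm2 s t * (R0 s t - a0) + cut (nrm2 s t) * (s * R0s s t + t * R0t s t))
        by (unfold nrm2; ring).
      destruct (Rle_or_lt (nrm2 s t) 0) as [L|L].
      - destruct (cut_0 (nrm2 s t)) as [c1 c2]; [lra|]. rewrite c1, c2. lra.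
      - rewrite Eul by auto. assert (A := cut'_ge0 (nrm2 s t)). assert (B := HR s t L).
        assert (0 <= cut' (nrm2 s t) * nrm2 s t) by nra. nra. }
    assert (K := Hkp s t). nra.
  - intros s t H1. destruct (Rle_or_lt (nrm2 s t) 0) as [L|L].
    + destruct (nrm2_eq0 s t) as [-> ->]; [assert (A := nrm2_nonneg s t); lra|].
      rewrite !Rmult_0_l, f0. lra.
    + destruct (HN s t L) as [n1 n2]. destruct (Hmu s t L) as [m1 [m2 m3]].
      assert (K := Hkp s t). assert (K2 := Hk2 s t ltac:(lra)).
      assert (n3 : N s t < 1) by nra.
      assert (kap s t < mu s t).
      { assert (0 < R0 s t) by lra. unfold R0 in K2, H. nra. }
      rewrite (Rmult_comm s), (Rmult_comm t).
      apply (ray_lt f fa fb d0 d1 e fC1 Hd1 Hd01 frad mu Hmu); try lra.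
      apply Rle_lt_trans with (d1 ^ 2); auto. eapply Rle_trans; [|exact m2].
      apply Rmult_le_compat_r; nra.
  - intros s t H1. rewrite (Rmult_comm s), (Rmult_comm t), nrm2_scal.
    destruct (Rle_or_lt (nrm2 s t) 0) as [L|L].
    + assert (A := nrm2_nonneg s t). replace (nrm2 s t) with 0 by lra. nra.
    + assert (K := Hkp s t). assert (K2 := Hk2 s t ltac:(lra)). assert (B := HR s t L).
      apply Rle_trans with (kap s t ^ 2); [|nra]. assert (0 <= kap s t ^ 2) by nra. nra.
  - intros a b Hab Hf. destruct (Rle_or_lt (nrm2 a b) 0) as [L|L].
    + destruct (nrm2_eq0 a b) as [-> ->]; [assert (A := nrm2_nonneg a b); lra|].
      exists 0, 0. unfold nrm2. repeat split; lra.
    + destruct (HN a b L) as [n1 n2].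
      assert (M : 1 < mu a b).
      { apply (ray_lt f fa fb d0 d1 e fC1 Hd1 Hd01 frad mu Hmu); try lra.
        rewrite !Rmult_1_l. exact Hf. }
      assert (B := HR a b L).
      assert (NR : N a b < R0 a b) by (unfold R0; nra).
      (* Radius of the image of a point at distance [r] from the origin on the ray through (a, b).
         It goes from 0 to [R0 a b], which exceeds the norm of (a, b). *)
      set (phi := fun r => r * (a0 + cut (r ^ 2) * (R0 a b - a0))).
      assert (P0 : phi 0 = 0) by (unfold phi; ring).
      assert (P1 : phi 1 = R0 a b) by (unfold phi; replace (1 ^ 2) with 1 by ring; rewrite cut_1; ring).
      destruct (IVT_gen phi 0 1 (N a b)) as [x [Hx Ex]].
      * intros x. unfold phi. apply continuity_pt_mult; [apply derivable_continuous_pt, derivable_pt_id|].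
        apply continuity_pt_plus; [apply continuity_pt_const; intros ? ?; reflexivity|].
        apply continuity_pt_mult; [|apply continuity_pt_const; intros ? ?; reflexivity].
        apply (continuity_pt_comp (fun x => x ^ 2) cut).
        -- apply derivable_continuous_pt, derivable_pt_pow.
        -- exact (is_derive_continuity_pt _ _ _ (is_derive_cut _)).
      * rewrite P0, P1, Rmin_left, Rmax_right by lra. lra.
      * rewrite Rmin_left, Rmax_right in Hx by lra.
        assert (x <> 0) by (intros ->; lra). assert (x <> 1) by (intros ->; lra).
        assert (L0 : 0 < x / N a b) by (apply Rdiv_lt_0_compat; lra).
        assert (E : nrm2 (x / N a b * a) (x / N a b * b) = x ^ 2).
        { rewrite nrm2_scal, <- n2. field. lra. }
        assert (Ek : kap (x / N a b * a) (x / N a b * b) = N a b / x).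
        { unfold kap. rewrite E, HRsc by auto. rewrite <- Ex. unfold phi. field. auto. }
        exists (x / N a b * a), (x / N a b * b). rewrite Ek, E.
        split; [nra|]. split; field; lra.
  - intros s t s' t' E1 E2.
    assert (K := Hkp s t). assert (K' := Hkp s' t').
    (* Two points with the same image lie on one ray, with ratio [l]; since [kap] does not decrease
       along it, [l] must be 1. *)
    set (l := kap s t / kap s' t').
    assert (Hl : 0 < l) by now apply Rdiv_lt_0_compat.
    assert (Es : s' = l * s) by (unfold l; apply Rmult_eq_reg_r with (kap s' t'); [rewrite <- E1; field|]; lra).
    assert (Et : t' = l * t) by (unfold l; apply Rmult_eq_reg_r with (kap s' t'); [rewrite <- E2; field|]; lra).
    destruct (Rle_or_lt (nrm2 s t) 0) as [L|L].
    + destruct (nrm2_eq0 s t) as [-> ->]; [assert (A := nrm2_nonneg s t); lra|]. lra.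
    + assert (El : l * kap s' t' = kap s t) by (unfold l; field; lra).
      assert (Ek : kap s' t' = a0 + cut (l ^ 2 * nrm2 s t) * (R0 s t - a0)).
      { rewrite Es, Et. unfold kap. now rewrite nrm2_scal, HRsc. }
      assert (Ek' : kap s t = a0 + cut (nrm2 s t) * (R0 s t - a0)) by reflexivity.
      assert (B := HR s t L).
      enough (El1 : l = 1) by (rewrite El1 in Es, Et; lra).
      destruct (Rtotal_order l 1) as [H|[H|H]]; auto; exfalso.
      * assert (l2 : l ^ 2 <= 1) by nra.
        assert (C : cut (l ^ 2 * nrm2 s t) <= cut (nrm2 s t)) by (apply cut_mono; nra).
        assert (kap s' t' <= kap s t) by (rewrite Ek, Ek'; apply Rplus_le_compat_l, Rmult_le_compat_r; lra).
        assert (l * kap s' t' < 1 * kap s' t') by (apply Rmult_lt_compat_r; lra). lra.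
      * assert (l2 : 1 <= l ^ 2) by nra.
        assert (C : cut (nrm2 s t) <= cut (l ^ 2 * nrm2 s t)) by (apply cut_mono; nra).
        assert (kap s t <= kap s' t') by (rewrite Ek, Ek'; apply Rplus_le_compat_l, Rmult_le_compat_r; lra).
        assert (1 * kap s' t' < l * kap s' t') by (apply Rmult_lt_compat_r; lra). lra.
Qed.

(** * Charts of an immersed surface *)

Lemma cross_lin a b (p q r s : R) k :
  cross (fun k => p * a k + q * b k) (fun k => r * a k + s * b k) k = (p * s - q * r) * cross a b k.
Proof. destruct k as [|[|k]]; simpl; ring. Qed.

(** For a positive form, the least eigenvalue is at least determinant over trace. Multiplied by the
    trace, the difference of the two sides is (aE + bF)^2 + (aF + bG)^2. *)
Lemma quadratic_form_lower_bound (E F G a b : R) : 0 < E + G ->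
  (E * G - F ^ 2) / (E + G) * nrm2 a b <= a ^ 2 * E + 2 * a * b * F + b ^ 2 * G.
Proof.
  intros H. apply Rmult_le_reg_l with (E + G); auto.
  replace ((E + G) * ((E * G - F ^ 2) / (E + G) * nrm2 a b)) with ((E * G - F ^ 2) * nrm2 a b) by (field; lra).
  unfold nrm2. assert (A := pow2_ge_0 (a * E + b * F)). assert (B := pow2_ge_0 (a * F + b * G)). nra.
Qed.

(** Here [q] is the linear part of a coordinate [w] and also of its radial derivative [d]. Expanding
    w d around q^2 leaves terms bounded by 2 M e n^2, M e n^2 and 2 e^2 n^2. *)
Lemma perturbed_square_lower_bound (w d q e n M : R) :
  Rabs (w - q) <= e * n -> Rabs (d - q) <= 2 * e * n -> Rabs q <= M * n ->
  0 < e <= 1 -> 0 <= n -> q ^ 2 - (3 * M + 2) * e * n ^ 2 <= w * d.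
Proof.
  intros Hw Hd Hq He Hn.
  assert (A : forall x y, - (Rabs x * Rabs y) <= x * y).
  { intros x y. rewrite <- Rabs_mult. assert (B := Rle_abs (- (x * y))). rewrite Rabs_Ropp in B. lra. }
  replace (w * d) with (q ^ 2 + q * (d - q) + (w - q) * q + (w - q) * (d - q)) by ring.
  assert (A1 := A q (d - q)). assert (A2 := A (w - q) q). assert (A3 := A (w - q) (d - q)).
  assert (P1 := Rabs_pos q). assert (P2 := Rabs_pos (w - q)). assert (P3 := Rabs_pos (d - q)).
  assert (B1 : Rabs q * Rabs (d - q) <= M * n * (2 * e * n)) by (apply Rmult_le_compat; lra).
  assert (B2 : Rabs (w - q) * Rabs q <= e * n * (M * n)) by (apply Rmult_le_compat; lra).
  assert (B3 : Rabs (w - q) * Rabs (d - q) <= e * n * (2 * e * n)) by (apply Rmult_le_compat; lra).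
  assert (C : e * n * (2 * e * n) <= 2 * e * n ^ 2).
  { replace (e * n * (2 * e * n)) with (2 * e * n ^ 2 * e) by ring.
    assert (0 <= 2 * e * n ^ 2) by (assert (period_sq := pow2_ge_0 n); nra). nra. }
  nra.
Qed.

(* The squared distance to a point of an immersed surface increases along rays
   of the parameter plane near that point. *)
Lemma radial_derivative_pos (W Wu Wv : nat -> R -> R -> R) :
  (forall k, C1pt (W k) (Wu k) (Wv k) 0 0) -> (forall k, W k 0 0 = 0) ->
  ~ (forall k, cross (fun k => Wu k 0 0) (fun k => Wv k 0 0) k = 0) ->
  exists d, 0 < d /\ forall a b, 0 < nrm2 a b < d ^ 2 ->
    0 < sum3 (fun k => W k a b * (a * Wu k a b + b * Wv k a b)).
Proof.
  intros HC H0 HI.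
  set (p := fun k => Wu k 0 0). set (q := fun k => Wv k 0 0).
  set (E := sum3 (fun k => p k ^ 2)). set (F := sum3 (fun k => p k * q k)). set (G := sum3 (fun k => q k ^ 2)).
  assert (HEG : 0 < E * G - F ^ 2).
  { assert (L : E * G - F ^ 2 = cross p q 0 ^ 2 + cross p q 1 ^ 2 + cross p q 2 ^ 2).
    { unfold E, F, G, sum3; simpl; ring. }
    rewrite L. assert (A0 := pow2_ge_0 (cross p q 0)). assert (A1 := pow2_ge_0 (cross p q 1)).
    assert (A2 := pow2_ge_0 (cross p q 2)).
    apply Rnot_le_lt. intros N. apply HI. intros k.
    assert (Z : forall x, x ^ 2 <= 0 -> x = 0).
    { intros x Hx. assert (B := pow2_ge_0 x). apply Rsqr_0_uniq. unfold Rsqr. lra. }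
    destruct k as [|[|k]]; apply Z; fold p q.
    - change (cross p q 0 ^ 2 <= 0). lra.
    - change (cross p q 1 ^ 2 <= 0). lra.
    - change (cross p q 2 ^ 2 <= 0). lra. }
  assert (HE : 0 <= E) by (unfold E, sum3; repeat apply Rplus_le_le_0_compat; apply pow2_ge_0).
  assert (HG : 0 <= G) by (unfold G, sum3; repeat apply Rplus_le_le_0_compat; apply pow2_ge_0).
  assert (HS : 0 < E + G).
  { assert (A := pow2_ge_0 F). destruct (Rtotal_order (E + G) 0) as [N|[N|N]]; try lra.
    assert (E = 0) by lra. assert (G = 0) by lra. rewrite H in HEG. lra. }
  set (m := (E * G - F ^ 2) / (E + G)).
  assert (Hm : 0 < m) by now apply Rdiv_lt_0_compat.
  set (M := sum3 (fun k => Rabs (p k) + Rabs (q k))).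
  assert (PM : forall k, (k < 3)%nat -> Rabs (p k) + Rabs (q k) <= M).
  { assert (Q : forall k, 0 <= Rabs (p k) + Rabs (q k)).
    { intros k. assert (A := Rabs_pos (p k)). assert (B := Rabs_pos (q k)). lra. }
    assert (Q0 := Q 0%nat). assert (Q1 := Q 1%nat). assert (Q2 := Q 2%nat).
    intros k Hk. unfold M, sum3. destruct k as [|[|[|k]]]; [lra..|lia]. }
  assert (HM : 0 <= M).
  { eapply Rle_trans; [|apply (PM 0%nat); lia]. assert (A := Rabs_pos (p 0%nat)). assert (B := Rabs_pos (q 0%nat)). lra. }
  (* Each of the three coordinates loses at most (3 M + 2) e n^2; [e] is chosen so that the total
     loss is at most half of m n^2. *)
  set (K := 3 * (3 * M + 2)).
  assert (HK : 0 < K) by (unfold K; lra).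
  assert (Pe : 0 < Rmin 1 (m / (2 * K))).
  { apply Rmin_pos; [lra|]. apply Rdiv_lt_0_compat; lra. }
  set (e := mkposreal _ Pe).
  assert (He1 : e <= 1) by apply Rmin_l.
  assert (He2 : K * e <= m / 2).
  { apply Rle_trans with (K * (m / (2 * K))).
    - apply Rmult_le_compat_l; [lra|]. apply Rmin_r.
    - right. field. lra. }
  assert (L : forall k, locally_2d (fun a b =>
    Rabs (W k a b - (a * p k + b * q k)) <= e * Rmax (Rabs a) (Rabs b) /\
    Rabs (Wu k a b - p k) < e /\ Rabs (Wv k a b - q k) < e) 0 0).
  { intros k. destruct (HC k) as [D [Cu Cv]].
    generalize (locally_2d_and _ _ _ _ (D e) (locally_2d_and _ _ _ _ (Cu e) (Cv e))).
    apply locally_2d_impl, locally_2d_forall. intros a b [D1 [D2 D3]].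
    rewrite H0, !Rminus_0_r in D1. fold (p k) (q k) in *.
    split; [|split; assumption].
    replace (W k a b - (a * p k + b * q k)) with (W k a b - (p k * a + q k * b)) by ring. exact D1. }
  destruct (locally_2d_and _ _ _ _ (L 0%nat) (locally_2d_and _ _ _ _ (L 1%nat) (L 2%nat))) as [d Hd].
  exists d. split; [apply cond_pos|].
  intros a b [Hab1 Hab2].
  assert (Hdp := cond_pos d).
  set (n := sqrt (nrm2 a b)).
  assert (n0 : 0 < n) by now apply sqrt_lt_R0.
  assert (n2 : n ^ 2 = nrm2 a b) by (unfold n; rewrite pow2_sqrt; lra).
  assert (Sa : Rabs a <= n).
  { unfold n. rewrite <- sqrt_Rsqr_abs. apply sqrt_le_1_alt. unfold nrm2, Rsqr. assert (A := pow2_ge_0 b). lra. }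
  assert (Sb : Rabs b <= n).
  { unfold n. rewrite <- sqrt_Rsqr_abs. apply sqrt_le_1_alt. unfold nrm2, Rsqr. assert (A := pow2_ge_0 a). lra. }
  assert (nd : n < d) by nra.
  destruct (Hd a b) as [B0 [B1 B2]]; [rewrite Rminus_0_r; lra..|].
  assert (X : forall k, (k < 3)%nat ->
    Rabs (W k a b - (a * p k + b * q k)) <= e * Rmax (Rabs a) (Rabs b) /\
    Rabs (Wu k a b - p k) < e /\ Rabs (Wv k a b - q k) < e ->
    (a * p k + b * q k) ^ 2 - (3 * M + 2) * e * n ^ 2 <= W k a b * (a * Wu k a b + b * Wv k a b)).
  { intros k Hk [Y1 [Y2 Y3]].
    assert (e0 := cond_pos e).
    assert (Pa := Rabs_pos a). assert (Pb := Rabs_pos b).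
    assert (Pu := Rabs_pos (p k)). assert (Pv := Rabs_pos (q k)).
    apply perturbed_square_lower_bound; try lra.
    - eapply Rle_trans; [exact Y1|]. apply Rmult_le_compat_l; [lra|]. now apply Rmax_lub.
    - replace (a * Wu k a b + b * Wv k a b - (a * p k + b * q k))
        with (a * (Wu k a b - p k) + b * (Wv k a b - q k)) by ring.
      eapply Rle_trans; [apply Rabs_triang|]. rewrite !Rabs_mult.
      assert (Rabs a * Rabs (Wu k a b - p k) <= n * e) by (apply Rmult_le_compat; try lra; apply Rabs_pos).
      assert (Rabs b * Rabs (Wv k a b - q k) <= n * e) by (apply Rmult_le_compat; try lra; apply Rabs_pos).
      lra.
    - eapply Rle_trans; [apply Rabs_triang|]. rewrite !Rabs_mult.
      assert (PMk := PM k Hk).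
      assert (Rabs a * Rabs (p k) <= n * Rabs (p k)) by (apply Rmult_le_compat_r; lra).
      assert (Rabs b * Rabs (q k) <= n * Rabs (q k)) by (apply Rmult_le_compat_r; lra).
      apply Rle_trans with (n * (Rabs (p k) + Rabs (q k))); [lra|]. rewrite (Rmult_comm M).
      apply Rmult_le_compat_l; lra. }
  assert (X0 := X 0%nat ltac:(lia) B0). assert (X1 := X 1%nat ltac:(lia) B1).
  assert (X2 := X 2%nat ltac:(lia) B2). clear X.
  assert (Q := quadratic_form_lower_bound E F G a b HS). fold m in Q.
  assert (QE : a ^ 2 * E + 2 * a * b * F + b ^ 2 * G =
    (a * p 0%nat + b * q 0%nat) ^ 2 + (a * p 1%nat + b * q 1%nat) ^ 2 + (a * p 2%nat + b * q 2%nat) ^ 2).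
  { unfold E, F, G, sum3. ring. }
  unfold sum3. rewrite QE in Q. rewrite <- n2 in Q.
  assert (Z : K * e * n ^ 2 <= m / 2 * n ^ 2) by (apply Rmult_le_compat_r; nra).
  assert (0 < m * n ^ 2) by (apply Rmult_lt_0_compat; nra).
  unfold K in Z. lra.
Qed.

Lemma open_disk : open2 (fun u v => u ^ 2 + v ^ 2 < 1).
Proof.
  intros u v H. apply (locally_2d_lt nrm2); auto. exact (C1pt_cont _ _ _ _ _ (C1pt_nrm2 u v)).
Qed.

Lemma C1pt_C1_on (D : R -> R -> Prop) (Y : R -> R -> pt) (Yu' Yv' : nat -> R -> R -> R) :
  open2 D -> (forall k u v, D u v -> C1pt (comp Y k) (Yu' k) (Yv' k) u v) ->
  C1_on D Y /\ forall u v, D u v ->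
    (Yu Y u v = fun k => Yu' k u v) /\ (Yv Y u v = fun k => Yv' k u v).
Proof.
  intros HD H. split.
  - intros u v Duv k.
    destruct (C1pt_du_dv D _ _ _ HD (H k) u v Duv) as (A1 & A2 & A3 & A4 & _). auto.
  - intros u v Duv. split; apply functional_extensionality; intros k;
    destruct (C1pt_du_dv D _ _ _ HD (H k) u v Duv) as (_ & _ & _ & _ & A5 & A6); auto.
Qed.

Lemma dist3_cont_at (Y : R -> R -> pt) u v :
  (forall k, continuity_2d_pt (comp Y k) u v) ->
  forall eps, 0 < eps -> exists eta, 0 < eta /\
     forall u' v', dist2 (u', v') (u, v) < eta -> dist3 (Y u' v') (Y u v) < eps.
Proof.
  intros H eps He.
  destruct (proj1 (continuity_2d_pt_dist _ _ _) (continuity_2d_pt_dist3 Y (Y u v) u v H) eps He) as [eta [Heta Q]].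
  exists eta. split; auto. intros u' v' H'. specialize (Q u' v' H').
  rewrite dist3_refl, Rminus_0_r in Q. apply Rabs_def2 in Q. lra.
Qed.

Lemma dist2_shift a b u v : dist2 (u + a, v + b) (u, v) = sqrt (nrm2 a b).
Proof. unfold dist2, nrm2; simpl. f_equal. ring. Qed.

Lemma sqrt_lt_of_sq x d : 0 < d -> x < d ^ 2 -> sqrt x < d.
Proof.
  intros Hd H. destruct (Rle_or_lt 0 x) as [L|L].
  - rewrite <- (sqrt_pow2 d) by lra. apply sqrt_lt_1_alt. lra.
  - rewrite sqrt_neg_0 by lra. lra.
Qed.

Lemma lt_of_sq x d : 0 < d -> x ^ 2 < d ^ 2 -> x < d.
Proof. intros Hd H. apply Rnot_le_lt. intros N. nra. Qed.

Lemma sq_lt_sq x d : 0 <= x -> x < d -> x ^ 2 < d ^ 2.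
Proof. intros. nra. Qed.

(** The third hypothesis says that points of the surface near [Z u v] have a parameter near (u, v):
    no other sheet comes back close to the point. Hence a small ball cuts the surface exactly in the
    image of a sublevel set of the squared distance, which [sublevel_set_disk] parametrizes. *)
Lemma embedded_of_immersion (Z : R -> R -> pt) (Zu Zv : nat -> R -> R -> R) :
  (forall k u v, C1pt (comp Z k) (Zu k) (Zv k) u v) ->
  (forall u v, ~ (forall k, cross (fun k => Zu k u v) (fun k => Zv k u v) k = 0)) ->
  (forall u v d, 0 < d -> exists eta, 0 < eta /\ forall u' v', dist3 (Z u' v') (Z u v) < eta ->
     exists u'' v'', Z u'' v'' = Z u' v' /\ dist2 (u'', v'') (u, v) < d) ->
  (forall u v, exists d, 0 < d /\ forall a b a' b', dist2 (a, b) (u, v) < d ->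
     dist2 (a', b') (u, v) < d -> Z a b = Z a' b' -> a = a' /\ b = b') ->
  embedded_surface (image Z).
Proof.
  intros HC HI Hinv Hinj p [u0 [v0 Hp]].
  set (W := fun k a b => comp Z k (u0 + a) (v0 + b) - co p k).
  set (Wu := fun k a b => Zu k (u0 + a) (v0 + b)).
  set (Wv := fun k a b => Zv k (u0 + a) (v0 + b)).
  assert (CW : forall k a b, C1pt (W k) (Wu k) (Wv k) a b).
  { intros k a b.
    eapply C1pt_ext; [| | | exact (C1pt_plus _ _ _ _ _ _ _ _
      (C1pt_comp _ _ _ _ _ _ _ _ _ a b (HC k (u0 + a) (v0 + b))
        (C1pt_plus _ _ _ _ _ _ _ _ (C1pt_const u0 a b) (C1pt_fst a b))
        (C1pt_plus _ _ _ _ _ _ _ _ (C1pt_const v0 a b) (C1pt_snd a b)))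
      (C1pt_const (- co p k) a b))]; intros; unfold W, Wu, Wv; simpl; ring. }
  destruct (radial_derivative_pos W Wu Wv) as [d0 [Hd0 Hrad]]; auto.
  { intros k. unfold W, Defs.comp. rewrite !Rplus_0_r, Hp. ring. }
  { intros N. apply (HI u0 v0). intros k. specialize (N k). unfold Wu, Wv in N. now rewrite !Rplus_0_r in N. }
  destruct (Hinj u0 v0) as [di [Hdi HJ]].
  set (d1 := Rmin d0 di / 2).
  assert (M0 : 0 < Rmin d0 di) by now apply Rmin_pos.
  assert (M1 := Rmin_l d0 di). assert (M2 := Rmin_r d0 di).
  assert (Hd1 : 0 < d1 < d0) by (unfold d1; lra).
  assert (Hd1i : d1 < di) by (unfold d1; lra).
  destruct (Hinv u0 v0 d1 ltac:(lra)) as [eta [Heta HV]].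
  rewrite Hp in HV.
  set (f := fun a b => sum3 (fun k => W k a b * W k a b)).
  set (fa := fun a b => sum3 (fun k => 2 * (W k a b * Wu k a b))).
  set (fb := fun a b => sum3 (fun k => 2 * (W k a b * Wv k a b))).
  assert (Ef : forall a b, f a b = dist3 (Z (u0 + a) (v0 + b)) p ^ 2).
  { intros a b. unfold dist3. rewrite pow2_sqrt by (repeat apply Rplus_le_le_0_compat; apply pow2_ge_0).
    unfold f, sum3, W, Defs.comp. ring. }
  assert (Cf : forall a b, C1pt f fa fb a b).
  { intros a b. assert (Q : forall k, _) by (intros k; exact (C1pt_mult _ _ _ _ _ _ _ _ (CW k a b) (CW k a b))).
    eapply C1pt_ext; [| | | exact (C1pt_plus _ _ _ _ _ _ _ _ (C1pt_plus _ _ _ _ _ _ _ _ (Q 0%nat) (Q 1%nat)) (Q 2%nat))];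
      intros; unfold f, fa, fb, sum3; ring. }
  destruct (sublevel_set_disk f fa fb d0 d1 (eta ^ 2)) as (P & Ps & Pt & Q & Qs & Qt & CP & CQ & HD & Hlt & Hle & Hsur & Hin); auto.
  { rewrite Ef, !Rplus_0_r, Hp, dist3_refl. ring. }
  { nra. }
  { intros a b Hab. replace (a * fa a b + b * fb a b) with
      (2 * sum3 (fun k => W k a b * (a * Wu k a b + b * Wv k a b))) by (unfold fa, fb, sum3; ring).
    assert (A := Hrad a b Hab). lra. }
  (* A point on the circle of radius [d1] mapped within [eta] of [p] would have a second parameter
     closer than [d1], against local injectivity. *)
  { intros a b Hab. rewrite Ef. apply Rnot_lt_le. intros N.
    destruct (HV (u0 + a) (v0 + b)) as [u'' [v'' [E D]]]; [now apply lt_of_sq|].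
    assert (E2 : dist2 (u0 + a, v0 + b) (u0, v0) = d1).
    { rewrite dist2_shift, Hab. apply sqrt_pow2. lra. }
    destruct (HJ u'' v'' (u0 + a) (v0 + b)) as [-> ->]; auto; lra. }
  exists eta. split; auto.
  exists (fun s t => Z (u0 + P s t) (v0 + Q s t)).
  intros D.
  set (Y := fun s t => Z (u0 + P s t) (v0 + Q s t)).
  assert (CY : forall k s t, C1pt (comp Y k)
     (fun s t => Zu k (u0 + P s t) (v0 + Q s t) * (0 + Ps s t) + Zv k (u0 + P s t) (v0 + Q s t) * (0 + Qs s t))
     (fun s t => Zu k (u0 + P s t) (v0 + Q s t) * (0 + Pt s t) + Zv k (u0 + P s t) (v0 + Q s t) * (0 + Qt s t)) s t).
  { intros k s t. exact (C1pt_comp _ _ _ _ _ _ _ _ _ s t (HC k _ _)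
        (C1pt_plus _ _ _ _ _ _ _ _ (C1pt_const u0 s t) (CP s t))
        (C1pt_plus _ _ _ _ _ _ _ _ (C1pt_const v0 s t) (CQ s t))). }
  destruct (C1pt_C1_on D Y _ _ open_disk (fun k u v _ => CY k u v)) as [C1 EY].
  assert (Hdl : forall s t, nrm2 s t <= 1 -> dist2 (u0 + P s t, v0 + Q s t) (u0, v0) < di).
  { intros s t Hst. rewrite dist2_shift. assert (A := Hle s t Hst). apply sqrt_lt_of_sq; auto. nra. }
  (* Injectivity is recorded on the closed disk, because continuity of the inverse is obtained by
     compactness. *)
  assert (YI : forall s t s' t', nrm2 s t <= 1 -> nrm2 s' t' <= 1 -> Y s t = Y s' t' -> s = s' /\ t = t').
  { intros s t s' t' H1 H2 E. destruct (HJ _ _ _ _ (Hdl s t H1) (Hdl s' t' H2) E). apply Hin; lra. }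
  split; [exact C1|]. split; [|split; [|split; [|split; [|split]]]].
  - intros s t Hst N. destruct (EY s t Hst) as [E1 E2]. apply (HI (u0 + P s t) (v0 + Q s t)).
    intros k. specialize (N k). rewrite E1, E2 in N.
    apply Rmult_eq_reg_l with (Ps s t * Qt s t - Pt s t * Qs s t); [|apply HD].
    rewrite Rmult_0_r, <- N.
    destruct k as [|[|k]]; simpl; ring.
  - intros s t Hst. split; [now exists (u0 + P s t), (v0 + Q s t)|].
    assert (A := Hlt s t Hst). rewrite Ef in A.
    now apply lt_of_sq.
  - intros q [[u' [v' Eq]] Hq]. subst q.
    destruct (HV u' v' Hq) as [u'' [v'' [E Dd]]].
    assert (Eu : u'' = u0 + (u'' - u0)) by ring. assert (Ev : v'' = v0 + (v'' - v0)) by ring.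
    rewrite Eu, Ev, dist2_shift in Dd.
    assert (Nn := nrm2_nonneg (u'' - u0) (v'' - v0)).
    destruct (Hsur (u'' - u0) (v'' - v0)) as [s [t [S1 [S2 S3]]]].
    + rewrite <- (pow2_sqrt (nrm2 (u'' - u0) (v'' - v0))) by auto.
      apply Rlt_le, sq_lt_sq; auto using sqrt_pos.
    + rewrite Ef, <- Eu, <- Ev, E. apply sq_lt_sq; auto using dist3_nonneg.
    + exists s, t. split; [exact S1|]. unfold Y. rewrite S2, S3, <- Eu, <- Ev. exact E.
  - intros s t s' t' H1 H2. apply YI; unfold nrm2; apply Rlt_le; assumption.
  - intros s t Hst eps He. destruct (dist3_cont_at Y s t (fun k => C1pt_cont _ _ _ _ _ (CY k s t)) eps He) as [r [Hr HR]].
    exists r. split; auto.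
  - intros s t Hst eps He.
    destruct (inverse_continuous_on_compact Y (fun x y => nrm2 x y - 1) (Y s t) (-1) 1 (-1) 1 s t) with (eps := eps)
      as [r [Hr HR]]; auto.
    + intros x y _ _. split.
      * intros k. exact (C1pt_cont _ _ _ _ _ (CY k x y)).
      * apply continuity_2d_pt_minus; [exact (C1pt_cont _ _ _ _ _ (C1pt_nrm2 x y))|apply continuity_2d_pt_const].
    + intros x y _ _ Hxy E. apply YI; auto; unfold nrm2 in *; [lra|]. apply Rlt_le. exact Hst.
    + exists r. split; auto. intros x y Hxy. unfold D in Hxy. apply HR; unfold nrm2; try lra;
        assert (A1 := pow2_ge_0 x); assert (A2 := pow2_ge_0 y); nra.
Qed.

(** * Polar coordinates *)

(** Carries regularity over to a function [g] given without a formula, such as a map defined by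
    choice, once it agrees locally with a C^1 function. *)
Lemma C1pt_congr_loc f fu fv g u v :
  locally_2d (fun s t => f s t = g s t /\ C1pt f fu fv s t) u v ->
  C1pt g (du g) (dv g) u v /\ du g u v = fu u v /\ dv g u v = fv u v.
Proof.
  intros L.
  assert (E : locally_2d (fun s t => f s t = g s t /\ fu s t = du g s t /\ fv s t = dv g s t) u v).
  { revert L. apply locally_2d_impl_strong, locally_2d_forall. intros s t L.
    destruct (locally_2d_singleton _ _ _ L) as [E C].
    destruct (C1pt_derive _ _ _ _ _ C) as [D1 D2].
    split; [exact E|]. destruct L as [d Hd]. split; symmetry; apply is_derive_unique.
    - apply (is_derive_ext_loc (fun x => f x t)); auto. exists d. intros y Hy. apply Hd; [exact Hy|].
      replace (t - t) with 0 by ring. rewrite Rabs_R0. apply cond_pos.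
    - apply (is_derive_ext_loc (fun x => f s x)); auto. exists d. intros y Hy. apply Hd; [|exact Hy].
      replace (s - s) with 0 by ring. rewrite Rabs_R0. apply cond_pos. }
  destruct (locally_2d_singleton _ _ _ L) as [_ C].
  destruct (locally_2d_singleton _ _ _ E) as [_ [E1 E2]].
  split; [|split; congruence]. exact (C1pt_ext_loc _ _ _ _ _ _ _ _ E C).
Qed.

Lemma polar_coordinates s t : (s, t) <> (0, 0) -> exists r a, exp r * cos a = s /\ exp r * sin a = t.
Proof.
  intros N.
  assert (P : 0 < s ^ 2 + t ^ 2).
  { assert (A := pow2_ge_0 s). assert (B := pow2_ge_0 t).
    destruct (Req_dec (s ^ 2 + t ^ 2) 0) as [Z|Z]; [|lra].
    exfalso. apply N. f_equal; apply Rsqr_0_uniq; unfold Rsqr; lra. }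
  set (n := sqrt (s ^ 2 + t ^ 2)).
  assert (n0 : 0 < n) by now apply sqrt_lt_R0.
  assert (n2 : n * n = s ^ 2 + t ^ 2) by (apply sqrt_sqrt; lra).
  assert (B : -1 <= s / n <= 1).
  { split; [apply Rmult_le_reg_r with n|apply Rmult_le_reg_r with n]; auto;
    unfold Rdiv; rewrite Rmult_assoc, Rinv_l by lra; nra. }
  assert (Hs : sin (acos (s / n)) = Rabs t / n).
  { rewrite sin_acos by auto. rewrite <- (Rabs_right n) at 2 by lra. rewrite <- Rabs_div by lra.
    rewrite <- sqrt_Rsqr_abs. f_equal. unfold Rsqr.
    transitivity ((n * n - s ^ 2) / (n * n)); [field; lra|]. rewrite n2 at 1. field. lra. }
  exists (ln n). rewrite exp_ln by auto.
  destruct (Rle_or_lt 0 t) as [L|L].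
  - exists (acos (s / n)). rewrite cos_acos, Hs, Rabs_right by (auto; lra). split; field; lra.
  - exists (- acos (s / n)). rewrite cos_neg, sin_neg, cos_acos, Hs, Rabs_left by auto. split; field; lra.
Qed.

(** A local branch of the logarithm with prescribed value r0 + i a0: after a rotation by - a0 the
    base point is on the positive axis, where atan (q / p) is the argument. The value is prescribed
    because the argument serves as a coordinate, not modulo 2 PI. *)
Lemma local_polar_coordinates r0 a0 : exists r a : R -> R -> R,
  r (exp r0 * cos a0) (exp r0 * sin a0) = r0 /\ a (exp r0 * cos a0) (exp r0 * sin a0) = a0 /\
  locally_2d (fun s t => exp (r s t) * cos (a s t) = s /\ exp (r s t) * sin (a s t) = t /\
    C1pt r (fun s t => s / nrm2 s t) (fun s t => t / nrm2 s t) s t /\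
    C1pt a (fun s t => - t / nrm2 s t) (fun s t => s / nrm2 s t) s t)
    (exp r0 * cos a0) (exp r0 * sin a0).
Proof.
  set (x := cos a0). set (y := sin a0).
  assert (xy : y ^ 2 = 1 - x ^ 2).
  { assert (E := sin2_cos2 a0). unfold Rsqr in E. fold x y in E. lra. }
  assert (X := exp_pos r0).
  set (p := fun s t => s * x + t * y). set (q := fun s t => t * x - s * y).
  assert (pq : forall s t, p s t ^ 2 + q s t ^ 2 = nrm2 s t).
  { intros s t. transitivity ((x ^ 2 + y ^ 2) * nrm2 s t); [unfold p, q, nrm2; ring|rewrite xy; ring]. }
  exists (fun s t => / 2 * ln (nrm2 s t)), (fun s t => a0 + atan (q s t / p s t)).
  assert (N0 : nrm2 (exp r0 * x) (exp r0 * y) = exp r0 ^ 2).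
  { transitivity (exp r0 ^ 2 * (x ^ 2 + y ^ 2)); [unfold nrm2; ring|rewrite xy; ring]. }
  assert (Cp : forall s t, continuity_2d_pt p s t).
  { intros s t. unfold p. apply continuity_2d_pt_plus; apply continuity_2d_pt_mult;
      auto using continuity_2d_pt_id1, continuity_2d_pt_id2, continuity_2d_pt_const. }
  assert (P0 : p (exp r0 * x) (exp r0 * y) = exp r0).
  { transitivity (exp r0 * (x ^ 2 + y ^ 2)); [unfold p; ring|rewrite xy; ring]. }
  split; [|split].
  - rewrite N0. replace (exp r0 ^ 2) with (exp r0 * exp r0) by ring. rewrite ln_mult, ln_exp by auto. field.
  - replace (q (exp r0 * x) (exp r0 * y)) with 0 by (unfold q; ring).
    unfold Rdiv. rewrite Rmult_0_l, atan_0. ring.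
  - rewrite <- P0 in X.
    generalize (locally_2d_gt p 0 _ _ (Cp _ _) X). apply locally_2d_impl_strong, locally_2d_forall.
    intros s t L. assert (Hp := locally_2d_singleton _ _ _ L). cbv beta in Hp.
    assert (Nn : forall s t, 0 < p s t -> 0 < nrm2 s t).
    { intros s' t' Hp'. rewrite <- pq. assert (B := pow2_ge_0 (q s' t')). nra. }
    assert (Np := Nn s t Hp).
    assert (S := sqrt_lt_R0 _ Np). assert (SS := sqrt_sqrt (nrm2 s t) ltac:(lra)).
    assert (Ee : exp (/ 2 * ln (nrm2 s t)) = sqrt (nrm2 s t)).
    { rewrite <- (exp_ln (sqrt (nrm2 s t))) by auto. f_equal.
      rewrite <- SS at 1. rewrite ln_mult by auto. field. }
    assert (Es : sqrt (1 + (q s t / p s t) ^ 2) = sqrt (nrm2 s t) / p s t).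
    { rewrite <- (sqrt_pow2 (p s t)) at 2 by lra. rewrite <- sqrt_div_alt by nra. f_equal.
      rewrite <- pq. field. lra. }
    assert (Ec : cos (atan (q s t / p s t)) = p s t / sqrt (nrm2 s t)).
    { rewrite cos_atan. unfold Rsqr. replace (q s t / p s t * (q s t / p s t)) with ((q s t / p s t) ^ 2) by ring.
      rewrite Es. field. lra. }
    assert (Esn : sin (atan (q s t / p s t)) = q s t / sqrt (nrm2 s t)).
    { rewrite sin_atan. unfold Rsqr. replace (q s t / p s t * (q s t / p s t)) with ((q s t / p s t) ^ 2) by ring.
      rewrite Es. field. lra. }
    rewrite Ee, cos_plus, sin_plus, Ec, Esn. fold x y.
    assert (CN : continuity_2d_pt (fun s t => / nrm2 s t) s t).
    { apply continuity_2d_pt_inv; [|lra]. exact (C1pt_cont _ _ _ _ _ (C1pt_nrm2 s t)). }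
    split; [|split; [|split]].
    + transitivity (s * (x ^ 2 + y ^ 2)); [unfold p, q; field; lra|rewrite xy; ring].
    + transitivity (t * (x ^ 2 + y ^ 2)); [unfold p, q; field; lra|rewrite xy; ring].
    + apply C1pt_intro.
      * revert L. apply locally_2d_impl, locally_2d_forall. intros s' t' L. apply Nn in L.
        unfold nrm2 in *. auto_derive; [exact L|]. field. lra.
      * unfold nrm2 in *. auto_derive; [exact Np|]. field. lra.
      * apply continuity_2d_pt_mult; auto using continuity_2d_pt_id1.
      * apply continuity_2d_pt_mult; auto using continuity_2d_pt_id2.
    + assert (Da : forall s t, 0 < p s t ->
        is_derive (fun z => a0 + atan (q z t / p z t)) s (- t / nrm2 s t) /\
        is_derive (fun z => a0 + atan (q s z / p s z)) t (s / nrm2 s t)).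
      { intros s' t' L'. assert (Np' := Nn s' t' L'). split.
        - replace (- t' / nrm2 s' t') with ((- y * p s' t' - x * q s' t') / (p s' t' ^ 2 + q s' t' ^ 2)).
          + unfold p, q in *. auto_derive; [lra|].
            unfold Rsqr. field. split; [|lra]. apply Rgt_not_eq. rewrite <- pq in Np'. unfold p, q in Np'. lra.
          + rewrite pq. f_equal. transitivity (- t' * (x ^ 2 + y ^ 2)); [unfold p, q; ring|rewrite xy; ring].
        - replace (s' / nrm2 s' t') with ((x * p s' t' - y * q s' t') / (p s' t' ^ 2 + q s' t' ^ 2)).
          + unfold p, q in *. auto_derive; [lra|].
            unfold Rsqr. field. split; [|lra]. apply Rgt_not_eq. rewrite <- pq in Np'. unfold p, q in Np'. lra.
          + rewrite pq. f_equal. transitivity (s' * (x ^ 2 + y ^ 2)); [unfold p, q; ring|rewrite xy; ring]. }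
      apply C1pt_intro.
      * revert L. apply locally_2d_impl, locally_2d_forall. intros s' t' L'. now apply Da.
      * now apply Da.
      * apply continuity_2d_pt_mult; auto. apply continuity_2d_pt_opp, continuity_2d_pt_id2.
      * apply continuity_2d_pt_mult; auto using continuity_2d_pt_id1.
Qed.

(** * Geometry of the horizontal catenoid *)

Lemma cosh_sinh_sq x : cosh x ^ 2 = 1 + sinh x ^ 2.
Proof.
  unfold cosh, sinh. assert (E : exp x * exp (- x) = 1).
  { rewrite <- exp_plus. replace (x + - x) with 0 by ring. apply exp_0. }
  replace (((exp x + exp (- x)) / 2) ^ 2) with (((exp x - exp (- x)) / 2) ^ 2 + exp x * exp (- x)) by field.
  rewrite E. ring.
Qed.

Lemma cosh_ge1 x : 1 <= cosh x.
Proof.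
  assert (E := cosh_sinh_sq x). assert (A := pow2_ge_0 (sinh x)).
  assert (P : 0 < cosh x).
  { unfold cosh. assert (B := exp_pos x). assert (D := exp_pos (- x)). lra. }
  nra.
Qed.

Lemma sinh_odd x : sinh (- x) = - sinh x.
Proof. unfold sinh. rewrite Ropp_involutive. field. Qed.

Lemma cosh_even x : cosh (- x) = cosh x.
Proof. unfold cosh. rewrite Ropp_involutive. field. Qed.

Lemma sin_sq x : sin x ^ 2 = 1 - cos x ^ 2.
Proof. assert (E := sin2_cos2 x). unfold Rsqr in E. lra. Qed.

Lemma dgm_eq i j l p : dgm i j l p =
  match i, j, l with
  | O, O, S O => co p 1 / 2
  | O, S O, O | S O, O, O => - co p 1 / 4
  | O, S O, S O | S O, O, S O => - co p 0 / 4
  | O, S (S _), S O | S (S _), O, S O => / 2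
  | S O, S O, O => co p 0 / 2
  | S O, S (S _), O | S (S _), S O, O => - / 2
  | _, _, _ => 0
  end.
Proof.
  unfold dgm. destruct p as [[a b] c].
  destruct i as [|[|i]], j as [|[|j]], l as [|[|l]]; unfold gmet, sum3; simpl;
    apply is_derive_unique; auto_derive; auto; field.
Qed.

(** The contact form dx3 + (x2 dx1 - x1 dx2) / 2, third element of the orthonormal coframe,
    evaluated on [a]. *)
Definition frame3 (p : pt) (a : nat -> R) : R :=
  a 2%nat + (co p 1 * a 0%nat - co p 0 * a 1%nat) / 2.

Lemma gdot_frame p a b :
  gdot p a b = a 0%nat * b 0%nat + a 1%nat * b 1%nat + frame3 p a * frame3 p b.
Proof. destruct p as [[x y] z]. unfold gdot, gmet, frame3, sum3; simpl. field. Qed.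

(** On the diagonal the connection rotates the first two frame components at rate [frame3] and
    leaves the third uncorrected. The diagonal case suffices, because conformality removes the mixed
    term from the mean curvature. *)
Lemma covd_frame p s a :
  covd p s a a 0 = s 0%nat + a 1%nat * frame3 p a /\
  covd p s a a 1 = s 1%nat - a 0%nat * frame3 p a /\
  frame3 p (covd p s a a) = frame3 p s.
Proof.
  destruct p as [[x y] z].
  assert (E0 : covd (x, y, z) s a a 0 = s 0%nat + a 1%nat * frame3 (x, y, z) a).
  { unfold covd, Gam, sum3. rewrite !dgm_eq. unfold ginv, frame3, sum3; simpl. field. }
  assert (E1 : covd (x, y, z) s a a 1 = s 1%nat - a 0%nat * frame3 (x, y, z) a).
  { unfold covd, Gam, sum3. rewrite !dgm_eq. unfold ginv, frame3, sum3; simpl. field. }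
  split; [|split]; auto.
  unfold frame3 at 1. rewrite E0, E1.
  unfold covd, Gam, sum3. rewrite !dgm_eq. unfold ginv, frame3, sum3; simpl. field.
Qed.

Ltac cont2d := repeat first
  [ assumption
  | apply continuity_2d_pt_plus | apply continuity_2d_pt_minus | apply continuity_2d_pt_opp
  | apply continuity_2d_pt_const | apply continuity_2d_pt_id1 | apply continuity_2d_pt_id2
  | apply continuity_2d_pt_mult ].

(** * Derivatives of the parametrization, conformality and minimality *)

Section Catenoid.
Variables (al C H : R) (phi g beta G : R -> R).
Hypothesis al0 : 0 < al.
Hypothesis C0 : 0 < C.
Hypothesis H0 : 0 < H.
(** With g = G' in place of the square root of [P], both phi' and g' are polynomial in g, cos phi
    and sin phi, so that derivatives of every order can be compared by [ring] and [field]. *)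
Hypothesis Dphi : forall u, is_derive phi u (g u * cos (phi u) ^ 2 - al).
Hypothesis Dg : forall u, is_derive g u (sin (phi u) * cos (phi u) * (C ^ 2 + g u ^ 2)).
Hypothesis Dbeta : forall u, is_derive beta u (C * cos (phi u) ^ 2).
Hypothesis DG : forall u, is_derive G u (g u).

Let cphi u := cos (phi u).
Let sphi u := sin (phi u).
Let Sh u v := sinh (al * v + beta u).
Let Ch u v := cosh (al * v + beta u).

Definition cx1 u v := g u / al * cos (phi u) * sinh (al * v + beta u) - C / al * sin (phi u) * cosh (al * v + beta u).
Definition cx2 u v := C * v - G u.
Definition cx3 u v := - (cx1 u v * cx2 u v) / 2
  + C / al * (g u / al - 1) * cos (phi u) * cosh (al * v + beta u)
  - / al * (C ^ 2 / al + g u) * sin (phi u) * sinh (al * v + beta u).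
Definition cX u v : pt := (cx1 u v, cx2 u v, cx3 u v).

(** The terms in 1 / al cancel: the contributions of g', phi' and beta' compensate each other. *)
Definition cx1u u v := g u * sphi u * Sh u v + C * cphi u * Ch u v.
Definition cx1v u v := g u * cphi u * Ch u v - C * sphi u * Sh u v.
(* third components of the partial derivatives of [cX] in the orthonormal frame *)
Definition ce3u u v := g u * cphi u * Sh u v - C * sphi u * Ch u v.
Definition ce3v u v := - (C * cphi u * Sh u v) - g u * sphi u * Ch u v.
Definition cx3u u v := ce3u u v - (cx2 u v * cx1u u v + cx1 u v * g u) * / 2.
Definition cx3v u v := ce3v u v - (cx2 u v * cx1v u v - cx1 u v * C) * / 2.

Let dphi u := g u * (cphi u * cphi u) - al.
Let quad u := C * C + g u * g u.
Definition cx1uu u v := cphi u * sphi u * sphi u * quad u * Sh u v + g u * cphi u * dphi u * Sh u v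
  + g u * sphi u * Ch u v * (C * (cphi u * cphi u)) - C * sphi u * dphi u * Ch u v + C * cphi u * Sh u v * (C * (cphi u * cphi u)).
Definition cx1uv u v := al * (g u * sphi u * Ch u v + C * cphi u * Sh u v).
Definition cx1vv u v := al * (g u * cphi u * Sh u v - C * sphi u * Ch u v).
Definition cx2uu u (v : R) := - (cphi u * sphi u * quad u).
Definition cx3uu u v := al * cx1u u v - (cx2 u v * cx1uu u v - cx1 u v * cx2uu u v) * / 2.
Definition cx3uv u v := al * cx1v u v - (C * cx1u u v + cx2 u v * cx1uv u v + cx1v u v * g u) * / 2.
Definition cx3vv u v := - al * cx1u u v - cx2 u v * cx1vv u v * / 2.

Lemma cont_phi u : continuity_pt phi u.
Proof. exact (is_derive_continuity_pt _ _ _ (Dphi u)). Qed.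

Lemma cont2d_c u v : continuity_2d_pt (fun u _ => cphi u) u v.
Proof.
  apply (continuity_1d_2d_pt_comp cphi (fun u _ => u)); auto using continuity_2d_pt_id1.
  apply (continuity_pt_comp phi cos); [apply cont_phi|apply continuity_cos].
Qed.

Lemma cont2d_s u v : continuity_2d_pt (fun u _ => sphi u) u v.
Proof.
  apply (continuity_1d_2d_pt_comp sphi (fun u _ => u)); auto using continuity_2d_pt_id1.
  apply (continuity_pt_comp phi sin); [apply cont_phi|apply continuity_sin].
Qed.

Lemma cont2d_g u v : continuity_2d_pt (fun u _ => g u) u v.
Proof.
  apply (continuity_1d_2d_pt_comp g (fun u _ => u)); auto using continuity_2d_pt_id1.
  exact (is_derive_continuity_pt _ _ _ (Dg u)).
Qed.

Lemma cont2d_x2 u v : continuity_2d_pt cx2 u v.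
Proof.
  unfold cx2. cont2d.
  apply (continuity_1d_2d_pt_comp G (fun u _ => u)); auto using continuity_2d_pt_id1.
  exact (is_derive_continuity_pt _ _ _ (DG u)).
Qed.

Lemma cont2d_A u v : continuity_2d_pt (fun u v => al * v + beta u) u v.
Proof.
  cont2d. apply (continuity_1d_2d_pt_comp beta (fun u _ => u)); auto using continuity_2d_pt_id1.
  exact (is_derive_continuity_pt _ _ _ (Dbeta u)).
Qed.

Lemma cont2d_Sh u v : continuity_2d_pt Sh u v.
Proof.
  apply (continuity_1d_2d_pt_comp sinh (fun u v => al * v + beta u)); [|apply cont2d_A].
  apply derivable_continuous_pt, derivable_pt_sinh.
Qed.

Lemma cont2d_Ch u v : continuity_2d_pt Ch u v.
Proof.
  apply (continuity_1d_2d_pt_comp cosh (fun u v => al * v + beta u)); [|apply cont2d_A].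
  apply derivable_continuous_pt, derivable_pt_cosh.
Qed.

Lemma cont2d_x1 u v : continuity_2d_pt cx1 u v.
Proof.
  assert (A1 := cont2d_c u v). assert (A2 := cont2d_s u v). assert (A3 := cont2d_g u v).
  assert (A4 := cont2d_Sh u v). assert (A5 := cont2d_Ch u v).
  unfold cx1, Rdiv. fold (Sh u v). cont2d.
Qed.

Ltac dcat := auto_derive;
  [ repeat match goal with |- _ /\ _ => split | |- True => exact I end;
    first [ exact (ex_intro _ _ (Dphi _)) | exact (ex_intro _ _ (Dg _))
          | exact (ex_intro _ _ (Dbeta _)) | exact (ex_intro _ _ (DG _)) ]
  | try rewrite (is_derive_unique (fun x => phi x) _ _ (Dphi _));
    try rewrite (is_derive_unique (fun x => g x) _ _ (Dg _));
    try rewrite (is_derive_unique (fun x => beta x) _ _ (Dbeta _));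
    try rewrite (is_derive_unique (fun x => G x) _ _ (DG _)) ].

Lemma D_x1 u v : is_derive (fun u => cx1 u v) u (cx1u u v) /\ is_derive (fun v => cx1 u v) v (cx1v u v).
Proof.
  unfold cx1, cx1u, cx1v, cphi, sphi, Sh, Ch. split.
  - dcat. field. lra.
  - dcat. field. lra.
Qed.

Lemma D_x2 u v : is_derive (fun u => cx2 u v) u (- g u) /\ is_derive (fun v => cx2 u v) v C.
Proof.
  unfold cx2. split.
  - dcat. ring.
  - dcat. ring.
Qed.

Lemma D_x3 u v : is_derive (fun u => cx3 u v) u (cx3u u v) /\ is_derive (fun v => cx3 u v) v (cx3v u v).
Proof.
  assert (E := sin_sq (phi u)).
  unfold cx3, cx1, cx2, cx3u, cx3v, ce3u, ce3v, cx1u, cx1v, cx1, cx2, cphi, sphi, Sh, Ch. split.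
  - dcat. apply Rminus_diag_uniq.
    (* The two sides differ by an explicit multiple of sin^2 + cos^2 - 1, the one relation that
       [field] does not know. *)
    transitivity (- cos (phi u) * (C ^ 2 + g u ^ 2) * sinh (al * v + beta u) / al
      * (sin (phi u) ^ 2 - (1 - cos (phi u) ^ 2))); [field; lra|]. rewrite E. ring.
  - dcat. field. lra.
Qed.

Lemma D_x1u u v : is_derive (fun u => cx1u u v) u (cx1uu u v) /\ is_derive (fun v => cx1u u v) v (cx1uv u v).
Proof.
  unfold cx1u, cx1uu, cx1uv, dphi, quad, cphi, sphi, Sh, Ch. split.
  - dcat. ring.
  - dcat. ring.
Qed.

Lemma D_x1v u v : is_derive (fun u => cx1v u v) u (cx1uv u v) /\ is_derive (fun v => cx1v u v) v (cx1vv u v).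
Proof.
  unfold cx1v, cx1vv, cx1uv, dphi, quad, cphi, sphi, Sh, Ch. split.
  - dcat. ring.
  - dcat. ring.
Qed.

Lemma D_x2u u v : is_derive (fun u => - g u) u (cx2uu u v).
Proof. unfold cx2uu, quad, cphi, sphi. dcat. ring. Qed.

Lemma D_x3u u v : is_derive (fun u => cx3u u v) u (cx3uu u v) /\ is_derive (fun v => cx3u u v) v (cx3uv u v).
Proof.
  unfold cx3u, cx3uu, cx3uv, ce3u, cx1u, cx1uu, cx1uv, cx1v, cx2uu, cx1, cx2, dphi, quad, cphi, sphi, Sh, Ch. split.
  - dcat. field. lra.
  - dcat. field. lra.
Qed.

Lemma D_x3v u v : is_derive (fun u => cx3v u v) u (cx3uv u v) /\ is_derive (fun v => cx3v u v) v (cx3vv u v).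
Proof.
  assert (E := sin_sq (phi u)).
  unfold cx3v, cx3uv, cx3vv, ce3v, cx1u, cx1uv, cx1v, cx1vv, cx1, cx2, dphi, quad, cphi, sphi, Sh, Ch. split.
  - dcat. apply Rminus_diag_uniq.
    transitivity (- cos (phi u) * (C ^ 2 + g u ^ 2) * cosh (al * v + beta u)
      * (sin (phi u) ^ 2 - (1 - cos (phi u) ^ 2))); [field; lra|]. rewrite E. ring.
  - dcat. field. lra.
Qed.

Ltac ccat u v :=
  assert (A1 := cont2d_c u v); assert (A2 := cont2d_s u v); assert (A3 := cont2d_g u v);
  assert (A4 := cont2d_Sh u v); assert (A5 := cont2d_Ch u v);
  assert (A6 := cont2d_x1 u v); assert (A7 := cont2d_x2 u v);
  unfold cx3u, cx3v, cx3uu, cx3uv, cx3vv, ce3u, ce3v, cx1u, cx1v, cx1uu, cx1uv, cx1vv, cx2uu, dphi, quad; cont2d.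

Lemma C1_x1 u v : C1pt cx1 cx1u cx1v u v.
Proof.
  apply C1pt_intro; [apply locally_2d_forall; intros; apply D_x1|apply D_x1|ccat u v..].
Qed.

Lemma C1_x2 u v : C1pt cx2 (fun u _ => - g u) (fun _ _ => C) u v.
Proof.
  apply C1pt_intro; [apply locally_2d_forall; intros; apply D_x2|apply D_x2|ccat u v..].
Qed.

Lemma C1_x3 u v : C1pt cx3 cx3u cx3v u v.
Proof.
  apply C1pt_intro; [apply locally_2d_forall; intros; apply D_x3|apply D_x3|ccat u v..].
Qed.

Lemma C1_x1u u v : C1pt cx1u cx1uu cx1uv u v.
Proof.
  apply C1pt_intro; [apply locally_2d_forall; intros; apply D_x1u|apply D_x1u|ccat u v..].
Qed.

Lemma C1_x1v u v : C1pt cx1v cx1uv cx1vv u v.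
Proof.
  apply C1pt_intro; [apply locally_2d_forall; intros; apply D_x1v|apply D_x1v|ccat u v..].
Qed.

Lemma C1_x2u u v : C1pt (fun u _ => - g u) cx2uu (fun _ _ => 0) u v.
Proof.
  apply C1pt_intro; [apply locally_2d_forall; intros; apply (D_x2u _ 0)|apply @is_derive_const|ccat u v..].
Qed.

Lemma C1_x3u u v : C1pt cx3u cx3uu cx3uv u v.
Proof.
  apply C1pt_intro; [apply locally_2d_forall; intros; apply D_x3u|apply D_x3u|ccat u v..].
Qed.

Lemma C1_x3v u v : C1pt cx3v cx3uv cx3vv u v.
Proof.
  apply C1pt_intro; [apply locally_2d_forall; intros; apply D_x3v|apply D_x3v|ccat u v..].
Qed.

Definition cXu (k : nat) : R -> R -> R :=
  match k with 0%nat => cx1u | 1%nat => fun u _ => - g u | _ => cx3u end.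
Definition cXv (k : nat) : R -> R -> R :=
  match k with 0%nat => cx1v | 1%nat => fun _ _ => C | _ => cx3v end.
Definition cXuu (k : nat) : R -> R -> R :=
  match k with 0%nat => cx1uu | 1%nat => cx2uu | _ => cx3uu end.
Definition cXuv (k : nat) : R -> R -> R :=
  match k with 0%nat => cx1uv | 1%nat => fun _ _ => 0 | _ => cx3uv end.
Definition cXvv (k : nat) : R -> R -> R :=
  match k with 0%nat => cx1vv | 1%nat => fun _ _ => 0 | _ => cx3vv end.

Lemma C1_X k u v : C1pt (comp cX k) (cXu k) (cXv k) u v.
Proof. destruct k as [|[|k]]; [apply C1_x1|apply C1_x2|apply C1_x3]. Qed.

Lemma C1_Xu k u v : C1pt (cXu k) (cXuu k) (cXuv k) u v.
Proof. destruct k as [|[|k]]; [apply C1_x1u|apply C1_x2u|apply C1_x3u]. Qed.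

Lemma C1_Xv k u v : C1pt (cXv k) (cXuv k) (cXvv k) u v.
Proof. destruct k as [|[|k]]; [apply C1_x1v|apply C1pt_const|apply C1_x3v]. Qed.

Lemma du_dv_global f fu fv : (forall u v, C1pt f fu fv u v) -> du f = fu /\ dv f = fv.
Proof.
  intros Hf. split; apply functional_extensionality; intros u; apply functional_extensionality; intros v;
  destruct (C1pt_derive _ _ _ _ _ (Hf u v)) as [D1 D2];
    [exact (is_derive_unique _ _ _ D1)|exact (is_derive_unique _ _ _ D2)].
Qed.

Lemma ex_derive_C1pt f fu fv u v : C1pt f fu fv u v ->
  ex_derive (fun z => f z v) u /\ ex_derive (fun z => f u z) v.
Proof. intros Hf. destruct (C1pt_derive _ _ _ _ _ Hf). split; eexists; eassumption. Qed.

Lemma Yu_cX u v : Yu cX u v = (fun k => cXu k u v).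
Proof. apply functional_extensionality; intros k. unfold Yu. now rewrite (proj1 (du_dv_global _ _ _ (C1_X k))). Qed.
Lemma Yv_cX u v : Yv cX u v = (fun k => cXv k u v).
Proof. apply functional_extensionality; intros k. unfold Yv. now rewrite (proj2 (du_dv_global _ _ _ (C1_X k))). Qed.
Lemma Yuu_cX u v : Yuu cX u v = (fun k => cXuu k u v).
Proof.
  apply functional_extensionality; intros k. unfold Yuu.
  now rewrite (proj1 (du_dv_global _ _ _ (C1_X k))), (proj1 (du_dv_global _ _ _ (C1_Xu k))).
Qed.
Lemma Yvv_cX u v : Yvv cX u v = (fun k => cXvv k u v).
Proof.
  apply functional_extensionality; intros k. unfold Yvv.
  now rewrite (proj2 (du_dv_global _ _ _ (C1_X k))), (proj2 (du_dv_global _ _ _ (C1_Xv k))).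
Qed.

Lemma C2_cX : C2_plane cX.
Proof.
  intros u v k.
  destruct (du_dv_global _ _ _ (C1_X k)) as [E1 E2].
  destruct (du_dv_global _ _ _ (C1_Xu k)) as [E3 E4].
  destruct (du_dv_global _ _ _ (C1_Xv k)) as [E5 E6].
  rewrite E1, E2, E3, E4, E5, E6.
  destruct (ex_derive_C1pt _ _ _ _ _ (C1_X k u v)).
  destruct (ex_derive_C1pt _ _ _ _ _ (C1_Xu k u v)).
  destruct (ex_derive_C1pt _ _ _ _ _ (C1_Xv k u v)).
  destruct (C1_Xu k u v) as [_ [? ?]]. destruct (C1_Xv k u v) as [_ [? ?]].
  repeat split; assumption.
Qed.

Lemma frame3_Xu u v : frame3 (cX u v) (fun k => cXu k u v) = ce3u u v.
Proof. unfold frame3; simpl. unfold cx3u. field. Qed.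

Lemma frame3_Xv u v : frame3 (cX u v) (fun k => cXv k u v) = ce3v u v.
Proof. unfold frame3; simpl. unfold cx3v. field. Qed.

Lemma cX_conformal u v :
  gdot (cX u v) (fun k => cXu k u v) (fun k => cXu k u v) = (g u ^ 2 + C ^ 2) * Ch u v ^ 2 /\
  gdot (cX u v) (fun k => cXv k u v) (fun k => cXv k u v) = (g u ^ 2 + C ^ 2) * Ch u v ^ 2 /\
  gdot (cX u v) (fun k => cXu k u v) (fun k => cXv k u v) = 0.
Proof.
  assert (E1 : sphi u ^ 2 = 1 - cphi u ^ 2) by apply sin_sq.
  assert (E2 : Ch u v ^ 2 = 1 + Sh u v ^ 2) by apply cosh_sinh_sq.
  rewrite !gdot_frame, frame3_Xu, frame3_Xv. simpl.
  unfold ce3u, ce3v, cx1u, cx1v. rewrite !Rmult_1_r.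
  replace (sphi u ^ 2) with (sphi u * sphi u) in E1 by ring. replace (Ch u v ^ 2) with (Ch u v * Ch u v) in E2 by ring.
  set (x := cphi u) in *. set (y := sphi u) in *. set (h := Ch u v) in *. set (z := Sh u v) in *.
  split; [|split].
  - transitivity (g u ^ 2 * (y * y + x ^ 2) * z ^ 2 + C ^ 2 * (y * y + x ^ 2) * (h * h) + g u ^ 2); [ring|].
    rewrite E1, E2. ring.
  - transitivity (g u ^ 2 * (y * y + x ^ 2) * (h * h) + C ^ 2 * (y * y + x ^ 2) * z ^ 2 + C ^ 2); [ring|].
    rewrite E1, E2. ring.
  - transitivity (C * g u * ((y * y + x ^ 2) * (h * h) - (y * y + x ^ 2) * z ^ 2 - 1)); [ring|].
    rewrite E1, E2. ring.
Qed.

(** In the orthonormal frame, two components of the cross product are (C^2 + g^2) cosh A times cos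
    phi and sin phi, which cannot vanish together. *)
Lemma cX_immersion u v : ~ (forall k, cross (fun k => cXu k u v) (fun k => cXv k u v) k = 0).
Proof.
  intros N. assert (N0 := N 0%nat). assert (period_sq := N 2%nat). simpl in N0, period_sq.
  assert (P : 0 < (C ^ 2 + g u ^ 2) * Ch u v).
  { apply Rmult_lt_0_compat; [assert (A := pow2_ge_0 (g u)); nra|].
    assert (A := cosh_ge1 (al * v + beta u)). unfold Ch. lra. }
  assert (Z2 : (C ^ 2 + g u ^ 2) * Ch u v * cphi u = 0) by (rewrite <- period_sq; unfold cx1u, cx1v; ring).
  assert (Z0 : (C ^ 2 + g u ^ 2) * Ch u v * sphi u = 0).
  { transitivity (cx2 u v * / 2 * ((C ^ 2 + g u ^ 2) * Ch u v * cphi u) -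
      (- g u * cx3v u v - cx3u u v * C) + 2 * (- g u * cx3v u v - cx3u u v * C) -
       cx2 u v * ((C ^ 2 + g u ^ 2) * Ch u v * cphi u)).
    - unfold cx3u, cx3v, ce3u, ce3v, cx1u, cx1v. field.
    - rewrite N0, Z2. ring. }
  apply Rmult_integral in Z2. apply Rmult_integral in Z0.
  destruct Z2 as [Z2|Z2]; [lra|]. destruct Z0 as [Z0|Z0]; [lra|].
  assert (E := sin_sq (phi u)). unfold cphi in Z2. unfold sphi in Z0. rewrite Z2, Z0 in E. lra.
Qed.

(** In the orthonormal frame the three components vanish by sin^2 + cos^2 = 1, by cosh^2 - sinh^2 =
    1, and identically. The last coordinate is then recovered from the third frame component. *)
Lemma cX_harmonic u v k : (k < 3)%nat ->
  covd (cX u v) (fun k => cXuu k u v) (fun k => cXu k u v) (fun k => cXu k u v) k +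
  covd (cX u v) (fun k => cXvv k u v) (fun k => cXv k u v) (fun k => cXv k u v) k = 0.
Proof.
  assert (E1 : sphi u ^ 2 = 1 - cphi u ^ 2) by apply sin_sq.
  assert (E2 : Ch u v ^ 2 = 1 + Sh u v ^ 2) by apply cosh_sinh_sq.
  destruct (covd_frame (cX u v) (fun k => cXuu k u v) (fun k => cXu k u v)) as [U0 [U1 U2]].
  destruct (covd_frame (cX u v) (fun k => cXvv k u v) (fun k => cXv k u v)) as [V0 [V1 V2]].
  rewrite frame3_Xu in U0, U1. rewrite frame3_Xv in V0, V1.
  assert (S0 : covd (cX u v) (fun k => cXuu k u v) (fun k => cXu k u v) (fun k => cXu k u v) 0 +
     covd (cX u v) (fun k => cXvv k u v) (fun k => cXv k u v) (fun k => cXv k u v) 0 = 0).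
  { rewrite U0, V0. simpl. unfold cx1uu, cx1vv, ce3u, ce3v, dphi, quad.
    transitivity (cphi u * (C ^ 2 + g u ^ 2) * Sh u v * (sphi u ^ 2 - (1 - cphi u ^ 2))); [ring|rewrite E1; ring]. }
  assert (S1 : covd (cX u v) (fun k => cXuu k u v) (fun k => cXu k u v) (fun k => cXu k u v) 1 +
     covd (cX u v) (fun k => cXvv k u v) (fun k => cXv k u v) (fun k => cXv k u v) 1 = 0).
  { rewrite U1, V1. simpl. unfold cx2uu, cx1u, cx1v, ce3u, ce3v, quad.
    transitivity (cphi u * sphi u * (C ^ 2 + g u ^ 2) * (Ch u v ^ 2 - (1 + Sh u v ^ 2))); [ring|rewrite E2; ring]. }
  intros Hk. destruct k as [|[|[|k]]]; auto; [|lia].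
  unfold frame3 in U2, V2. simpl in U2, V2.
  assert (U2' := Rplus_eq_compat_l (covd (cX u v) (fun k => cXvv k u v) (fun k => cXv k u v) (fun k => cXv k u v) 2
     + (cx2 u v * covd (cX u v) (fun k => cXvv k u v) (fun k => cXv k u v) (fun k => cXv k u v) 0
       - cx1 u v * covd (cX u v) (fun k => cXvv k u v) (fun k => cXv k u v) (fun k => cXv k u v) 1) / 2) _ _ U2).
  rewrite V2 in U2' at 2.
  assert (R0 : forall a b, a + b = 0 -> b = - a) by (intros; lra).
  apply R0 in S0. apply R0 in S1. rewrite S0, S1 in U2'.
  match goal with |- ?a + ?b = 0 => set (a' := a) in *; set (b' := b) in * end.
  assert (Z : cx3vv u v + (cx2 u v * cx1vv u v - cx1 u v * 0) / 2 +
    (cx3uu u v + (cx2 u v * cx1uu u v - cx1 u v * cx2uu u v) / 2) = 0).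
  { unfold cx3uu, cx3vv. field. }
  rewrite Z in U2'. lra.
Qed.

(** With E = G and F = 0 the vector [W] is E times the sum in [cX_harmonic], so it vanishes entirely
    and not only in the normal direction. *)
Lemma cX_minimal : minimal_immersion cX.
Proof.
  split; [exact C2_cX|]. intros u v. split.
  - unfold immersion_at. rewrite Yu_cX, Yv_cX. apply cX_immersion.
  - unfold mean_curv_zero_at. rewrite Yu_cX, Yv_cX, Yuu_cX, Yvv_cX.
    destruct (cX_conformal u v) as [E1 [E2 E3]]. rewrite E1, E2, E3.
    assert (K := cX_harmonic u v).
    assert (Z : forall k, (k < 3)%nat -> forall l m,
     l * covd (cX u v) (fun k => cXuu k u v) (fun k => cXu k u v) (fun k => cXu k u v) k
     - 2 * 0 * m + l * covd (cX u v) (fun k => cXvv k u v) (fun k => cXv k u v) (fun k => cXv k u v) k = 0).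
    { intros k Hk l m. assert (Kk := K k Hk).
      transitivity (l * (covd (cX u v) (fun k => cXuu k u v) (fun k => cXu k u v) (fun k => cXu k u v) k
       + covd (cX u v) (fun k => cXvv k u v) (fun k => cXv k u v) (fun k => cXv k u v) k)); [ring|].
      rewrite Kk. ring. }
    unfold det3. unfold sum3 at 1. rewrite !Z by lia. ring.
Qed.

(** * Sections by the planes x_2 = a *)

Hypothesis phi_decr : forall u, g u * cos (phi u) ^ 2 - al < 0.
Hypothesis phi_odd : forall u, phi (- u) = - phi u.
Hypothesis g_even : forall u, g (- u) = g u.
Hypothesis beta_odd : forall u, beta (- u) = - beta u.
Hypothesis G_odd : forall u, G (- u) = - G u.
Hypothesis phi_shift : forall u, phi (u + H) = phi u - PI.
Hypothesis g_shift : forall u, g (u + H) = g u.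
Hypothesis beta_shift : forall u, beta (u + H) = beta u + beta H.
Hypothesis period : forall u, al * G (u + H) + C * beta (u + H) = al * G u + C * beta u.

(** On the section x_2 = a one has v = (a + G u) / C; [hgt] is the resulting value of A, and [y1],
    [y2] are x_1 and x_3 + a x_1 / 2 as functions of u. *)
Definition hgt a u := al * ((a + G u) / C) + beta u.
Definition y1 a u := g u / al * cos (phi u) * sinh (hgt a u) - C / al * sin (phi u) * cosh (hgt a u).
Definition y2 a u := C / al * (g u / al - 1) * cos (phi u) * cosh (hgt a u)
  - / al * (C ^ 2 / al + g u) * sin (phi u) * sinh (hgt a u).
Definition speed a u := (g u ^ 2 + C ^ 2) / C * cosh (hgt a u).

Lemma speed_pos a u : 0 < speed a u.
Proof.
  unfold speed. assert (A := cosh_ge1 (hgt a u)). assert (B := pow2_ge_0 (g u)).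
  apply Rmult_lt_0_compat; [|lra]. apply Rdiv_lt_0_compat; nra.
Qed.

Lemma D_y1 a u : is_derive (y1 a) u (speed a u * cos (phi u)).
Proof.
  unfold y1, speed, hgt. dcat. unfold Rdiv. field. lra.
Qed.

Lemma D_y2 a u : is_derive (y2 a) u (- speed a u * sin (phi u)).
Proof.
  assert (E := sin_sq (phi u)).
  unfold y2, speed, hgt. dcat. unfold Rdiv. apply Rminus_diag_uniq.
  transitivity (- cos (phi u) * (C ^ 2 + g u ^ 2) * sinh (al * ((a + G u) * / C) + beta u) / al
      * (sin (phi u) ^ 2 - (1 - cos (phi u) ^ 2))); [field; lra|]. rewrite E. ring.
Qed.

(** C times [hgt] is al G + C beta up to a constant, so [period] is exactly what makes A periodic
    along every section at once. *)
Lemma hgt_shift a u : hgt a (u + H) = hgt a u.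
Proof.
  unfold hgt. apply Rmult_eq_reg_l with C; [|lra].
  transitivity (al * a + (al * G (u + H) + C * beta (u + H))); [field; lra|].
  rewrite period. field. lra.
Qed.

Lemma cos_shift u : cos (phi (u + H)) = - cos (phi u).
Proof. rewrite phi_shift, cos_minus, cos_PI, sin_PI. ring. Qed.

Lemma sin_shift u : sin (phi (u + H)) = - sin (phi u).
Proof. rewrite phi_shift, sin_minus, cos_PI, sin_PI. ring. Qed.

(** Half a period changes the signs of cos phi and sin phi and leaves g and A alone: each section is
    symmetric about the origin. *)
Lemma y_shift a u : y1 a (u + H) = - y1 a u /\ y2 a (u + H) = - y2 a u.
Proof. unfold y1, y2. rewrite hgt_shift, g_shift, cos_shift, sin_shift. split; ring. Qed.

Lemma y_period a u : y1 a (u + 2 * H) = y1 a u /\ y2 a (u + 2 * H) = y2 a u.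
Proof.
  replace (u + 2 * H) with ((u + H) + H) by ring.
  destruct (y_shift a (u + H)) as [-> ->]. destruct (y_shift a u) as [-> ->]. split; ring.
Qed.

Lemma cX_section u v : cX u v =
  (y1 (cx2 u v) u, cx2 u v, y2 (cx2 u v) u - cx2 u v * y1 (cx2 u v) u / 2).
Proof.
  assert (E : hgt (cx2 u v) u = al * v + beta u) by (unfold hgt, cx2; field; lra).
  unfold cX. f_equal; [f_equal|].
  - unfold cx1, y1. now rewrite E.
  - unfold cx3, cx1, y1, y2. rewrite E. field. lra.
Qed.

Lemma image_cX_iff a b d : image cX (a, b, d) <-> exists u, a = y1 b u /\ d = y2 b u - b * y1 b u / 2.
Proof.
  split.
  - intros [u [v E]]. rewrite cX_section in E. injection E as E1 E2 E3. exists u. subst. auto.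
  - intros [u [E1 E2]]. exists u, ((b + G u) / C). rewrite cX_section.
    replace (cx2 u ((b + G u) / C)) with b by (unfold cx2; field; lra). now subst.
Qed.

Lemma section_cX a y : section (image cX) a y <-> exists u, y = (y1 a u, y2 a u).
Proof.
  split.
  - intros [x1 [x3 [HS Ey]]]. apply image_cX_iff in HS. destruct HS as [u [E1 E2]].
    exists u. subst. f_equal. field.
  - intros [u Ey]. exists (y1 a u), (y2 a u - a * y1 a u / 2). split.
    + apply image_cX_iff. now exists u.
    + subst. f_equal. field.
Qed.

Lemma phi_strict u u' : u < u' -> phi u' < phi u.
Proof.
  intros L. apply Ropp_lt_cancel.
  apply (incr_MVT (fun u => - phi u) (fun u => - (g u * cos (phi u) ^ 2 - al))); auto.
  - intros x _. apply (@is_derive_opp _ R_NormedModule phi). apply Dphi.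
  - intros x _. assert (A := phi_decr x). lra.
Qed.

(* Signed distance, positive on the left, from [(z1, z2)] to the tangent line of the section curve at [u]. *)
Definition side a u z1 z2 := cos (phi u) * (z2 - y2 a u) + sin (phi u) * (z1 - y1 a u).

(** Along the curve the derivative of [side] is the speed times sin (phi u - phi x), positive on the
    first half period and negative on the second; [side] vanishes at both ends, so it is positive in
    between. *)
Lemma side_curve_pos a u u0 : u < u0 < u + 2 * H -> 0 < side a u (y1 a u0) (y2 a u0).
Proof.
  intros [L1 L2].
  assert (Dd : forall x, is_derive (fun x => side a u (y1 a x) (y2 a x)) x (speed a x * sin (phi u - phi x))).
  { intros x. unfold side.
    auto_derive.
    - split; [exact (ex_intro _ _ (D_y2 a _))|]. split; [exact (ex_intro _ _ (D_y1 a _))|exact I].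
    - rewrite (is_derive_unique (fun x => y1 a x) _ _ (D_y1 a _)), (is_derive_unique (fun x => y2 a x) _ _ (D_y2 a _)).
      rewrite sin_minus. ring. }
  assert (Z0 : side a u (y1 a u) (y2 a u) = 0) by (unfold side; ring).
  assert (Z2 : side a u (y1 a (u + 2 * H)) (y2 a (u + 2 * H)) = 0).
  { destruct (y_period a u) as [-> ->]. exact Z0. }
  assert (P := PI_RGT_0).
  destruct (Rle_or_lt u0 (u + H)) as [L|L].
  - rewrite <- Z0. apply (incr_MVT (fun x => side a u (y1 a x) (y2 a x)) (fun x => speed a x * sin (phi u - phi x))); auto.
    intros x Hx. apply Rmult_lt_0_compat; [apply speed_pos|].
    assert (A := phi_strict u x ltac:(lra)). assert (B := phi_strict x (u + H) ltac:(lra)).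
    rewrite phi_shift in B. apply sin_gt_0; lra.
  - apply Ropp_lt_cancel. rewrite Ropp_0. rewrite <- Ropp_0, <- Z2.
    apply (incr_MVT (fun x => - side a u (y1 a x) (y2 a x)) (fun x => - (speed a x * sin (phi u - phi x)))); auto.
    + intros x _. apply (@is_derive_opp _ R_NormedModule (fun x => side a u (y1 a x) (y2 a x))). apply Dd.
    + intros x Hx. rewrite <- Ropp_mult_distr_r_reverse. apply Rmult_lt_0_compat; [apply speed_pos|].
      assert (A := phi_strict (u + H) x ltac:(lra)). assert (B := phi_strict x (u + H + H) ltac:(lra)).
      rewrite !phi_shift in B. rewrite phi_shift in A.
      rewrite <- sin_neg.
      replace (- (phi u - phi x)) with (PI - ((phi u - phi x) - PI)  - 2 * PI) by ring.
      rewrite <- (sin_period _ 1). simpl.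
      replace (PI - (phi u - phi x - PI) - 2 * PI + 2 * 1 * PI) with (PI - (phi u - phi x - PI)) by ring.
      apply sin_gt_0; lra.
Qed.

Lemma floor_rep T u u0 : 0 < T -> exists n : Z, u <= u0 - IZR n * T < u + T.
Proof.
  intros HT. exists (Int_part ((u0 - u) / T)).
  destruct (base_Int_part ((u0 - u) / T)) as [A B].
  set (n := IZR (Int_part ((u0 - u) / T))) in *.
  assert (E : u0 - u = (u0 - u) / T * T) by (field; lra).
  assert (A' : n * T <= (u0 - u) / T * T) by (apply Rmult_le_compat_r; lra).
  assert (B' : ((u0 - u) / T - 1) * T < n * T) by (apply Rmult_lt_compat_r; lra).
  rewrite <- E in A'. rewrite Rmult_minus_distr_r, <- E in B'. lra.
Qed.

(** The case d = 0 is periodicity; a nonzero [d] is the drift of G over a period. *)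
Lemma additive_shift_Z (f : R -> R) T d : (forall u, f (u + T) = f u + d) ->
  forall n u, f (u + IZR n * T) = f u + IZR n * d.
Proof.
  intros E.
  assert (P : forall (n : nat) u, f (u + INR n * T) = f u + INR n * d).
  { induction n as [|n IH]; intros u.
    - simpl. rewrite !Rmult_0_l, !Rplus_0_r. reflexivity.
    - rewrite S_INR. replace (u + (INR n + 1) * T) with ((u + INR n * T) + T) by ring.
      rewrite E, IH. ring. }
  intros n u. destruct (Z.le_gt_cases 0 n) as [L|L].
  - rewrite <- (Z2Nat.id n) by lia. rewrite <- INR_IZR_INZ. apply P.
  - assert (En : IZR n = - INR (Z.to_nat (- n))).
    { rewrite INR_IZR_INZ, Z2Nat.id by lia. rewrite opp_IZR. ring. }
    rewrite En. assert (Q := P (Z.to_nat (- n)) (u + - INR (Z.to_nat (- n)) * T)).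
    replace (u + - INR (Z.to_nat (- n)) * T + INR (Z.to_nat (- n)) * T) with u in Q by ring.
    lra.
Qed.

Lemma y_period_Z a (n : Z) u : y1 a (u + IZR n * (2 * H)) = y1 a u /\ y2 a (u + IZR n * (2 * H)) = y2 a u.
Proof.
  split; [rewrite (additive_shift_Z (y1 a) (2 * H) 0)|rewrite (additive_shift_Z (y2 a) (2 * H) 0)];
    try ring; intros w; rewrite Rplus_0_r; apply y_period.
Qed.

Lemma side_curve_nonneg a u u0 : 0 <= side a u (y1 a u0) (y2 a u0).
Proof.
  destruct (floor_rep (2 * H) u u0) as [n Hn]; [lra|].
  destruct (y_period_Z a n (u0 - IZR n * (2 * H))) as [E1 E2].
  replace (u0 - IZR n * (2 * H) + IZR n * (2 * H)) with u0 in E1, E2 by ring.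
  rewrite E1, E2.
  destruct (Req_dec (u0 - IZR n * (2 * H)) u) as [E|N].
  - rewrite E. right. unfold side. ring.
  - apply Rlt_le, side_curve_pos. lra.
Qed.

(** A point of the curve lies on its own tangent, whereas by [side_curve_pos] the others within one
    period lie strictly to the left. *)
Lemma y_eq_period a u u' : y1 a u = y1 a u' -> y2 a u = y2 a u' -> exists n : Z, u' = u + IZR n * (2 * H).
Proof.
  intros E1 E2.
  destruct (floor_rep (2 * H) u u') as [n Hn]; [lra|].
  exists n. destruct (Req_dec (u' - IZR n * (2 * H)) u) as [E|N]; [lra|exfalso].
  assert (P := side_curve_pos a u (u' - IZR n * (2 * H)) ltac:(lra)).
  destruct (y_period_Z a n (u' - IZR n * (2 * H))) as [F1 F2].
  replace (u' - IZR n * (2 * H) + IZR n * (2 * H)) with u' in F1, F2 by ring.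
  rewrite <- F1, <- F2, <- E1, <- E2 in P. unfold side in P.
  replace (cos (phi u) * (y2 a u - y2 a u) + sin (phi u) * (y1 a u - y1 a u)) with 0 in P by ring. lra.
Qed.

Lemma section_closed_embedded a : closed_embedded_curve (section (image cX) a).
Proof.
  exists (2 * H), (y1 a), (y2 a). split; [lra|]. split; [intros u; apply y_period|].
  split; [|split].
  - intros u.
    assert (E1 : Derive (y1 a) = fun u => speed a u * cos (phi u)).
    { apply functional_extensionality; intros x. apply is_derive_unique, D_y1. }
    assert (E2 : Derive (y2 a) = fun u => - speed a u * sin (phi u)).
    { apply functional_extensionality; intros x. apply is_derive_unique, D_y2. }
    rewrite E1, E2.
    assert (CS : continuity_pt (speed a) u).
    { eapply is_derive_continuity_pt. unfold speed, hgt. apply (Derive_correct (fun u => (g u ^ 2 + C ^ 2) / C * cosh (al * ((a + G u) / C) + beta u))).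
      auto_derive. repeat match goal with |- _ /\ _ => split | |- True => exact I end;
       first [ exact (ex_intro _ _ (Dg _)) | exact (ex_intro _ _ (Dbeta _)) | exact (ex_intro _ _ (DG _)) ]. }
    split; [eexists; apply D_y1|]. split; [eexists; apply D_y2|].
    split; [|split].
    + apply continuity_pt_mult; auto. apply (continuity_pt_comp phi cos); [apply cont_phi|apply continuity_cos].
    + apply continuity_pt_mult; [now apply continuity_pt_opp|].
      apply (continuity_pt_comp phi sin); [apply cont_phi|apply continuity_sin].
    + intros E. injection E as F1 F2. assert (P := speed_pos a u).
      apply Rmult_integral in F1. apply Rmult_integral in F2.
      destruct F1 as [F1|F1]; [lra|]. destruct F2 as [F2|F2]; [lra|].
      assert (E := sin_sq (phi u)). rewrite F1, F2 in E. lra.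
  - assert (Q : forall u u', 0 <= u < 2 * H -> 0 <= u' < 2 * H -> u < u' -> y1 a u = y1 a u' -> y2 a u = y2 a u' -> False).
    { intros u u' Hu Hu' L E1 E2. assert (P := side_curve_pos a u u' ltac:(lra)).
      rewrite <- E1, <- E2 in P. unfold side in P. lra. }
    intros u u' Hu Hu' E1 E2. destruct (Rtotal_order u u') as [L|[L|L]]; auto; exfalso; eauto.
  - apply section_cX.
Qed.

Definition hull a (z : R * R) := forall u, 0 <= side a u (fst z) (snd z).

Lemma side_lip a u z z' : Rabs (side a u (fst z) (snd z) - side a u (fst z') (snd z')) <= 2 * dist2 z z'.
Proof.
  unfold side. destruct (dist2_coord z z') as [D1 D2].
  replace (cos (phi u) * (snd z - y2 a u) + sin (phi u) * (fst z - y1 a u) -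
    (cos (phi u) * (snd z' - y2 a u) + sin (phi u) * (fst z' - y1 a u)))
  with (cos (phi u) * (snd z - snd z') + sin (phi u) * (fst z - fst z')) by ring.
  eapply Rle_trans; [apply Rabs_triang|]. rewrite !Rabs_mult.
  assert (Cb := COS_bound (phi u)). assert (Sb := SIN_bound (phi u)).
  assert (C1 : Rabs (cos (phi u)) <= 1) by (apply Rabs_le; lra).
  assert (S1 : Rabs (sin (phi u)) <= 1) by (apply Rabs_le; lra).
  assert (P1 := Rabs_pos (snd z - snd z')). assert (P2 := Rabs_pos (fst z - fst z')). nra.
Qed.

Lemma D_side a u z1 z2 : is_derive (fun u => side a u z1 z2) u
  ((g u * cos (phi u) ^ 2 - al) * (cos (phi u) * (z1 - y1 a u) - sin (phi u) * (z2 - y2 a u))).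
Proof.
  unfold side. auto_derive.
  - repeat match goal with |- _ /\ _ => split | |- True => exact I end;
    first [ exact (ex_intro _ _ (Dphi _)) | exact (ex_intro _ _ (D_y1 a _)) | exact (ex_intro _ _ (D_y2 a _)) ].
  - rewrite (is_derive_unique (fun x => phi x) _ _ (Dphi _)), (is_derive_unique (fun x => y1 a x) _ _ (D_y1 a _)),
     (is_derive_unique (fun x => y2 a x) _ _ (D_y2 a _)). ring.
Qed.

Lemma side_period a z1 z2 u : side a (u + 2 * H) z1 z2 = side a u z1 z2.
Proof.
  unfold side. destruct (y_period a u) as [-> ->].
  replace (u + 2 * H) with ((u + H) + H) by ring. rewrite !cos_shift, !sin_shift. ring.
Qed.

(** By periodicity and compactness the signed distances to the tangents have a common lower bound
    [d]; the radius d / 2 absorbs the factor 2 of [side_lip]. *)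
Lemma hull_interior a z : (forall u, 0 < side a u (fst z) (snd z)) -> interior2 (hull a) z.
Proof.
  intros P.
  destruct (segment_pos_lower_bound (fun u => side a u (fst z) (snd z)) 0 (2 * H)) as [d [Hd Q]]; auto.
  { intros u. exact (is_derive_continuity_pt _ _ _ (D_side a u _ _)). }
  exists (d / 2). split; [lra|]. intros y Hy u.
  assert (Qu : d <= side a u (fst z) (snd z)).
  { destruct (floor_rep (2 * H) 0 u) as [n Hn]; [lra|].
    assert (E := additive_shift_Z (fun u => side a u (fst z) (snd z)) (2 * H) 0
       ltac:(intros w; cbv beta; rewrite side_period; ring) n (u - IZR n * (2 * H))). simpl in E.
    replace (u - IZR n * (2 * H) + IZR n * (2 * H)) with u in E by ring.
    rewrite E, Rmult_0_r, Rplus_0_r. apply Q. lra. }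
  assert (L := side_lip a u y z). apply Rabs_le_between in L. lra.
Qed.

Lemma hull_convex a : convex2 (hull a).
Proof.
  intros x y l Hx Hy Hl u. specialize (Hx u). specialize (Hy u). simpl.
  replace (side a u _ _) with (l * side a u (fst x) (snd x) + (1 - l) * side a u (fst y) (snd y))
    by (unfold side; ring).
  assert (0 <= l * side a u (fst x) (snd x)) by (apply Rmult_le_pos; lra).
  assert (0 <= (1 - l) * side a u (fst y) (snd y)) by (apply Rmult_le_pos; lra). lra.
Qed.

Lemma phi_0 : phi 0 = 0.
Proof. assert (E := phi_odd 0). rewrite Ropp_0 in E. lra. Qed.

Lemma hull_bounded a : bounded2 (hull a).
Proof.
  assert (PP := PI_RGT_0).
  assert (EH : phi H = - PI).
  { assert (E := phi_shift 0). rewrite phi_0, Rplus_0_l in E. lra. }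
  (* phi takes the values 0, - PI / 2, - PI, - 3 PI / 2 at 0, [w], [H], [w + H]: two horizontal and
     two vertical tangents enclose the hull in a box. *)
  destruct (IVT_gen phi 0 H (- (PI / 2))) as [w [Hw Ew]].
  { intros x. apply cont_phi. }
  { rewrite phi_0, EH. rewrite Rmin_right, Rmax_left by lra. lra. }
  exists ((Rabs (y1 a w) + Rabs (y1 a (w + H))) + (Rabs (y2 a 0) + Rabs (y2 a H))).
  intros z Hz.
  assert (Z1 := Hz 0). assert (Z2 := Hz H). assert (Z3 := Hz w). assert (Z4 := Hz (w + H)).
  unfold side in Z1, Z2, Z3, Z4. rewrite cos_shift, sin_shift, Ew in Z4. rewrite Ew in Z3. rewrite EH in Z2. rewrite phi_0 in Z1.
  rewrite cos_neg, sin_neg, cos_PI2, sin_PI2 in Z3, Z4. rewrite cos_neg, sin_neg, cos_PI, sin_PI in Z2.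
  rewrite cos_0, sin_0 in Z1.
  eapply Rle_trans; [apply dist2_le_abs|]. simpl. rewrite !Rminus_0_r.
  apply Rplus_le_compat; apply Rabs_le; unfold Rabs; repeat destruct Rcase_abs; lra.
Qed.

Lemma hull_boundary a y : boundary2 (hull a) y <-> section (image cX) a y.
Proof.
  rewrite section_cX. split.
  - intros HB.
    assert (HK : hull a y).
    { intros u. apply Rnot_lt_le. intros N.
      destruct (HB (- side a u (fst y) (snd y) / 2)) as [[z [Dz Kz]] _]; [lra|].
      specialize (Kz u). assert (L := side_lip a u z y). apply Rabs_le_between in L. lra. }
    destruct (classic (exists u, side a u (fst y) (snd y) = 0)) as [[u Eu]|N].
    + exists u.
      (* For a hull point on the tangent at [u], [side] is minimal at [u], so its derivative
         vanishes; as phi' is nonzero, the tangential offset vanishes along with the normal one, and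
         the point is the curve point. *)
      assert (Z : (g u * cos (phi u) ^ 2 - al) * (cos (phi u) * (fst y - y1 a u) - sin (phi u) * (snd y - y2 a u)) = 0).
      { assert (Dd := proj1 (is_derive_Reals _ _ _) (D_side a u (fst y) (snd y))).
        set (pr := exist _ _ Dd : derivable_pt (fun u => side a u (fst y) (snd y)) u).
        rewrite <- (derive_pt_eq_0 _ _ _ pr Dd).
        apply (deriv_minimum _ (u - 1) (u + 1)); try lra.
        intros x _ _. rewrite Eu. apply HK. }
      apply Rmult_integral in Z. assert (A := phi_decr u).
      destruct Z as [Z|Z]; [lra|]. unfold side in Eu.
      assert (E := sin_sq (phi u)).
      set (x := cos (phi u)) in *. set (w := sin (phi u)) in *.
      assert (F1 : fst y - y1 a u = 0).
      { transitivity ((w ^ 2 + x ^ 2) * (fst y - y1 a u)); [rewrite E; ring|].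
        transitivity (x * (x * (fst y - y1 a u) - w * (snd y - y2 a u)) + w * (x * (snd y - y2 a u) + w * (fst y - y1 a u))); [ring|].
        rewrite Z, Eu. ring. }
      assert (F2 : snd y - y2 a u = 0).
      { transitivity ((w ^ 2 + x ^ 2) * (snd y - y2 a u)); [rewrite E; ring|].
        transitivity (- w * (x * (fst y - y1 a u) - w * (snd y - y2 a u)) + x * (x * (snd y - y2 a u) + w * (fst y - y1 a u))); [ring|].
        rewrite Z, Eu. ring. }
      destruct y as [z1 z2]. simpl in *. f_equal; lra.
    + exfalso. destruct (hull_interior a y) as [r [Hr Hi]].
      { intros u. destruct (HK u) as [L|L]; auto. exfalso. apply N. now exists u. }
      destruct (HB r Hr) as [_ [z [Dz Kz]]]. apply Kz, Hi, Dz.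
  - intros [u ->] r Hr. split.
    + exists (y1 a u, y2 a u). split; [rewrite dist2_refl; lra|]. intros w. apply side_curve_nonneg.
    (* A step of length r / 4 along the right normal makes [side] negative at [u]. *)
    + exists (y1 a u + - (r / 4) * sin (phi u), y2 a u + - (r / 4) * cos (phi u)). split.
      * eapply Rle_lt_trans; [apply dist2_le_abs|]. simpl.
        replace (y1 a u + - (r / 4) * sin (phi u) - y1 a u) with (- (r / 4) * sin (phi u)) by ring.
        replace (y2 a u + - (r / 4) * cos (phi u) - y2 a u) with (- (r / 4) * cos (phi u)) by ring.
        rewrite !Rabs_mult, Rabs_Ropp, (Rabs_right (r / 4)) by lra.
        assert (Cb := COS_bound (phi u)). assert (Sb := SIN_bound (phi u)).
        assert (Rabs (cos (phi u)) <= 1) by (apply Rabs_le; lra).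
        assert (Rabs (sin (phi u)) <= 1) by (apply Rabs_le; lra). nra.
      * intros K. specialize (K u). unfold side in K; simpl in K.
        replace (cos (phi u) * (y2 a u + - (r / 4) * cos (phi u) - y2 a u) +
          sin (phi u) * (y1 a u + - (r / 4) * sin (phi u) - y1 a u))
        with (- (r / 4) * (sin (phi u) ^ 2 + cos (phi u) ^ 2)) in K by ring.
        rewrite sin_sq in K. lra.
Qed.

(** The origin is the midpoint of the curve points at u and u + H; [side] vanishes at the first and
    is positive at the second. *)
Lemma hull_interior_0 a : interior2 (hull a) (0, 0).
Proof.
  apply hull_interior. intros u. simpl.
  assert (P := side_curve_pos a u (u + H) ltac:(lra)).
  destruct (y_shift a u) as [E1 E2]. rewrite E1, E2 in P. unfold side in *. lra.
Qed.

Lemma section_enclosed a : enclosed_by_convex_curve (section (image cX) a) (0, 0).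
Proof.
  exists (hull a). split; [apply hull_convex|]. split; [apply hull_bounded|].
  split; [apply hull_boundary|apply hull_interior_0].
Qed.

Lemma section_convex a : convex_curve (section (image cX) a).
Proof.
  exists (hull a). split; [apply hull_convex|]. split; [apply hull_bounded|].
  split; [exists (0, 0); apply hull_interior_0|apply hull_boundary].
Qed.

(** This symmetry is (u, v) -> (- u, - v); [rot2] is u -> u + H inside each section, and [rot1] is
    their composite. *)
Lemma image_rot3 p : image cX p -> image cX (rot3 p).
Proof.
  intros [u [v <-]]. exists (- u), (- v).
  assert (E : al * - v + beta (- u) = - (al * v + beta u)) by (rewrite beta_odd; ring).
  unfold cX, rot3, cx3, cx1, cx2. rewrite E, sinh_odd, cosh_even, g_even, G_odd, phi_odd, cos_neg, sin_neg.
  f_equal; [f_equal|]; field; lra.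
Qed.

Lemma image_rot2 p : image cX p -> image cX (rot2 p).
Proof.
  destruct p as [[x1 x2] x3]. rewrite image_cX_iff. intros [u [E1 E2]]. apply image_cX_iff.
  exists (u + H). destruct (y_shift x2 u) as [-> ->]. subst. split; field.
Qed.

Lemma image_rot1 p : image cX p -> image cX (rot1 p).
Proof.
  intros Hp. replace (rot1 p) with (rot2 (rot3 p)); [now apply image_rot2, image_rot3|].
  destruct p as [[a b] d]. simpl. now rewrite Ropp_involutive.
Qed.

(** * The period, embeddedness and closedness *)

Let T := 2 * H.
Let b := 2 * beta H / al.

Lemma cX_shift_Z (n : Z) u v : cX (u + IZR n * T) (v - IZR n * b) = cX u v.
Proof.
  (* Two uses of [period]: over T = 2 H the function G changes by - 2 C beta(H) / al = - C b, which
     compensates the change of C v in x_2. *)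
  assert (EG : G (u + IZR n * T) = G u + IZR n * (- (C * b))).
  { apply additive_shift_Z. intros w. unfold T, b.
    assert (P1 := period w). assert (P2 := period (w + H)).
    rewrite (beta_shift (w + H)) in P2. rewrite beta_shift in P1.
    apply Rmult_eq_reg_l with al; [|lra].
    replace (w + 2 * H) with (w + H + H) by ring.
    transitivity (al * G w - 2 * C * beta H); [lra|field; lra]. }
  assert (E2 : cx2 (u + IZR n * T) (v - IZR n * b) = cx2 u v) by (unfold cx2; rewrite EG; ring).
  rewrite !cX_section, E2. unfold T.
  destruct (y_period_Z (cx2 u v) n u) as [-> ->]. reflexivity.
Qed.

(** Equal x_2 puts both points on one section, where u is determined modulo the period; then x_2
    determines v, as C is nonzero. *)
Lemma cX_eq u v u' v' : cX u v = cX u' v' -> exists n : Z, u' = u + IZR n * T /\ v' = v - IZR n * b.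
Proof.
  intros E. assert (E0 := E). rewrite !cX_section in E. injection E as E1 E2 E3.
  rewrite <- E2 in E1, E3. rewrite <- E1 in E3.
  destruct (y_eq_period (cx2 u v) u u' E1) as [n Hn]; [lra|].
  exists n. fold T in Hn. split; auto.
  assert (E4 := cX_shift_Z n u v). rewrite <- Hn in E4. rewrite E0 in E4.
  unfold cX in E4. injection E4 as _ E5 _. unfold cx2 in E5. apply Rmult_eq_reg_l with C; lra.
Qed.

(** The upper bound is the inverse of a positive lower bound for 1 / (1 + G^2), which
    [segment_pos_lower_bound] provides. *)
Lemma G_bounded a a' : exists M, forall u, a <= u <= a' -> Rabs (G u) <= M.
Proof.
  assert (P : forall u, 0 < 1 + G u ^ 2) by (intros u; assert (A := pow2_ge_0 (G u)); lra).
  destruct (segment_pos_lower_bound (fun u => / (1 + G u ^ 2)) a a') as [d [Hd Q]].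
  - intros u. apply continuity_pt_inv; [|assert (A := P u); lra].
    apply continuity_pt_plus; [apply continuity_pt_const; intros ? ?; reflexivity|].
    apply (continuity_pt_comp G (fun x => x ^ 2)); [exact (is_derive_continuity_pt _ _ _ (DG u))|].
    apply derivable_continuous_pt, derivable_pt_pow.
  - intros u. apply Rinv_0_lt_compat, P.
  - exists (/ d). intros u Hu. specialize (Q u Hu).
    apply Rle_trans with (1 + G u ^ 2).
    + unfold Rabs; destruct Rcase_abs; nra.
    + rewrite <- (Rinv_inv (1 + G u ^ 2)). apply Rinv_le_contravar; auto.
Qed.

Lemma cX_representative u0 u' v' : exists u v, cX u v = cX u' v' /\ u0 <= u < u0 + T.
Proof.
  destruct (floor_rep T u0 u') as [n Hn]; [unfold T; lra|].
  exists (u' - IZR n * T), (v' + IZR n * b). split; auto.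
  rewrite <- (cX_shift_Z n). f_equal; ring.
Qed.

(** The window [u - H, u + H] contains a parameter of every surface point, and meets the fibre of
    [cX u v] only at (u, v). For points within distance 1, x_2 differs by at most 1, so |C (y - v)|
    <= 1 + 2 M: this is the origin of [V]. *)
Lemma cX_inverse_continuous u v d : 0 < d -> exists eta, 0 < eta /\ forall u' v',
  dist3 (cX u' v') (cX u v) < eta ->
  exists u'' v'', cX u'' v'' = cX u' v' /\ dist2 (u'', v'') (u, v) < d.
Proof.
  intros Hd.
  destruct (G_bounded (u - H) (u + H)) as [M HM].
  set (V := (1 + 2 * M) / C).
  destruct (inverse_continuous_on_compact cX (fun _ _ => 0) (cX u v) (u - H) (u + H) (v - V) (v + V) u v)
    with (eps := d) as [eta [He Q]]; auto.
  - intros x y _ _. split; [intros k; exact (C1pt_cont _ _ _ _ _ (C1_X k x y))|apply continuity_2d_pt_const].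
  - intros x y Hx _ _ E. destruct (cX_eq _ _ _ _ E) as [n [E1 E2]].
    assert (n0 : n = 0%Z).
    { apply one_IZR_lt1. unfold T in E1. split; nra. }
    subst n. lra.
  - exists (Rmin eta 1). split; [apply Rmin_pos; lra|]. intros u' v' Hdist.
    assert (M1 := Rmin_l eta 1). assert (M2 := Rmin_r eta 1).
    destruct (cX_representative (u - H) u' v') as [x [y [E Hx]]]. unfold T in Hx.
    exists x, y. split; auto. rewrite <- E in Hdist.
    apply Q; try lra.
    assert (L := dist3_coord (cX x y) (cX u v) 1). simpl in L. unfold cx2 in L.
    assert (Gx := HM x ltac:(lra)). assert (Gu := HM u ltac:(lra)).
    assert (L1 : Rabs (C * y - G x - (C * v - G u)) <= 1) by lra.
    apply Rabs_le_between in L1. apply Rabs_le_between in Gx. apply Rabs_le_between in Gu.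
    assert (EV : C * V = 1 + 2 * M) by (unfold V; field; lra).
    split; apply Rmult_le_reg_l with C; lra.
Qed.

Lemma cX_embedded : embedded_surface (image cX).
Proof.
  apply (embedded_of_immersion cX cXu cXv).
  - apply C1_X.
  - apply cX_immersion.
  - apply cX_inverse_continuous.
  (* Two parameters within [H] of u differ by less than the period 2 H. *)
  - intros u v. exists H. split; auto. intros x y x' y' D1 D2 E.
    destruct (cX_eq _ _ _ _ E) as [n [E1 E2]].
    destruct (dist2_coord (x, y) (u, v)) as [A1 _]. destruct (dist2_coord (x', y') (u, v)) as [A2 _].
    simpl in A1, A2. apply Rabs_le_between in A1. apply Rabs_le_between in A2.
    assert (n0 : n = 0%Z).
    { apply one_IZR_lt1. unfold T in E1. split; nra. }
    subst n. lra.
Qed.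

(** Reducing u modulo the period and bounding v through x_2 confines the surface points near [p] to
    one rectangle, on which the distance to a point off the surface has a positive lower bound. *)
Lemma cX_closed : closed3 (image cX).
Proof.
  intros [[p0 p1] p2] Hp. apply NNPP. intros N.
  destruct (G_bounded 0 T) as [M HM].
  set (V := (1 + Rabs (p1) + M) / C).
  destruct (rectangle_pos_lower_bound (fun u v => dist3 (cX u v) (p0, p1, p2)) 0 T (- V) V) as [d [Hd Q]].
  - intros u v _ _. apply continuity_2d_pt_dist3. intros k. exact (C1pt_cont _ _ _ _ _ (C1_X k u v)).
  - intros u v _ _. destruct (dist3_nonneg (cX u v) (p0, p1, p2)) as [L|L]; auto.
    exfalso. apply N. exists u, v. now apply dist3_eq0.
  - destruct (Hp (Rmin d 1)) as [q' [[u' [v' Eq]] Hq]]; [apply Rmin_pos; lra|].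
    assert (M1 := Rmin_l d 1). assert (M2 := Rmin_r d 1).
    destruct (cX_representative 0 u' v') as [x [y [E Hx]]]. rewrite Rplus_0_l in Hx.
    rewrite <- Eq, <- E, dist3_sym in Hq.
    assert (L := dist3_coord (cX x y) (p0, p1, p2) 1). simpl in L. unfold cx2 in L.
    assert (Gx := HM x ltac:(lra)).
    assert (L1 : Rabs (C * y - G x - p1) <= 1) by lra.
    apply Rabs_le_between in L1. apply Rabs_le_between in Gx.
    assert (Pp := Rle_abs (p1)). assert (Pm := Rle_abs (- p1)). rewrite Rabs_Ropp in Pm.
    assert (EV : C * V = 1 + Rabs (p1) + M) by (unfold V; field; lra).
    assert (Hy : - V <= y <= V) by (split; apply Rmult_le_reg_l with C; lra).
    assert (B := Q x y ltac:(lra) Hy). lra.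
Qed.

(** * Covering of the punctured plane *)

Let period_sq := T ^ 2 + b ^ 2.

Lemma period_sq_pos : 0 < period_sq.
Proof. unfold period_sq, T. assert (A := pow2_ge_0 b). nra. Qed.

(* Real form of [z |-> exp (2 i pi z / (T - i b))], the universal covering of the punctured
   plane whose deck transformation is the period of [cX]. *)
Definition cov_arg u v := 2 * PI * (T * u - b * v) / period_sq.
Definition cov_log u v := - (2 * PI * (b * u + T * v)) / period_sq.
Definition cov1 u v := exp (cov_log u v) * cos (cov_arg u v).
Definition cov2 u v := exp (cov_log u v) * sin (cov_arg u v).
(** inv_u + i inv_v = (T - i b) (r + i a) / (2 i pi), the inverse of the linear map in the exponent
    of the covering. *)
Definition inv_u r a := (T * a - b * r) / (2 * PI).
Definition inv_v r a := - (T * r + b * a) / (2 * PI).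

Lemma cov_inv r a : cov_log (inv_u r a) (inv_v r a) = r /\ cov_arg (inv_u r a) (inv_v r a) = a.
Proof.
  assert (A := period_sq_pos). assert (P := PI_RGT_0). unfold cov_log, cov_arg, inv_u, inv_v, period_sq in *.
  split; field; lra.
Qed.

Lemma inv_cov u v : inv_u (cov_log u v) (cov_arg u v) = u /\ inv_v (cov_log u v) (cov_arg u v) = v.
Proof.
  assert (A := period_sq_pos). assert (P := PI_RGT_0). unfold cov_log, cov_arg, inv_u, inv_v, period_sq in *.
  split; field; lra.
Qed.

(** Together with [cX_eq_cov], this makes the fibres of the covering and of [cX] coincide. *)
Lemma cov_eq u v u' v' : cov1 u v = cov1 u' v' -> cov2 u v = cov2 u' v' -> cX u v = cX u' v'.
Proof.
  unfold cov1, cov2. intros E1 E2.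
  assert (P := PI_RGT_0).
  set (r := cov_log u v) in *. set (a := cov_arg u v) in *.
  set (r' := cov_log u' v') in *. set (a' := cov_arg u' v') in *.
  assert (Er : r = r').
  { apply exp_inv. assert (X := exp_pos r). assert (X' := exp_pos r').
    assert (Sq : exp r ^ 2 = exp r' ^ 2).
    { transitivity ((exp r * cos a) ^ 2 + (exp r * sin a) ^ 2).
      - replace ((exp r * cos a) ^ 2 + (exp r * sin a) ^ 2) with (exp r ^ 2 * (sin a ^ 2 + cos a ^ 2)) by ring.
        rewrite sin_sq. ring.
      - rewrite E1, E2.
        replace ((exp r' * cos a') ^ 2 + (exp r' * sin a') ^ 2) with (exp r' ^ 2 * (sin a' ^ 2 + cos a' ^ 2)) by ring.
        rewrite sin_sq. ring. }
    nra. }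
  rewrite <- Er in E1, E2. assert (X := exp_pos r).
  apply Rmult_eq_reg_l in E1; [|lra]. apply Rmult_eq_reg_l in E2; [|lra].
  (* Equal sines and cosines give cos (a' - a) = 1, hence a zero of the sine at the half angle, and
     this form yields the integer [n]. *)
  assert (Hs : sin ((a' - a) / 2) = 0).
  { assert (K := cos_2a_sin ((a' - a) / 2)). replace (2 * ((a' - a) / 2)) with (a' - a) in K by field.
    rewrite cos_minus, <- E1, <- E2 in K.
    assert (K2 := sin_sq a). apply Rsqr_0_uniq. unfold Rsqr. lra. }
  destruct (sin_eq_0_0 _ Hs) as [n Hn].
  assert (Ea : a' = a + IZR n * (2 * PI)) by lra.
  destruct (inv_cov u v) as [U1 V1]. destruct (inv_cov u' v') as [U2 V2].
  fold r a in U1, V1. fold r' a' in U2, V2.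
  rewrite <- U2, <- V2, <- Er, Ea.
  rewrite <- (cX_shift_Z n u v). rewrite <- U1, <- V1. unfold inv_u, inv_v. f_equal; field; lra.
Qed.

Lemma cX_eq_cov u v u' v' : cX u v = cX u' v' -> cov1 u v = cov1 u' v' /\ cov2 u v = cov2 u' v'.
Proof.
  intros E. destruct (cX_eq _ _ _ _ E) as [n [-> ->]].
  assert (A := period_sq_pos).
  assert (El : cov_log (u + IZR n * T) (v - IZR n * b) = cov_log u v) by (unfold cov_log, period_sq in *; field; lra).
  assert (Ea : cov_arg (u + IZR n * T) (v - IZR n * b) = cov_arg u v + IZR n * (2 * PI)).
  { unfold cov_arg, period_sq in *; field; lra. }
  unfold cov1, cov2. rewrite El, Ea.
  rewrite (additive_shift_Z cos (2 * PI) 0), (additive_shift_Z sin (2 * PI) 0).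
  - rewrite !Rmult_0_r, !Rplus_0_r. auto.
  - intros w. rewrite sin_plus, sin_2PI, cos_2PI. ring.
  - intros w. rewrite cos_plus, sin_2PI, cos_2PI. ring.
Qed.

Lemma cov_neq0 u v : (cov1 u v, cov2 u v) <> (0, 0).
Proof.
  unfold cov1, cov2. intros E. injection E as E1 E2. assert (X := exp_pos (cov_log u v)).
  apply Rmult_integral in E1. apply Rmult_integral in E2.
  destruct E1 as [E1|E1]; [lra|]. destruct E2 as [E2|E2]; [lra|].
  assert (K := sin_sq (cov_arg u v)). rewrite E1, E2 in K. lra.
Qed.

Lemma cov_surj s t : (s, t) <> (0, 0) -> exists u v, cov1 u v = s /\ cov2 u v = t.
Proof.
  intros N. destruct (polar_coordinates s t N) as [r [a [E1 E2]]].
  exists (inv_u r a), (inv_v r a). unfold cov1, cov2. destruct (cov_inv r a) as [-> ->]. auto.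
Qed.

(** Locally [Psi] is [cX] composed with a branch of the inverse of the covering. That branch is
    holomorphic with derivative x + i y, so its differential has Cauchy-Riemann form. *)
Lemma conformal_parametrization (Psi : R -> R -> pt) u0 v0 :
  (forall u v, Psi (cov1 u v) (cov2 u v) = cX u v) ->
  let s0 := cov1 u0 v0 in let t0 := cov2 u0 v0 in
  exists x y : R, x ^ 2 + y ^ 2 <> 0 /\ forall k,
    C1pt (comp Psi k) (du (comp Psi k)) (dv (comp Psi k)) s0 t0 /\
    du (comp Psi k) s0 t0 = x * cXu k u0 v0 + y * cXv k u0 v0 /\
    dv (comp Psi k) s0 t0 = - y * cXu k u0 v0 + x * cXv k u0 v0.
Proof.
  intros HPsi s0 t0.
  assert (P := PI_RGT_0). assert (A := period_sq_pos).
  assert (Hb : 0 < nrm2 s0 t0).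
  { destruct (Req_dec (nrm2 s0 t0) 0) as [Z|Z].
    - destruct (nrm2_eq0 _ _ Z) as [Z1 Z2]. exfalso. apply (cov_neq0 u0 v0). fold s0 t0. now rewrite Z1, Z2.
    - assert (B := nrm2_nonneg s0 t0). lra. }
  destruct (local_polar_coordinates (cov_log u0 v0) (cov_arg u0 v0)) as (r & a & Er & Ea & HL).
  fold (cov1 u0 v0) (cov2 u0 v0) in Er, Ea, HL. fold s0 t0 in Er, Ea, HL.
  set (m := nrm2 s0 t0) in *.
  (* Real and imaginary parts of (T - i b) / (2 i pi (s0 + i t0)). *)
  exists ((T * (- t0 / m) - b * (s0 / m)) / (2 * PI)), (- (T * (s0 / m) + b * (- t0 / m)) / (2 * PI)).
  split.
  { replace (((T * (- t0 / m) - b * (s0 / m)) / (2 * PI)) ^ 2 + (- (T * (s0 / m) + b * (- t0 / m)) / (2 * PI)) ^ 2)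
      with (period_sq * nrm2 s0 t0 / (4 * PI ^ 2 * m ^ 2)) by (unfold period_sq, nrm2; field; lra).
    apply Rgt_not_eq, Rdiv_lt_0_compat; [now apply Rmult_lt_0_compat|].
    apply Rmult_lt_0_compat; nra. }
  intros k.
  set (ft := fun s t => comp cX k (inv_u (r s t) (a s t)) (inv_v (r s t) (a s t))).
  set (Uu := fun s t => cXu k (inv_u (r s t) (a s t)) (inv_v (r s t) (a s t))).
  set (Uv := fun s t => cXv k (inv_u (r s t) (a s t)) (inv_v (r s t) (a s t))).
  destruct (C1pt_congr_loc ft
    (fun s t => Uu s t * (- b / (2 * PI) * (s / nrm2 s t) + T / (2 * PI) * (- t / nrm2 s t))
      + Uv s t * (- T / (2 * PI) * (s / nrm2 s t) + - b / (2 * PI) * (- t / nrm2 s t)))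
    (fun s t => Uu s t * (- b / (2 * PI) * (t / nrm2 s t) + T / (2 * PI) * (s / nrm2 s t))
      + Uv s t * (- T / (2 * PI) * (t / nrm2 s t) + - b / (2 * PI) * (s / nrm2 s t)))
    (comp Psi k) s0 t0) as [R1 [R2 R3]].
  - revert HL. apply locally_2d_impl, locally_2d_forall. intros s t (L1 & L2 & L3 & L4). split.
    + unfold ft, Defs.comp. f_equal. rewrite <- HPsi. unfold cov1, cov2.
      destruct (cov_inv (r s t) (a s t)) as [-> ->]. now rewrite L1, L2.
    + assert (Lin : forall p q s t, C1pt (fun r a => p * r + q * a) (fun _ _ => p) (fun _ _ => q) s t).
      { intros p' q' s' t'. eapply C1pt_ext; [| | | exact (C1pt_plus _ _ _ _ _ _ _ _
          (C1pt_mult _ _ _ _ _ _ _ _ (C1pt_const p' s' t') (C1pt_fst s' t'))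
          (C1pt_mult _ _ _ _ _ _ _ _ (C1pt_const q' s' t') (C1pt_snd s' t')))]; intros; simpl; ring. }
      assert (Iu : forall x y, C1pt inv_u (fun _ _ => - b / (2 * PI)) (fun _ _ => T / (2 * PI)) x y).
      { intros x y. eapply C1pt_ext; [| | | exact (Lin (- b / (2 * PI)) (T / (2 * PI)) x y)]; intros; auto.
        unfold inv_u. field. lra. }
      assert (Iv : forall x y, C1pt inv_v (fun _ _ => - T / (2 * PI)) (fun _ _ => - b / (2 * PI)) x y).
      { intros x y. eapply C1pt_ext; [| | | exact (Lin (- T / (2 * PI)) (- b / (2 * PI)) x y)]; intros; auto.
        unfold inv_v. field. lra. }
      exact (C1pt_comp _ _ _ _ _ _ _ _ _ s t (C1_X k _ _)
        (C1pt_comp _ _ _ _ _ _ _ _ _ s t (Iu _ _) L3 L4)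
        (C1pt_comp _ _ _ _ _ _ _ _ _ s t (Iv _ _) L3 L4)).
  - split; [exact R1|]. rewrite R2, R3. unfold Uu, Uv. rewrite Er, Ea.
    destruct (inv_cov u0 v0) as [-> ->]. fold m. split; field; lra.
Qed.

Lemma gdot_lin p (a1 a2 : nat -> R) x y z w :
  gdot p (fun k => x * a1 k + y * a2 k) (fun k => z * a1 k + w * a2 k) =
  x * z * gdot p a1 a1 + (x * w + y * z) * gdot p a1 a2 + y * w * gdot p a2 a2.
Proof. rewrite !gdot_frame. unfold frame3. field. Qed.

Lemma cX_conformal_to_punctured_plane : conformal_to_punctured_plane (image cX).
Proof.
  destruct (functional_choice (fun (z w : R * R) => z <> (0, 0) ->
    cov1 (fst w) (snd w) = fst z /\ cov2 (fst w) (snd w) = snd z)) as [w Hw].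
  { intros [s t]. destruct (classic ((s, t) = (0, 0))) as [E|N].
    - exists (0, 0). tauto.
    - destruct (cov_surj s t N) as [u [v E]]. exists (u, v). auto. }
  (* [w] picks some parameter over each point; by [cov_eq] the value of [Psi] off the origin does
     not depend on the choice. *)
  set (Psi := fun s t => cX (fst (w (s, t))) (snd (w (s, t)))).
  assert (HPsi : forall u v, Psi (cov1 u v) (cov2 u v) = cX u v).
  { intros u v. unfold Psi. destruct (Hw _ (cov_neq0 u v)) as [E1 E2]. now apply cov_eq. }
  assert (HD : forall s t, (s, t) <> (0, 0) -> exists u v, cov1 u v = s /\ cov2 u v = t /\ Psi s t = cX u v).
  { intros s t N. destruct (cov_surj s t N) as [u [v [E1 E2]]]. exists u, v. repeat split; auto.
    now rewrite <- E1, <- E2. }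
  exists Psi. intros D.
  split; [|split; [|split; [split; [|split; [|split; [|split]]]|]]].
  - intros s t N k. destruct (HD s t N) as [u [v [E1 [E2 E3]]]].
    destruct (conformal_parametrization Psi u v HPsi) as [x [y [_ Q]]]. destruct (Q k) as [Q1 _].
    rewrite E1, E2 in Q1.
    destruct (ex_derive_C1pt _ _ _ _ _ Q1). destruct Q1 as [_ [? ?]]. auto.
  - intros s t N I. destruct (HD s t N) as [u [v [E1 [E2 E3]]]].
    destruct (conformal_parametrization Psi u v HPsi) as [x [y [Nz Q]]]. rewrite E1, E2 in Q.
    apply (cX_immersion u v). intros k. specialize (I k).
    replace (Yu Psi s t) with (fun k => x * cXu k u v + y * cXv k u v) in I
      by (apply functional_extensionality; intros j; unfold Yu; symmetry; apply Q).
    replace (Yv Psi s t) with (fun k => - y * cXu k u v + x * cXv k u v) in I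
      by (apply functional_extensionality; intros j; unfold Yv; symmetry; apply Q).
    rewrite (cross_lin (fun k => cXu k u v) (fun k => cXv k u v)) in I. apply Rmult_integral in I. destruct I as [I|I]; auto.
    exfalso. apply Nz. lra.
  - intros s t N. destruct (HD s t N) as [u [v [E1 [E2 E3]]]]. exists u, v. auto.
  - intros p [u [v E]]. exists (cov1 u v), (cov2 u v). split; [apply cov_neq0|]. now rewrite HPsi.
  - intros s t s' t' N N' E.
    destruct (HD s t N) as [u [v [E1 [E2 E3]]]]. destruct (HD s' t' N') as [u' [v' [E1' [E2' E3']]]].
    rewrite E3, E3' in E. destruct (cX_eq_cov _ _ _ _ E). split; congruence.
  - intros s t N eps He. destruct (HD s t N) as [u [v [E1 [E2 E3]]]].
    destruct (conformal_parametrization Psi u v HPsi) as [x [y [_ Q]]]. rewrite E1, E2 in Q.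
    destruct (dist3_cont_at Psi s t) with (eps := eps) as [r [Hr HR]]; auto.
    + intros k. destruct (Q k) as [Q1 _]. exact (C1pt_cont _ _ _ _ _ Q1).
    + exists r. split; auto.
  (* Continuity of the inverse: a nearby surface point has a parameter near (u, v) by
     [cX_inverse_continuous], and the covering is continuous at (u, v). *)
  - intros s t N eps He. destruct (HD s t N) as [u [v [E1 [E2 E3]]]].
    assert (CC : forall f : R -> R, (forall z, continuity_pt f z) ->
       continuity_2d_pt (fun u v => exp (cov_log u v) * f (cov_arg u v)) u v).
    { intros f Hf. apply continuity_2d_pt_mult.
      - apply continuity_1d_2d_pt_comp; [apply derivable_continuous_pt, derivable_pt_exp|].
        unfold cov_log, Rdiv. cont2d.
      - apply continuity_1d_2d_pt_comp; [apply Hf|]. unfold cov_arg, Rdiv. cont2d. }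
    assert (He2 : 0 < eps / 2) by lra.
    destruct (proj1 (continuity_2d_pt_dist _ _ _) (CC cos continuity_cos) _ He2) as [d1 [Hd1 K1]].
    destruct (proj1 (continuity_2d_pt_dist _ _ _) (CC sin continuity_sin) _ He2) as [d2 [Hd2 K2]].
    destruct (cX_inverse_continuous u v (Rmin d1 d2)) as [eta [Heta Q]]; [now apply Rmin_pos|].
    assert (M1 := Rmin_l d1 d2). assert (M2 := Rmin_r d1 d2).
    exists eta. split; auto. intros s' t' N' Hdist.
    destruct (HD s' t' N') as [u' [v' [E1' [E2' E3']]]].
    rewrite E3, E3' in Hdist. destruct (Q u' v' Hdist) as [u'' [v'' [E D']]].
    destruct (cX_eq_cov _ _ _ _ E) as [F1 F2].
    assert (L1 := K1 u'' v'' ltac:(lra)). assert (L2 := K2 u'' v'' ltac:(lra)).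
    fold (cov1 u'' v'') (cov1 u v) in L1. fold (cov2 u'' v'') (cov2 u v) in L2.
    rewrite F1, E1, E1' in L1. rewrite F2, E2, E2' in L2.
    eapply Rle_lt_trans; [apply dist2_le_abs|]. simpl. lra.
  - intros s t N. destruct (HD s t N) as [u [v [E1 [E2 E3]]]].
    destruct (conformal_parametrization Psi u v HPsi) as [x [y [_ Q]]]. rewrite E1, E2 in Q.
    replace (Yu Psi s t) with (fun k => x * cXu k u v + y * cXv k u v)
      by (apply functional_extensionality; intros j; unfold Yu; symmetry; apply Q).
    replace (Yv Psi s t) with (fun k => - y * cXu k u v + x * cXv k u v)
      by (apply functional_extensionality; intros j; unfold Yv; symmetry; apply Q).
    rewrite E3, !(gdot_lin _ (fun k => cXu k u v) (fun k => cXv k u v)).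
    destruct (cX_conformal u v) as [G1 [G2 G3]]. rewrite G1, G2, G3. split; ring.
Qed.

End Catenoid.

(** * The ordinary differential equation for phi *)

Lemma same_derive_diff (f g h : R -> R) : (forall u, is_derive f u (h u)) -> (forall u, is_derive g u (h u)) ->
  forall u v, f u - g u = f v - g v.
Proof.
  intros Hf Hg.
  assert (D : forall t, is_derive (fun u => f u - g u) t 0).
  { intros t. replace 0 with (h t - h t) by ring.
    apply (@is_derive_minus _ R_NormedModule f g); auto. }
  intros u v. destruct (Rtotal_order u v) as [L|[->|L]]; auto.
  - apply (eq_is_derive (fun u => f u - g u)); auto.
  - symmetry. apply (eq_is_derive (fun u => f u - g u)); auto.
Qed.

Lemma is_derive_reflect (f : R -> R) x l : is_derive f (- x) l -> is_derive (fun x => - f (- x)) x l.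
Proof.
  intros D. assert (E : is_derive (fun x => - x) x (- 1)) by (auto_derive; auto; ring).
  assert (K := is_derive_opp _ _ _ (is_derive_comp f (fun x => - x) x l (- 1) D E)).
  replace l with (opp (scal (- 1) l)); [exact K|]. unfold opp, scal; simpl; unfold mult; simpl. ring.
Qed.

Lemma is_derive_translate (f : R -> R) h x l : is_derive f (x + h) l -> is_derive (fun x => f (x + h)) x l.
Proof.
  intros D. assert (E : is_derive (fun x => x + h) x 1) by (auto_derive; auto; ring).
  assert (K := is_derive_comp f (fun x => x + h) x l 1 D E).
  replace l with (scal 1 l); [exact K|]. unfold scal; simpl; unfold mult; simpl. ring.
Qed.

(** Separation of variables: [Q], a primitive of 1 / w, turns both solutions into functions of slope
    -1, and it is strictly increasing, hence injective. *)
Lemma autonomous_ode_unique (w : R -> R) (f1 f2 : R -> R) :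
  (forall x, continuous w x) -> (forall x, 0 < w x) ->
  (forall u, is_derive f1 u (- w (f1 u))) -> (forall u, is_derive f2 u (- w (f2 u))) ->
  f1 0 = f2 0 -> forall u, f1 u = f2 u.
Proof.
  intros Cw Pw H1 H2 E0.
  set (Q := fun x => RInt (fun z => / w z) 0 x).
  assert (Ci : forall x, continuous (fun z => / w z) x).
  { intros x. apply (continuous_comp w Rinv); auto. apply continuous_Rinv. assert (P := Pw x). lra. }
  assert (DQ : forall x, is_derive Q x (/ w x)).
  { intros x. apply (is_derive_RInt (fun z => / w z) Q 0 x); auto.
    apply filter_forall. intros y. apply (@RInt_correct R_CompleteNormedModule), (@ex_RInt_continuous R_CompleteNormedModule). auto. }
  assert (Qi : forall x y, x < y -> Q x < Q y).
  { intros x y L. apply (incr_MVT Q (fun x => / w x)); auto. intros. now apply Rinv_0_lt_compat. }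
  assert (DC : forall f, (forall u, is_derive f u (- w (f u))) -> forall u, is_derive (fun u => Q (f u)) u (- 1)).
  { intros f Hf u. replace (- 1) with (- w (f u) * / w (f u)) by (field; assert (P := Pw (f u)); lra).
    apply (is_derive_comp Q f u); auto. }
  intros u.
  assert (E := same_derive_diff _ _ (fun _ => - 1) (DC f1 H1) (DC f2 H2) u 0). simpl in E. rewrite E0 in E.
  destruct (Rtotal_order (f1 u) (f2 u)) as [L|[L|L]]; auto; apply Qi in L; lra.
Qed.

(** Darboux's property, since [f'] is not known to be continuous. If [f'] became positive at some u
    > 0, the minimum of [f] on [0, u] would be interior and [f'] would vanish there; a reflection
    handles u < 0. *)
Lemma is_derive_pos_of_nonzero (f f' : R -> R) : (forall u, is_derive f u (f' u)) ->
  (forall u, f' u <> 0) -> f' 0 < 0 -> forall u, f' u < 0.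
Proof.
  assert (Key : forall f f' : R -> R, (forall u, is_derive f u (f' u)) -> (forall u, f' u <> 0) ->
    f' 0 < 0 -> forall u, 0 <= u -> f' u < 0).
  { clear f f'. intros f f' Hd Hn H0 u Hu.
    destruct (Rle_or_lt (f' u) 0) as [L|L]; [assert (A := Hn u); lra|exfalso].
    assert (Hu' : 0 < u) by (destruct Hu as [Hu|<-]; lra).
    assert (Hloc : forall x y, is_derive f x y -> 0 < y -> exists d, 0 < d /\ forall h, 0 < h < d ->
       f (x - h) < f x /\ f x < f (x + h)).
    { intros x y Dx Py. apply is_derive_Reals in Dx. assert (Py2 : 0 < y / 2) by lra.
      destruct (Dx _ Py2) as [d Hd']. exists d. split; [apply cond_pos|]. intros h Hh.
      assert (A1 := Hd' h ltac:(lra) ltac:(rewrite Rabs_right; lra)).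
      assert (A2 := Hd' (- h) ltac:(lra) ltac:(rewrite Rabs_Ropp, Rabs_right; lra)).
      apply Rabs_def2 in A1. apply Rabs_def2 in A2.
      assert (B1 : 0 < (f (x + h) - f x) / h) by lra.
      assert (B2 : 0 < (f (x + - h) - f x) / - h) by lra.
      replace (f (x + h)) with (f x + (f (x + h) - f x) / h * h) by (field; lra).
      replace (f (x - h)) with (f x - (f (x + - h) - f x) / - h * h)
        by (replace (x - h) with (x + - h) by ring; field; lra).
      assert (0 < (f (x + h) - f x) / h * h) by (apply Rmult_lt_0_compat; lra).
      assert (0 < (f (x + - h) - f x) / - h * h) by (apply Rmult_lt_0_compat; lra). lra. }
    destruct (continuity_ab_min f 0 u) as [m [Hm1 Hm2]]; [lra| |].
    { intros x _. exact (is_derive_continuity_pt _ _ _ (Hd x)). }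
    destruct (Req_dec m u) as [E|Nu].
    - subst m. destruct (Hloc u (f' u) (Hd u) L) as [d [Pd Q]].
      assert (M1 := Rmin_l d u). assert (M2 := Rmin_r d u). assert (M3 : 0 < Rmin d u) by now apply Rmin_pos.
      destruct (Q (Rmin d u / 2)) as [Q1 _]; [lra|].
      assert (K := Hm1 (u - Rmin d u / 2) ltac:(lra)). lra.
    - destruct (Req_dec m 0) as [E|N0].
      + subst m.
        assert (D0 := proj1 (is_derive_Reals _ _ _) (Hd 0)).
        assert (Py2 : 0 < - f' 0 / 2) by lra. destruct (D0 _ Py2) as [d Hd'].
        assert (Pd := cond_pos d).
        assert (M1 := Rmin_l d u). assert (M2 := Rmin_r d u). assert (M3 : 0 < Rmin d u) by now apply Rmin_pos.
        set (h := Rmin d u / 2). assert (Ph : 0 < h) by (unfold h; lra).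
        assert (A1 := Hd' h ltac:(lra) ltac:(rewrite Rabs_right; unfold h; lra)).
        apply Rabs_def2 in A1. assert (B1 : (f (0 + h) - f 0) / h < 0) by lra.
        assert (K := Hm1 h ltac:(unfold h; lra)). rewrite Rplus_0_l in B1.
        assert (0 <= (f h - f 0) / h) by (apply Rdiv_le_0_compat; lra). lra.
      + assert (Dm := proj1 (is_derive_Reals _ _ _) (Hd m)).
        set (pr := exist _ _ Dm : derivable_pt f m).
        apply (Hn m). rewrite <- (derive_pt_eq_0 _ _ _ pr Dm).
        apply (deriv_minimum f 0 u); try lra. intros x Hx1 Hx2. apply Hm1. lra. }
  intros Hd Hn H0 u. destruct (Rle_or_lt 0 u) as [L|L].
  - now apply (Key f f').
  - assert (K := Key (fun x => - f (- x)) (fun x => f' (- x))).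
    rewrite <- (Ropp_involutive u). apply K; auto; try lra.
    + intros x. apply is_derive_reflect, Hd.
    + now rewrite Ropp_0.
Qed.

(** With k = cos (2 theta), 4 alpha^2 P = (2 alpha^2 - (1 - k) x^2) (2 alpha^2 + (1 + k) x^2). The
    first factor stays positive up to |x| = 1 when k > 1 - 2 alpha^2, which follows from theta <
    theta^+; [m] is the product of the lower bounds 2 alpha^2 - 1 + k and 2 alpha^2, divided by 4
    alpha^2. *)
Lemma P_at_pos alpha theta : 0 < alpha -> 0 < theta -> theta < theta_plus alpha -> theta < PI / 4 ->
  0 < C_at alpha theta /\
  exists m, 0 < m /\ forall x, -1 <= x <= 1 -> m <= P_at alpha theta x.
Proof.
  intros Ha H0 Hp H4. assert (P := PI_RGT_0).
  assert (Hs : 0 < sin (2 * theta)) by (apply sin_gt_0; lra).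
  assert (Hk : 0 < cos (2 * theta)) by (apply cos_gt_0; lra).
  set (k := cos (2 * theta)) in *.
  assert (Hk1 : 1 - 2 * alpha ^ 2 < k).
  { unfold theta_plus in Hp. destruct (Rlt_dec 1 alpha) as [L|L]; [nra|].
    assert (B : -1 <= 1 - 2 * alpha ^ 2 <= 1) by nra.
    assert (Q := acos_bound (1 - 2 * alpha ^ 2)).
    rewrite <- (cos_acos (1 - 2 * alpha ^ 2)) by exact B.
    unfold k. apply cos_decreasing_1; lra. }
  split; [unfold C_at; apply Rdiv_lt_0_compat; lra|].
  assert (Ek : C_at alpha theta ^ 2 = (1 - k ^ 2) / (4 * alpha ^ 2)).
  { unfold C_at. assert (E := sin_sq (2 * theta)). fold k in E.
    transitivity (sin (2 * theta) ^ 2 / (4 * alpha ^ 2)); [field; lra|now rewrite E]. }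
  exists ((2 * alpha ^ 2 - 1 + k) / 2). split; [lra|].
  intros x Hx. unfold P_at. fold k. rewrite Ek.
  assert (Hx2 : 0 <= x ^ 2 <= 1) by nra.
  assert (A2 : 0 < alpha ^ 2) by nra.
  apply Rmult_le_reg_l with (4 * alpha ^ 2); [lra|].
  replace (4 * alpha ^ 2 * (alpha ^ 2 + k * x ^ 2 - (1 - k ^ 2) / (4 * alpha ^ 2) * x ^ 4))
    with ((2 * alpha ^ 2 - (1 - k) * x ^ 2) * (2 * alpha ^ 2 + (k + 1) * x ^ 2)) by (field; lra).
  assert (k1 : k <= 1) by (unfold k; apply COS_bound).
  replace (4 * alpha ^ 2 * ((2 * alpha ^ 2 - 1 + k) / 2)) with ((2 * alpha ^ 2 - 1 + k) * (2 * alpha ^ 2)) by field.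
  apply Rmult_le_compat; nra.
Qed.

Section FromODE.
Variables (alpha theta m : R) (phi beta G : R -> R).
Let C := C_at alpha theta.
Let k := cos (2 * theta).
Let P := P_at alpha theta.
Hypothesis al0 : 0 < alpha.
Hypothesis C0 : 0 < C.
Hypothesis m0 : 0 < m.
Hypothesis HP : forall x, -1 <= x <= 1 -> m <= P x.
Hypothesis Hphi : forall u, ex_derive phi u /\ Derive phi u ^ 2 = P (cos (phi u)).
Hypothesis phi0 : phi 0 = 0.
Hypothesis Dphi0 : Derive phi 0 <= 0.
Hypothesis Hbeta : forall u, is_derive beta u (C * cos (phi u) ^ 2).
Hypothesis beta0 : beta 0 = 0.
Hypothesis HG : forall u, is_derive G u ((C ^ 2 * cos (phi u) ^ 2 - k) / (alpha - Derive phi u)).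
Hypothesis G0 : G 0 = 0.

Definition phi_rate x := sqrt (P (cos x)).

Lemma P_cos_pos x : 0 < P (cos x).
Proof. assert (A := HP (cos x) (COS_bound x)). lra. Qed.

Lemma phi_rate_pos x : 0 < phi_rate x.
Proof. apply sqrt_lt_R0, P_cos_pos. Qed.

Lemma phi_rate_sq x : phi_rate x ^ 2 = P (cos x).
Proof. apply pow2_sqrt. assert (A := P_cos_pos x). lra. Qed.

Lemma is_derive_phi_rate x : is_derive phi_rate x ((2 * C ^ 2 * cos x ^ 3 - k * cos x) * sin x / phi_rate x).
Proof.
  assert (A := P_cos_pos x). assert (B := phi_rate_pos x).
  unfold phi_rate at 1, P, P_at. auto_derive; [exact A|].
  match goal with |- context [/ (2 * sqrt ?e)] => change (sqrt e) with (phi_rate x) end.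
  unfold C, k. field. lra.
Qed.

(** phi' never vanishes because [P] is positive on [-1, 1], so by Darboux its sign at 0 persists and
    the negative root is taken throughout. *)
Lemma Derive_phi u : Derive phi u = - phi_rate (phi u).
Proof.
  assert (N : forall u, Derive phi u < 0).
  { apply is_derive_pos_of_nonzero with phi.
    - intros x. apply Derive_correct, Hphi.
    - intros x E. assert (A := P_cos_pos (phi x)). destruct (Hphi x) as [_ B]. rewrite E in B. lra.
    - assert (A := P_cos_pos (phi 0)). destruct (Hphi 0) as [_ B].
      destruct Dphi0 as [L|L]; auto. rewrite L in B. lra. }
  assert (E : Derive phi u ^ 2 = phi_rate (phi u) ^ 2) by (rewrite phi_rate_sq; apply Hphi).
  assert (A := N u). assert (B := phi_rate_pos (phi u)). nra.
Qed.

Lemma is_derive_phi u : is_derive phi u (- phi_rate (phi u)).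
Proof. rewrite <- Derive_phi. apply Derive_correct, Hphi. Qed.

Definition dG u := (C ^ 2 * cos (phi u) ^ 2 - k) / (alpha + phi_rate (phi u)).

Lemma dG_eq u : dG u = (C ^ 2 * cos (phi u) ^ 2 - k) / (alpha - Derive phi u).
Proof. unfold dG. rewrite Derive_phi. f_equal. ring. Qed.

(** A difference of squares: with r = [phi_rate] and x = cos phi, (alpha + r) (alpha - r) = alpha^2
    - P = x^2 (C^2 x^2 - k). *)
Lemma dG_cos u : dG u * cos (phi u) ^ 2 = alpha - phi_rate (phi u).
Proof.
  assert (A := phi_rate_pos (phi u)). assert (B := phi_rate_sq (phi u)).
  unfold dG. apply Rmult_eq_reg_r with (alpha + phi_rate (phi u)); [|lra].
  transitivity (alpha ^ 2 - P (cos (phi u))); [unfold P, P_at; fold C k; field; lra|].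
  rewrite <- B. ring.
Qed.

Lemma is_derive_dG u : is_derive dG u (sin (phi u) * cos (phi u) * (C ^ 2 + dG u ^ 2)).
Proof.
  assert (A := phi_rate_pos (phi u)). assert (B := dG_cos u).
  unfold dG at 1. auto_derive;
    repeat match goal with |- _ /\ _ => split | |- True => exact I end; try lra;
    try exact (ex_intro _ _ (is_derive_phi u)); try exact (ex_intro _ _ (is_derive_phi_rate (phi u))).
  rewrite (is_derive_unique (fun x : R => phi x) _ _ (is_derive_phi u)).
  rewrite (is_derive_unique (fun x : R => phi_rate x) _ _ (is_derive_phi_rate (phi u))).
  (* The numerator is traded for h (alpha + r), then h x^2 for alpha - r; what remains is (alpha +
     r) (C^2 + h^2) over alpha + r. *)
  assert (E : C ^ 2 * cos (phi u) ^ 2 - k = dG u * (alpha + phi_rate (phi u))) by (unfold dG; field; lra).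
  set (x := cos (phi u)) in *. set (y := sin (phi u)) in *. set (r := phi_rate (phi u)) in *. set (h := dG u) in *.
  transitivity (x * y * (2 * C ^ 2 * r + (C ^ 2 * x ^ 2 - k) / (alpha + r) * (C ^ 2 * x ^ 2 + (C ^ 2 * x ^ 2 - k))) / (alpha + r)).
  { field. lra. }
  rewrite E. replace (h * (alpha + r) / (alpha + r)) with h by (field; lra).
  replace (2 * C ^ 2 * r + h * (C ^ 2 * x ^ 2 + h * (alpha + r)))
    with (2 * C ^ 2 * r + C ^ 2 * (h * x ^ 2) + h ^ 2 * (alpha + r)) by ring.
  rewrite B. field. lra.
Qed.

Lemma continuous_phi_rate x : continuous phi_rate x.
Proof. apply (@ex_derive_continuous _ R_NormedModule). exact (ex_intro _ _ (is_derive_phi_rate x)). Qed.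

Lemma phi_eq_of_ode f : (forall u, is_derive f u (- phi_rate (f u))) -> f 0 = 0 -> forall u, f u = phi u.
Proof.
  intros Hf E. apply (autonomous_ode_unique phi_rate); auto using continuous_phi_rate, phi_rate_pos, is_derive_phi.
  now rewrite phi0.
Qed.

Lemma phi_rate_cos x y : cos x ^ 2 = cos y ^ 2 -> phi_rate x = phi_rate y.
Proof.
  intros E. unfold phi_rate, P, P_at. f_equal.
  replace (cos x ^ 4) with ((cos x ^ 2) ^ 2) by ring. replace (cos y ^ 4) with ((cos y ^ 2) ^ 2) by ring.
  now rewrite E.
Qed.

(** [phi_rate] depends only on cos^2, so u -> - phi (- u) solves the same initial value problem. *)
Lemma ode_phi_odd u : phi (- u) = - phi u.
Proof.
  enough (E : - phi (- u) = phi u) by lra.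
  apply (phi_eq_of_ode (fun u => - phi (- u))); [|cbv beta; rewrite Ropp_0, phi0, Ropp_0; reflexivity].
  intros x. apply is_derive_reflect.
  rewrite (phi_rate_cos (- phi (- x)) (phi (- x))); [apply is_derive_phi|]. now rewrite cos_neg.
Qed.

(** The rate is at least sqrt m, so phi reaches - PI no later than PI / sqrt m. Adding PI leaves
    cos^2 unchanged, hence phi (u + H) + PI solves the initial value problem of phi. *)
Lemma ode_half_period : exists H, 0 < H /\ phi H = - PI /\ forall u, phi (u + H) = phi u - PI.
Proof.
  assert (PP := PI_RGT_0).
  assert (Sm := sqrt_lt_R0 _ m0).
  assert (Lb : forall x, sqrt m <= phi_rate x).
  { intros x. apply sqrt_le_1_alt, HP, COS_bound. }
  set (U := PI / sqrt m). assert (PU : 0 < U) by (unfold U; apply Rdiv_lt_0_compat; lra).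
  assert (LU : phi U <= - PI).
  { destruct (MVT_cor2 phi (fun u => - phi_rate (phi u)) 0 U PU) as [c [E _]].
    - intros c _. apply is_derive_Reals, is_derive_phi.
    - rewrite phi0 in E. assert (L := Lb (phi c)).
      assert (sqrt m * U <= phi_rate (phi c) * U) by (apply Rmult_le_compat_r; lra).
      assert (sqrt m * U = PI) by (unfold U; field; lra). lra. }
  destruct (IVT_gen phi 0 U (- PI)) as [H [HH EH]].
  { intros x. exact (is_derive_continuity_pt _ _ _ (is_derive_phi x)). }
  { rewrite phi0. rewrite Rmin_right, Rmax_left by lra. lra. }
  rewrite Rmin_left, Rmax_right in HH by lra.
  assert (H <> 0) by (intros ->; rewrite phi0 in EH; lra).
  exists H. split; [lra|]. split; auto. intros u.
  enough (E : phi (u + H) + PI = phi u) by lra.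
  apply (phi_eq_of_ode (fun u => phi (u + H) + PI)); [|cbv beta; rewrite Rplus_0_l, EH; apply Rplus_opp_l].
  intros x. rewrite (phi_rate_cos (phi (x + H) + PI) (phi (x + H))); [|rewrite neg_cos; ring].
  replace (- phi_rate (phi (x + H))) with (- phi_rate (phi (x + H)) + 0) by ring.
  apply (@is_derive_plus _ R_NormedModule (fun u => phi (u + H)) (fun _ => PI)).
  - apply is_derive_translate, is_derive_phi.
  - apply @is_derive_const.
Qed.

Lemma is_derive_G u : is_derive G u (dG u).
Proof. rewrite dG_eq. apply HG. Qed.

Lemma dG_even u : dG (- u) = dG u.
Proof. unfold dG. rewrite ode_phi_odd, cos_neg, (phi_rate_cos (- phi u) (phi u)); auto. now rewrite cos_neg. Qed.

Lemma odd_primitive (f f' : R -> R) : (forall u, is_derive f u (f' u)) -> (forall u, f' (- u) = f' u) ->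
  f 0 = 0 -> forall u, f (- u) = - f u.
Proof.
  intros Hf He E u.
  assert (Q := same_derive_diff (fun u => - f (- u)) f f').
  assert (K : forall u v, - f (- u) - f u = - f (- v) - f v).
  { apply Q; auto. intros x. apply is_derive_reflect. rewrite <- He. apply Hf. }
  assert (K0 := K u 0). rewrite Ropp_0, E in K0. lra.
Qed.

Lemma periodic_primitive (f f' : R -> R) H : (forall u, is_derive f u (f' u)) -> (forall u, f' (u + H) = f' u) ->
  f 0 = 0 -> forall u, f (u + H) = f u + f H.
Proof.
  intros Hf He E u.
  assert (K : forall u v, f (u + H) - f u = f (v + H) - f v).
  { apply (same_derive_diff (fun u => f (u + H)) f f'); auto.
    intros x. apply is_derive_translate. rewrite <- He. apply Hf. }
  assert (K0 := K u 0). rewrite Rplus_0_l, E in K0. lra.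
Qed.

(** * The integral L and the closing condition *)

Let J u := alpha * G u + C * beta u.

Lemma is_derive_J u : is_derive J u (alpha * dG u + C * (C * cos (phi u) ^ 2)).
Proof.
  unfold J. auto_derive.
  - split; [exact (ex_intro _ _ (is_derive_G u))|]. split; [exact (ex_intro _ _ (Hbeta u))|exact I].
  - rewrite (is_derive_unique (fun x : R => G x) _ _ (is_derive_G u)), (is_derive_unique (fun x : R => beta x) _ _ (Hbeta u)). ring.
Qed.

Lemma L_integrand_continuous x : -1 < x < 1 -> continuous (L_integrand alpha theta) x.
Proof.
  intros Hx. assert (A := HP x ltac:(lra)). unfold P in A.
  assert (B : 0 < 1 - x ^ 2) by nra.
  assert (D : 0 < (1 - x ^ 2) * P_at alpha theta x) by (apply Rmult_lt_0_compat; lra).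
  assert (S1 := sqrt_lt_R0 _ D). assert (S2 : 0 < sqrt (P_at alpha theta x)) by (apply sqrt_lt_R0; lra).
  apply (@ex_derive_continuous _ R_NormedModule). unfold L_integrand, P_at in *. auto_derive.
  assert (Hd : 0 < sqrt ((1 - x ^ 2) * (alpha ^ 2 + cos (2 * theta) * x ^ 2 - C_at alpha theta ^ 2 * x ^ 4)) *
     (alpha + sqrt (alpha ^ 2 + cos (2 * theta) * x ^ 2 - C_at alpha theta ^ 2 * x ^ 4))).
  { apply Rmult_lt_0_compat; lra. }
  unfold Rminus in *.
  repeat split; try lra; simpl in *; try lra.
Qed.

(* The substitution [x = cos phi] turns the integrand of [L] into [- J']. *)
Lemma RInt_L H a b : (forall u, 0 < u < H -> - PI < phi u < 0) -> 0 < a < H -> 0 < b < H ->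
  RInt (L_integrand alpha theta) (cos (phi a)) (cos (phi b)) = J a - J b.
Proof.
  intros Hr Ha Hb.
  assert (Hin : forall x, Rmin a b <= x <= Rmax a b -> 0 < x < H).
  { intros x. unfold Rmin, Rmax. destruct Rle_dec; lra. }
  assert (Hc : forall u, 0 < u < H -> sin (phi u) < 0 /\ -1 < cos (phi u) < 1).
  { intros u Hu. specialize (Hr u Hu).
    assert (S : 0 < sin (- phi u)) by (apply sin_gt_0; lra). rewrite sin_neg in S.
    assert (E := sin_sq (phi u)). assert (CB := COS_bound (phi u)). split; [lra|]. nra. }
  assert (Q := is_RInt_comp (L_integrand alpha theta) (fun u => cos (phi u)) (fun u => sin (phi u) * phi_rate (phi u)) a b).
  assert (I1 : is_RInt (fun y => scal (sin (phi y) * phi_rate (phi y)) (L_integrand alpha theta (cos (phi y)))) a b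
    (RInt (L_integrand alpha theta) (cos (phi a)) (cos (phi b)))).
  { apply Q.
    - intros x Hx. apply L_integrand_continuous. now apply Hc, Hin.
    - intros x Hx. split.
      + auto_derive; [exact (ex_intro _ _ (is_derive_phi x))|].
        rewrite (is_derive_unique (fun x : R => phi x) _ _ (is_derive_phi x)). ring.
      + apply (@ex_derive_continuous _ R_NormedModule). auto_derive.
        repeat match goal with |- _ /\ _ => split | |- True => exact I end;
          first [exact (ex_intro _ _ (is_derive_phi x)) | exact (ex_intro _ _ (is_derive_phi_rate (phi x)))]. }
  assert (I2 : is_RInt (fun y => opp (alpha * dG y + C * (C * cos (phi y) ^ 2))) a b (opp (J b - J a))).
  { apply @is_RInt_opp. apply (@is_RInt_derive R_CompleteNormedModule J).
    - intros x _. apply is_derive_J.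
    - intros x _. apply (@ex_derive_continuous _ R_NormedModule). auto_derive.
      repeat match goal with |- _ /\ _ => split | |- True => exact I end;
        first [exact (ex_intro _ _ (is_derive_dG x)) | exact (ex_intro _ _ (is_derive_phi x))]. }
  assert (I3 : is_RInt (fun y => opp (alpha * dG y + C * (C * cos (phi y) ^ 2))) a b
    (RInt (L_integrand alpha theta) (cos (phi a)) (cos (phi b)))).
  { revert I1. apply is_RInt_ext. intros x Hx. specialize (Hin x ltac:(lra)).
    destruct (Hc x Hin) as [S1 S2].
    assert (Rp := phi_rate_pos (phi x)). assert (Pp := P_cos_pos (phi x)).
    unfold scal, opp; simpl; unfold mult; simpl.
    unfold L_integrand. fold C. change (P_at alpha theta (cos (phi x))) with (P (cos (phi x))).
    change (sqrt (P (cos (phi x)))) with (phi_rate (phi x)).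
    (* sin phi is negative on (- PI, 0), hence the minus sign. *)
    assert (Es : sqrt ((1 - cos (phi x) ^ 2) * P (cos (phi x))) = - sin (phi x) * phi_rate (phi x)).
    { rewrite sqrt_mult_alt by nra. fold (phi_rate (phi x)). f_equal.
      rewrite <- sin_sq. replace (sin (phi x) ^ 2) with ((- sin (phi x)) ^ 2) by ring. apply sqrt_pow2. lra. }
    rewrite Es. unfold dG. fold k. field. lra. }
  assert (U1 := is_RInt_unique _ _ _ _ I2). assert (U2 := is_RInt_unique _ _ _ _ I3).
  rewrite <- U2, U1. unfold opp; simpl. ring.
Qed.

(** The integrand is singular at x = -1 and x = 1, so the substitution is made between interior
    points and the limits are taken afterwards: x -> -1 is u -> H, and x -> 1 is u -> 0, so that L =
    J H - J 0. *)
Lemma J_half_period H : 0 < H -> phi H = - PI -> L_vanishes alpha theta -> J H = 0.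
Proof.
  intros H0 EH HL.
  assert (PP := PI_RGT_0).
  assert (Hdec : forall u v, u < v -> phi v < phi u).
  { intros u v L. apply Ropp_lt_cancel.
    apply (incr_MVT (fun u => - phi u) (fun u => - - phi_rate (phi u))); auto.
    - intros x _. apply (@is_derive_opp _ R_NormedModule phi), is_derive_phi.
    - intros x _. assert (A := phi_rate_pos (phi x)). lra. }
  assert (Hr : forall u, 0 < u < H -> - PI < phi u < 0).
  { intros u [L1 L2]. apply Hdec in L1. apply Hdec in L2. lra. }
  assert (J0 : J 0 = 0) by (unfold J; rewrite G0, beta0; ring).
  assert (CJ : forall x, continuity_pt J x) by (intros x; exact (is_derive_continuity_pt _ _ _ (is_derive_J x))).
  assert (CX : forall x, continuity_pt (fun u => cos (phi u)) x).
  { intros x. apply (continuity_pt_comp phi cos); [exact (is_derive_continuity_pt _ _ _ (is_derive_phi x))|apply continuity_cos]. }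
  assert (Hb : forall u, 0 < u < H -> -1 < cos (phi u) < 1).
  { intros u Hu. specialize (Hr u Hu).
    assert (S : 0 < sin (- phi u)) by (apply sin_gt_0; lra). rewrite sin_neg in S.
    assert (E := sin_sq (phi u)). assert (CB := COS_bound (phi u)). nra. }
  (* The filters at the two ends exclude the end points, so points strictly inside (0, H) are needed
     at which both [J] and cos phi are close to their limits. *)
  assert (Near : forall x0 d, x0 = 0 \/ x0 = H -> 0 < d -> exists u, 0 < u < H /\
     Rabs (J u - J x0) < d /\ Rabs (cos (phi u) - cos (phi x0)) < d).
  { intros x0 d Hx Hd.
    destruct (CJ x0 d Hd) as [d1 [P1 Q1]]. destruct (CX x0 d Hd) as [d2 [P2 Q2]].
    assert (M0 : 0 < Rmin (Rmin d1 d2) H) by (repeat apply Rmin_pos; lra).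
    set (h := Rmin (Rmin d1 d2) H / 2).
    assert (h1 : h < d1) by (unfold h; assert (A1 := Rmin_l (Rmin d1 d2) H); assert (A2 := Rmin_l d1 d2); lra).
    assert (h2 : h < d2) by (unfold h; assert (A1 := Rmin_l (Rmin d1 d2) H); assert (A2 := Rmin_r d1 d2); lra).
    assert (h3 : 0 < h < H) by (unfold h; assert (A1 := Rmin_r (Rmin d1 d2) H); lra).
    assert (Ex : exists u, 0 < u < H /\ u <> x0 /\ Rabs (u - x0) = h).
    { destruct Hx as [-> | ->].
      - exists h. split; [lra|]. split; [lra|]. rewrite Rminus_0_r, Rabs_right; lra.
      - exists (H - h). split; [lra|]. split; [lra|].
        replace (H - h - H) with (- h) by ring. rewrite Rabs_Ropp, Rabs_right; lra. }
    destruct Ex as [u [Hu [Nu Eu]]]. exists u. split; auto. split.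
    - apply Q1. split; [split; [exact I|now apply not_eq_sym]|]. simpl; unfold R_dist. lra.
    - apply Q2. split; [split; [exact I|now apply not_eq_sym]|]. simpl; unfold R_dist. lra. }
  apply Rabs_eq_0. apply Rle_antisym; [|apply Rabs_pos]. apply le_epsilon. intros e He. rewrite Rplus_0_l.
  assert (He3 : 0 < e / 3) by lra.
  destruct (HL (fun y => Rabs y < e / 3)) as [Qa Qb [da Ha] [db Hb'] Hab].
  { exists (mkposreal _ He3). intros y Hy. unfold ball in Hy; simpl in Hy. unfold AbsRing_ball, abs, minus, plus, opp in Hy; simpl in Hy.
    now rewrite Ropp_0, Rplus_0_r in Hy. }
  assert (Pa : 0 < Rmin (e / 3) da) by (apply Rmin_pos; auto; apply cond_pos).
  assert (Pb : 0 < Rmin (e / 3) db) by (apply Rmin_pos; auto; apply cond_pos).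
  destruct (Near H _ (or_intror eq_refl) Pa) as [a [Ia [Ja Xa]]].
  destruct (Near 0 _ (or_introl eq_refl) Pb) as [b [Ib [Jb Xb]]].
  rewrite EH, cos_neg, cos_PI in Xa. rewrite phi0, cos_0 in Xb. rewrite J0 in Jb.
  assert (A1 := Rmin_l (e / 3) da). assert (A2 := Rmin_r (e / 3) da).
  assert (B1 := Rmin_l (e / 3) db). assert (B2 := Rmin_r (e / 3) db).
  destruct (Hab (cos (phi a)) (cos (phi b))) as [y [Iy Hy]].
  { apply Ha; [|apply Hb; auto]. unfold ball; simpl; unfold AbsRing_ball, abs, minus, plus, opp; simpl.
    unfold Rminus in Xa. lra. }
  { apply Hb'; [|apply Hb; auto]. unfold ball; simpl; unfold AbsRing_ball, abs, minus, plus, opp; simpl.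
    unfold Rminus in Xb. lra. }
  simpl in Iy. apply (@is_RInt_unique R_CompleteNormedModule) in Iy. rewrite (RInt_L H a b Hr Ia Ib) in Iy. subst y.
  apply Rabs_def2 in Hy. assert (Ja' : Rabs (J a - J H) < e / 3) by lra. assert (Jb' : Rabs (J b - 0) < e / 3) by lra.
  apply Rabs_def2 in Ja'. apply Rabs_def2 in Jb'. apply Rabs_le. lra.
Qed.

End FromODE.

Theorem theorem5p6 (alpha theta : R) (phi beta G : R -> R) :
  0 < alpha ->
  is_theta_tilde alpha theta ->
  (* phi'^2 = P(cos phi), phi(0) = 0, phi'(0) <= 0 *)
  (forall u, ex_derive phi u /\ (Derive phi u) ^ 2 = P_at alpha theta (cos (phi u))) ->
  phi 0 = 0 -> Derive phi 0 <= 0 ->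
  (* beta' = C cos^2 phi, beta(0) = 0 *)
  (forall u, is_derive beta u (C_at alpha theta * cos (phi u) ^ 2)) -> beta 0 = 0 ->
  (* G' = (C^2 cos^2 phi - cos 2theta) / (alpha - phi'), G(0) = 0 *)
  (forall u, is_derive G u
     ((C_at alpha theta ^ 2 * cos (phi u) ^ 2 - cos (2 * theta)) / (alpha - Derive phi u))) ->
  G 0 = 0 ->
  let X := X_map alpha theta phi beta G in
  let S := image X in
  (* minimal annulus (annulus: see item 4) *)
  minimal_immersion X /\
  (* 1. sections by vertical planes {x2 = c} *)
  (forall c, (exists y, section S c y) /\
             closed_embedded_curve (section S c) /\ convex_curve (section S c)) /\
  (* 2. properly embedded *)
  properly_embedded S /\
  (* 3. symmetries and the x2-axis inside *)
  (forall p, S p -> S (rot1 p)) /\ (forall p, S p -> S (rot2 p)) /\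
  (forall p, S p -> S (rot3 p)) /\
  (forall c, enclosed_by_convex_curve (section S c) (0, 0)) /\
  (* 4. conformal type *)
  conformal_to_punctured_plane S.
Proof.
  intros al0 [th0 [thp [th4 HL]]] Hphi phi0 Dphi0 Hbeta beta0 HG G0 X S.
  destruct (P_at_pos alpha theta al0 th0 thp th4) as [C0 [m [m0 HP]]].
  destruct (ode_half_period alpha theta m phi m0 HP Hphi phi0 Dphi0) as [H [H0 [EH phi_shift]]].
  assert (JH := J_half_period alpha theta m phi beta G al0 m0 HP Hphi phi0 Dphi0 Hbeta beta0 HG G0 H H0 EH HL).
  set (C := C_at alpha theta) in *.
  set (g := dG alpha theta phi).
  assert (Dphi : forall u, is_derive phi u (g u * cos (phi u) ^ 2 - alpha)).
  { intros u. unfold g. rewrite (dG_cos alpha theta m phi al0 m0 HP).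
    replace (alpha - phi_rate alpha theta (phi u) - alpha) with (- phi_rate alpha theta (phi u)) by ring.
    exact (is_derive_phi alpha theta m phi m0 HP Hphi Dphi0 u). }
  assert (Dg : forall u, is_derive g u (sin (phi u) * cos (phi u) * (C ^ 2 + g u ^ 2)))
    by exact (is_derive_dG alpha theta m phi al0 m0 HP Hphi Dphi0).
  assert (DG : forall u, is_derive G u (g u))
    by exact (is_derive_G alpha theta m phi G m0 HP Hphi Dphi0 HG).
  assert (phi_decr : forall u, g u * cos (phi u) ^ 2 - alpha < 0).
  { intros u. unfold g. rewrite (dG_cos alpha theta m phi al0 m0 HP).
    assert (A := phi_rate_pos alpha theta m m0 HP (phi u)). lra. }
  assert (phi_odd := ode_phi_odd alpha theta m phi m0 HP Hphi phi0 Dphi0).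
  assert (g_even : forall u, g (- u) = g u)
    by exact (dG_even alpha theta m phi m0 HP Hphi phi0 Dphi0).
  assert (cos_shift2 : forall u, cos (phi (u + H)) ^ 2 = cos (phi u) ^ 2).
  { intros u. rewrite phi_shift, cos_minus, cos_PI, sin_PI. ring. }
  assert (g_shift : forall u, g (u + H) = g u).
  { intros u. unfold g, dG. now rewrite cos_shift2, (phi_rate_cos alpha theta _ _ (cos_shift2 u)). }
  assert (beta_odd : forall u, beta (- u) = - beta u).
  { apply (odd_primitive beta _ Hbeta); auto. intros u. now rewrite phi_odd, cos_neg. }
  assert (beta_shift : forall u, beta (u + H) = beta u + beta H).
  { apply (periodic_primitive beta _ H Hbeta); auto. intros u. now rewrite cos_shift2. }
  assert (G_odd : forall u, G (- u) = - G u) by now apply (odd_primitive G _ DG).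
  (* [JH] says that the increments of alpha G and C beta over [H] cancel; each increment is
     independent of u. *)
  assert (period : forall u, alpha * G (u + H) + C * beta (u + H) = alpha * G u + C * beta u).
  { intros u. rewrite beta_shift, (periodic_primitive G _ H DG g_shift G0 u).
    unfold C in JH |- *. lra. }
  assert (EX : X = cX alpha C phi g beta G).
  { apply functional_extensionality; intros u. apply functional_extensionality; intros v.
    unfold X, X_map, cX, cx3, cx1, cx2. now rewrite (is_derive_unique _ _ _ (DG u)). }
  unfold S. rewrite EX. clear X S EX.
  split; [now apply cX_minimal|].
  split; [|split; [split|split; [|split; [|split; [|split]]]]].
  - intros a. split; [|split].
    + exists (y1 alpha C phi g beta G a 0, y2 alpha C phi g beta G a 0).
      apply section_cX; auto. now exists 0.
    + now apply section_closed_embedded with H.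
    + now apply section_convex with H.
  - now apply cX_embedded with H.
  - now apply cX_closed with H.
  - intros p. now apply image_rot1 with H.
  - intros p. now apply image_rot2 with H.
  - intros p. now apply image_rot3.
  - intros a. now apply section_enclosed with H.
  - now apply cX_conformal_to_punctured_plane with H.
Qed.
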